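(* Let $F$ be a compactly supported distribution on $\mathbb{C}^d$. Consider the infinite matrix $\mathbf{A}_F=(a_{\alpha\beta})_{\alpha,\beta\in\mathbb{Z}_+^d}$ with $a_{\alpha\beta}=\langle F,Z^\alpha\bar Z^\beta\rangle$, $Z=(z_1,\dots,z_d)$. Suppose that $\mathbf{A}_F$ has finite rank $m$. Then $\operatorname{supp}F$ consists of at most $m$ points, and $F=\sum_q L_q\delta(Z-Z_q)$, where $Z_q\in\mathbb{C}^d$ are points and $L_q$ are linear differential operators with constant coefficients.
   Context: $Z^\alpha=z_1^{\alpha_1}\cdots z_d^{\alpha_d}$, $\bar Z^\beta=\bar z_1^{\beta_1}\cdots\bar z_d^{\beta_d}$; $\langle F,\phi\rangle$ denotes the action of $F$ on a smooth function $\phi$. *)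

(* Defs.v *)
From HB Require Import structures.
From mathcomp Require Import all_boot all_order all_algebra.
From mathcomp Require Import all_classical all_reals all_analysis.
From mathcomp Require Import complex.
Set Implicit Arguments. Unset Strict Implicit. Unset Printing Implicit Defensive.
Import Order.TTheory GRing.Theory Num.Theory.
Import numFieldNormedType.Exports.
Local Open Scope classical_set_scope.
Local Open Scope ring_scope.
Local Open Scope complex_scope.

Section Distributions.
Variable R : realType.

(* We identify C^d with R^(2d) = 'rV[R]_(d + d): the point x corresponds to
   z_j = x_j + i x_(d+j). *)

Definition evec n (i : 'I_n) : 'rV[R]_n := delta_mx 0 i.

Fixpoint iterD n (s : seq 'I_n) (f : 'rV[R]_n -> R) : 'rV[R]_n -> R :=
  match s with
  | [::] => f
  | i :: s' => fun x => 'D_(evec i) (iterD s' f) x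
  end.

Definition smoothR n (f : 'rV[R]_n -> R) : Prop :=
  forall s : seq 'I_n, continuous (iterD s f) /\
    forall (i : 'I_n) (x : 'rV[R]_n), derivable (iterD s f) x (evec i).

Definition smoothC n (phi : 'rV[R]_n -> R[i]) : Prop :=
  smoothR (fun x => complex.Re (phi x)) /\ smoothR (fun x => complex.Im (phi x)).

Definition iterDC n (s : seq 'I_n) (phi : 'rV[R]_n -> R[i]) : 'rV[R]_n -> R[i] :=
  fun x => (iterD s (fun y => complex.Re (phi y)) x) +i* (iterD s (fun y => complex.Im (phi y)) x).

(* A compactly supported distribution on R^n (an element of E'(R^n)): a
   C-linear functional on complex-valued smooth functions which is continuous
   for the C^infinity topology, i.e. bounded by finitely many derivatives on a
   compact set (here a ball of radius r around 0). *)
Definition comp_supp_distribution n (F : ('rV[R]_n -> R[i]) -> R[i]) : Prop :=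
  (forall (a : R[i]) (phi psi : 'rV[R]_n -> R[i]), smoothC phi -> smoothC psi ->
     F (fun x => a * phi x + psi x) = a * F phi + F psi) /\
  exists (r C : R) (N : nat), forall phi : 'rV[R]_n -> R[i], smoothC phi ->
    forall M : R,
      (forall s : seq 'I_n, (size s <= N)%N ->
         forall x : 'rV[R]_n, `|x| <= r -> Normc.normc (iterDC s phi x) <= M) ->
      Normc.normc (F phi) <= C * M.

Definition dsupport n (F : ('rV[R]_n -> R[i]) -> R[i]) : set 'rV[R]_n :=
  [set x | ~ exists eps : R, 0 < eps /\
      forall phi : 'rV[R]_n -> R[i], smoothC phi ->
        (forall y, eps <= `|y - x| -> phi y = 0) -> F phi = 0].

Definition zc d (j : 'I_d) (x : 'rV[R]_(d + d)) : R[i] :=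
  x 0 (lshift d j) +i* x 0 (rshift d j).
Definition zbc d (j : 'I_d) (x : 'rV[R]_(d + d)) : R[i] :=
  x 0 (lshift d j) -i* x 0 (rshift d j).

Definition monomZ d (alpha beta : 'I_d -> nat) (x : 'rV[R]_(d + d)) : R[i] :=
  \prod_(j < d) (zc j x ^+ alpha j * zbc j x ^+ beta j).

Definition AF d (F : ('rV[R]_(d + d) -> R[i]) -> R[i])
  (alpha beta : 'I_d -> nat) : R[i] := F (monomZ alpha beta).

Definition inf_rank (I : Type) (A : I -> I -> R[i]) (m : nat) : Prop :=
  (forall (k : nat) (rows cols : 'I_k -> I),
      (\rank (\matrix_(i < k, j < k) A (rows i) (cols j)) <= m)%N) /\
  (exists (k : nat) (rows cols : 'I_k -> I),
      \rank (\matrix_(i < k, j < k) A (rows i) (cols j)) = m).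

End Distributions.

(* Main.v *)
(* Finite rank splits the moments as [<F, Z^a Zbar^b> = sum_j u_j(a) v_j(b)] with [m] terms, so
   [<F, Z^a Zbar^b exp(t z_i - conj(t z_i))> = sum_j u_(a,j)(t) v_(j,b)(- conj t)] with [u], [v]
   entire in [t].  As the exponential has modulus 1, the left-hand side grows polynomially in [t],
   with a degree that does not depend on [a] and [b].  The [m x m] determinants of both sides show
   that (holomorphic) * (antiholomorphic), hence by Liouville a product of two entire functions, is
   a polynomial of uniformly bounded degree; by Cramer's rule the functions [u_(a,j)], [a] varying,
   are then governed by a finite-dimensional family, which yields [p != 0] with [p(z_i) F = 0] on
   polynomials.  Polynomials being dense in C^infinity, [p(z_i) F = 0], and likewise
   [conj(q(z_i)) F = 0].

   Idempotents of [C[T]/(P)] cut [F] into pieces [e_q F] killed by powers of [z_i - q_i].  If such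
   a piece is also killed by a function [v] with [v(q) <> 0], then it vanishes, because
   [|z_i - q_i|^(2k) + |v|^2] is invertible; hence it is killed by powers of [conj (z_i - q_i)] as
   well, and is a finite combination of derivatives at [q].  Finally the functions [e_q Z^a] and
   [conj (e_q') Zbar^b] make the moment matrix diagonal, so at most [m] pieces are nonzero. *)

Require Import Defs.
From HB Require Import structures.
From mathcomp Require Import all_boot all_order all_algebra.
From mathcomp Require Import all_classical all_reals all_analysis.
From mathcomp Require Import complex ring lra perm cyclic separable cyclotomic.
Import Order.TTheory GRing.Theory Num.Theory.
Import numFieldNormedType.Exports.
Set Implicit Arguments. Unset Strict Implicit. Unset Printing Implicit Defensive.
Local Open Scope classical_set_scope.
Local Open Scope ring_scope.
Local Open Scope complex_scope.
Local Notation iterD := (@Defs.iterD _ _).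

(** * Smooth functions and distributions *)

(** No complex analysis and no cutoff functions are used. The exponentials are truncated to
    [texp N], so that [F] is only evaluated on polynomials in [z] and [conj z], entire functions
    become polynomials known modulo [X^N], and Liouville's theorem becomes Cauchy's inequality for
    polynomials, which is a finite average over roots of unity.

    The obstacle is the order of choices: a product of truncated exponentials is close to a function
    of modulus 1 only for bounded [t], so the truncation [N] must depend on the radius [rho], while
    Liouville's argument lets [rho] grow. This is harmless because the coefficient of [X^k] is the
    same for all truncations [N > k].

    The growth exponent has to be independent of the rows since Cramer's rule replaces one chosen
    row by an arbitrary [a]; only then does one linear relation serve all [a] at once. *)

Section RealCalculus.
Variables (R : realType) (n : nat).
Local Notation X := 'rV[R]_n.
Implicit Types f g : X -> R.

(* Sealed, so that unification never unfolds a derivative to a limit. *)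
Fact Dr_subproof : {D : 'I_n -> (X -> R) -> X -> R |
  forall i f, D i f = fun x => 'D_(evec R i) f x}.
Proof. by exists (fun i f x => 'D_(evec R i) f x). Qed.

Definition Dr : 'I_n -> (X -> R) -> X -> R := sval Dr_subproof.

Lemma DrP i f x : Dr i f x = 'D_(evec R i) f x.
Proof. by rewrite /Dr (svalP Dr_subproof). Qed.

Lemma iterD_cons i s f : iterD (i :: s) f = Dr i (iterD s f).
Proof. by apply/funext => x; rewrite DrP. Qed.

Lemma iterD_rcons s i f : iterD (rcons s i) f = iterD s (Dr i f).
Proof.
elim: s => [|j s ih]; first exact: iterD_cons.
by rewrite rcons_cons !iterD_cons ih.
Qed.

Lemma iterD_cat s t f : iterD (s ++ t) f = iterD s (iterD t f).
Proof. by elim: s => //= j s ->. Qed.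

(* A sealed copy of [smoothR]: unification never unfolds an inductive type. *)
Variant smooth f : Prop := Smooth of smoothR f.

(** Smoothness as a greatest fixed point: a class of continuous, partially differentiable functions
    that is stable under [Dr] consists of smooth functions. Each closure property below then only
    needs a suitable stable class, with no formula for iterated derivatives. *)
Lemma smooth_coind (P : (X -> R) -> Prop) :
  (forall f, P f -> continuous f /\
     forall i, (forall x, derivable f x (evec R i)) /\ P (Dr i f)) ->
  forall f, P f -> smooth f.
Proof.
move=> H f Pf; have HP s : P (iterD s f).
  by elim: s => // i s /H[_ /(_ i)[_]]; rewrite iterD_cons.
by split=> s; have [c d] := H _ (HP s); split => // i x; have [] := d i.
Qed.

Lemma smooth_cont f : smooth f -> continuous f.
Proof. by case=> /(_ [::])[]. Qed.
Arguments smooth_cont {f} _ x.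

Lemma smooth_derivable f i x : smooth f -> derivable f x (evec R i).
Proof. by case=> /(_ [::])[_]; apply. Qed.
Arguments smooth_derivable {f} i x _.

Lemma smooth_Dr f i : smooth f -> smooth (Dr i f).
Proof. by case=> sf; split=> s; rewrite -iterD_rcons; apply: sf. Qed.

Lemma smooth_iterD f s : smooth f -> smooth (iterD s f).
Proof. by case=> sf; split=> t; rewrite -iterD_cat; apply: sf. Qed.

Lemma Dr_cst i (c : R) : Dr i (fun=> c) = (fun=> 0).
Proof. by apply/funext => x; rewrite DrP; apply: derive_cst. Qed.

Lemma smooth_cst (c : R) : smooth ((fun=> c) : X -> R).
Proof.
apply: (@smooth_coind (fun f => exists c : R, f = fun=> c)); last by exists c.
move=> _ [a ->]; split; first by move=> x; apply: cst_continuous.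
by move=> i; split; [move=> x; apply: derivable_cst | exists 0; apply: Dr_cst].
Qed.

Lemma DrD f g i : smooth f -> smooth g ->
  Dr i (fun x => f x + g x) = fun x => Dr i f x + Dr i g x.
Proof.
by move=> sf sg; apply/funext => x; rewrite !DrP; apply: deriveD; apply: smooth_derivable.
Qed.

Lemma smoothD f g : smooth f -> smooth g -> smooth (fun x => f x + g x).
Proof.
move=> sf sg; apply: (@smooth_coind (fun h => exists f g,
  [/\ smooth f, smooth g & h = fun x => f x + g x])); last by exists f, g.
move=> _ {f g sf sg} [f [g [sf sg ->]]]; split.
  by move=> x; exact: (continuousD (smooth_cont sf x) (smooth_cont sg x)).
move=> i; split; first by move=> x; apply: derivableD; apply: smooth_derivable.
by exists (Dr i f), (Dr i g); split; [exact: smooth_Dr.. | exact: DrD].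
Qed.

Lemma DrZ f (c : R) i : smooth f ->
  Dr i (fun x => c * f x) = fun x => c * Dr i f x.
Proof.
by move=> sf; apply/funext => x; rewrite !DrP; apply: deriveZ; apply: smooth_derivable.
Qed.

Lemma smoothZ f (c : R) : smooth f -> smooth (fun x => c * f x).
Proof.
move=> sf; apply: (@smooth_coind (fun h => exists2 f,
  smooth f & h = fun x => c * f x)); last by exists f.
move=> _ {f sf} [f sf ->]; split.
  by move=> x; exact: (continuousM (@cst_continuous _ _ c x) (smooth_cont sf x)).
move=> i; split.
  by move=> x; apply: derivableZ; apply: smooth_derivable.
by exists (Dr i f); [exact: smooth_Dr | exact: DrZ].
Qed.

Lemma DrN f i : smooth f -> Dr i (fun x => - f x) = fun x => - Dr i f x.
Proof.
by move=> sf; apply/funext => x; rewrite !DrP; apply: deriveN; apply: smooth_derivable.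
Qed.

Lemma smoothN f : smooth f -> smooth (fun x => - f x).
Proof.
move=> sf; rewrite (_ : (fun _ => _) = fun x => -1 * f x); last first.
  by apply/funext => x; rewrite mulN1r.
exact: smoothZ.
Qed.

Lemma smoothB f g : smooth f -> smooth g -> smooth (fun x => f x - g x).
Proof. by move=> sf sg; apply: smoothD => //; apply: smoothN. Qed.

Lemma DrB f g i : smooth f -> smooth g ->
  Dr i (fun x => f x - g x) = fun x => Dr i f x - Dr i g x.
Proof. by move=> sf sg; rewrite DrD ?DrN //; apply: smoothN. Qed.

Lemma DrM f g i : smooth f -> smooth g ->
  Dr i (fun x => f x * g x) = fun x => Dr i f x * g x + f x * Dr i g x.
Proof.
move=> sf sg; apply/funext => x; rewrite !DrP [LHS]deriveM; last 2 first.
  - exact: smooth_derivable.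
  - exact: smooth_derivable.
by rewrite addrC; congr (_ + _); exact: mulrC.
Qed.

(** Products alone are not stable under [Dr]: Leibniz' rule yields a sum of two products. This is
    the smallest stable class that contains them. *)
Inductive sumprod : (X -> R) -> Prop :=
| SumprodM f g : smooth f -> smooth g -> sumprod (fun x => f x * g x)
| SumprodD f g : sumprod f -> sumprod g -> sumprod (fun x => f x + g x).

Lemma smoothM f g : smooth f -> smooth g -> smooth (fun x => f x * g x).
Proof.
move=> sf sg; apply: (@smooth_coind sumprod); last exact: SumprodM.
move=> h; elim=> {f g sf sg h}.
  move=> f g sf sg; split.
    by move=> x; exact: (continuousM (smooth_cont sf x) (smooth_cont sg x)).
  move=> i; split.
    by move=> x; apply: derivableM; apply: smooth_derivable.
  rewrite DrM//; apply: SumprodD; apply: SumprodM => //; exact: smooth_Dr.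
move=> f g _ [cf df] _ [cg dg]; split; first by move=> x; exact: (continuousD (cf x) (cg x)).
move=> i; have [df1 df2] := df i; have [dg1 dg2] := dg i; split.
  by move=> x; apply: derivableD.
rewrite (_ : Dr i _ = fun x => Dr i f x + Dr i g x); first exact: SumprodD.
by apply/funext => x; rewrite !DrP; apply: deriveD.
Qed.

(** The functions [g / f^k] with [g] smooth form a stable class, since the derivative of [g / f^k]
    is [(g' f - k g f') / f^(k+1)]. *)
Lemma smooth_inv f : smooth f -> (forall x, f x != 0) ->
  smooth (fun x => (f x)^-1).
Proof.
move=> sf f0; pose P (h : X -> R) := exists g : X -> R, exists k,
  smooth g /\ h = fun x => g x * (f x) ^- k.
have key k : continuous (fun x => f x ^- k : R) /\ forall i,
    (forall x, derivable (fun x => f x ^- k) x (evec R i)) /\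
    Dr i (fun x => f x ^- k) = fun x => - k%:R * Dr i f x * f x ^- k.+1.
  elim: k => [|k [ck dk]].
    rewrite (_ : (fun x => f x ^- 0) = (fun=> 1)); last first.
      by apply/funext => x; rewrite expr0 invr1.
    split; first by move=> x; apply: cst_continuous.
    move=> i; split; first by move=> x; apply: derivable_cst.
    by rewrite Dr_cst; apply/funext => x; rewrite oppr0 !mul0r.
  have E : (fun x => f x ^- k.+1) = fun x => (f x)^-1 * f x ^- k.
    by apply/funext => x; rewrite exprS invfM.
  rewrite E; split.
    move=> x; exact: (continuousM (continuousV (f0 x) (smooth_cont sf x)) (ck x)).
  move=> i; have [dk1 dk2] := dk i.
  have dV x : derivable (fun x => (f x)^-1) x (evec R i).
    by apply: derivableV => //; apply: smooth_derivable.
  split; first by move=> x; apply: derivableM.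
  apply/funext => x; rewrite !DrP [LHS]deriveM// (deriveV (f0 x) (smooth_derivable i x sf)).
  move: dk2 => /(congr1 (@^~ x)); rewrite !DrP => ->.
  rewrite /GRing.scale /=.
  rewrite -!exprVn; move: ('D_(evec R i) f x : R) (f x)^-1 => v u.
  by rewrite !exprS expr0 -(natr1 k); ring.
apply: (@smooth_coind P); last first.
  exists (fun=> 1), 1%N; split; first exact: smooth_cst.
  by apply/funext => x; rewrite mul1r expr1.
move=> _ [g [k [sg ->]]]; have [ck dk] := key k; split.
  by move=> x; exact: (continuousM (smooth_cont sg x) (ck x)).
move=> i; have [dk1 dk2] := dk i; split.
  by move=> x; apply: derivableM => //; apply: smooth_derivable.
exists (fun x => Dr i g x * f x - k%:R * (g x * Dr i f x)), k.+1; split.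
  exact: (smoothB (smoothM (smooth_Dr i sg) sf) (smoothZ _ (smoothM sg (smooth_Dr i sf)))).
apply/funext => x; rewrite !DrP [LHS]deriveM//; last exact: smooth_derivable.
move: dk2 => /(congr1 (@^~ x)); rewrite !DrP => ->.
rewrite /GRing.scale /=.
rewrite -!exprVn !exprS.
move: (f0 x) ('D_(evec R i) f x : R) ('D_(evec R i) g x : R) (g x).
move: (f x) => u u0 v w z; have {1}-> : w = w * (u * u^-1) by rewrite divff ?mulr1.
by ring.
Qed.

Lemma DrE (i : 'I_n) f x : Dr i f x = 'D_1 (fun h : R => f (h *: evec R i + x)) 0.
Proof.
rewrite DrP /derive.
apply: (congr1 (fun u => lim (u @ 0^'))); apply/funext => h /=; rewrite scale0r add0r addr0.
by rewrite [_ *: (1 : R)]mulr1.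
Qed.

Lemma smooth_coord (l : 'I_n) : smooth (fun x : X => x 0 l).
Proof.
have dl i x : is_derive x (evec R i) (fun x : X => x 0 l) (i == l)%:R.
  apply: DeriveDef.
    apply/derivable1P.
    rewrite (_ : (fun h => _) = fun h : R => h * (i == l)%:R + x 0 l); last first.
      by apply/funext => h; rewrite !mxE eqxx /= [l == i]eq_sym.
    by [].
  rewrite -DrP DrE.
  rewrite (_ : (fun h => _) = fun h : R => h * (i == l)%:R + x 0 l); last first.
    by apply/funext => h; rewrite !mxE eqxx /= [l == i]eq_sym.
  by rewrite derive_val /= addr0 /GRing.scale /= mulr1 mulr0 add0r.
apply: (@smooth_coind (fun f => smooth f \/ f = fun x : X => x 0 l)); last by right.
move=> f [sf|->]; split.
- exact: smooth_cont.
- by move=> i; split; [move=> x; exact: smooth_derivable | left; exact: smooth_Dr].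
- exact: coord_continuous.
- move=> i; split; first by move=> x; have [] := dl i x.
  left; rewrite (_ : Dr i _ = fun=> (i == l)%:R); first exact: smooth_cst.
  by apply/funext => x; rewrite DrP; have [_] := dl i x.
Qed.

Lemma Dr_coord (i l : 'I_n) : Dr i (fun x : X => x 0 l) = fun=> (i == l)%:R.
Proof.
apply/funext => x; rewrite DrE.
rewrite (_ : (fun h => _) = fun h : R => h * (i == l)%:R + x 0 l); last first.
  by apply/funext => h; rewrite !mxE eqxx /= [l == i]eq_sym.
by rewrite derive_val /= addr0 /GRing.scale /= mulr1 mulr0 add0r.
Qed.

End RealCalculus.
Arguments smooth_cont {R n f} _ x.
Arguments smooth_derivable {R n f} i x _.

Local Notation normc := Normc.normc.

Section ComplexNorm.
Variable R : realType.
Implicit Types z w : R[i].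

Lemma normc_ge0 z : 0 <= normc z.
Proof. by case: z => a b /=; apply: sqrtr_ge0. Qed.

Lemma normc_real (x : R) : normc x%:C = `|x|.
Proof. by rewrite /= expr0n addr0 sqrtr_sqr. Qed.

Lemma normc_conj z : normc (conjc z) = normc z.
Proof. by case: z => a b /=; rewrite sqrrN. Qed.

Lemma normc_Re z : `|complex.Re z| <= normc z.
Proof.
by case: z => a b /=; rewrite -sqrtr_sqr ler_sqrt ?addr_ge0 ?sqr_ge0 ?lerDl ?sqr_ge0.
Qed.

Lemma normc_Im z : `|complex.Im z| <= normc z.
Proof.
by case: z => a b /=; rewrite -sqrtr_sqr ler_sqrt ?addr_ge0 ?sqr_ge0 ?lerDr ?sqr_ge0.
Qed.

Lemma normcD z w : normc (z + w) <= normc z + normc w.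
Proof. exact: le_normcD. Qed.

Lemma normcN z : normc (- z) = normc z.
Proof. exact: normcN. Qed.

Lemma normc_le_ReIm z : normc z <= `|complex.Re z| + `|complex.Im z|.
Proof.
rewrite {1}(complexE z) (le_trans (normcD _ _))// normc_real lerD//.
by rewrite Normc.normcM normc_real /= expr0n add0r expr1n sqrtr1 mul1r.
Qed.

Lemma normc0 : normc (0 : R[i]) = 0.
Proof. exact: Normc.normc0. Qed.

Lemma normcX z n : normc (z ^+ n) = normc z ^+ n.
Proof.
elim: n => [|n ih]; first by rewrite !expr0 [LHS]Normc.normc1.
by rewrite !exprS Normc.normcM ih.
Qed.

Lemma normc_sum (I : Type) (s : seq I) (P : pred I) (u : I -> R[i]) :
  normc (\sum_(i <- s | P i) u i) <= \sum_(i <- s | P i) normc (u i).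
Proof.
elim/big_rec2 : _ => [|i y1 y2 _ h]; first by rewrite normc0.
by apply: le_trans (normcD _ _) _; rewrite lerD2l.
Qed.

Lemma normc_eq0 z : (normc z == 0) = (z == 0).
Proof. by apply/eqP/eqP => [/Normc.eq0_normc|->]; last exact: normc0. Qed.

Lemma ReM z w : complex.Re (z * w) = complex.Re z * complex.Re w - complex.Im z * complex.Im w.
Proof. by case: z w => [a b] [c e]. Qed.

Lemma ImM z w : complex.Im (z * w) = complex.Re z * complex.Im w + complex.Im z * complex.Re w.
Proof. by case: z w => [a b] [c e]. Qed.

Lemma ReD z w : complex.Re (z + w) = complex.Re z + complex.Re w.
Proof. by case: z w => [a b] [c e]. Qed.

Lemma ImD z w : complex.Im (z + w) = complex.Im z + complex.Im w.
Proof. by case: z w => [a b] [c e]. Qed.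

Lemma complexP z w : complex.Re z = complex.Re w -> complex.Im z = complex.Im w -> z = w.
Proof. by case: z w => [a b] [c e] /= -> ->. Qed.

End ComplexNorm.

Section ComplexCalculus.
Variables (R : realType) (n : nat).
Local Notation X := 'rV[R]_n.
Implicit Types phi psi : X -> R[i].

Variant csmooth phi : Prop := Csmooth of
  smooth (fun x => complex.Re (phi x)) & smooth (fun x => complex.Im (phi x)).

Lemma csmoothP phi : csmooth phi <-> smoothC phi.
Proof. by split=> [[[] ? []] |[] ? ?]. Qed.

Definition DC (i : 'I_n) phi : X -> R[i] := fun x =>
  Dr i (fun y => complex.Re (phi y)) x +i* Dr i (fun y => complex.Im (phi y)) x.

Lemma iterDC_rcons s i phi : iterDC (rcons s i) phi = iterDC s (DC i phi).
Proof. by apply/funext => x; rewrite /iterDC !iterD_rcons. Qed.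

Lemma iterDC_nil phi : iterDC [::] phi = phi.
Proof. by apply/funext => x; rewrite /iterDC/=; case: (phi x). Qed.

Lemma csmooth_DC phi i : csmooth phi -> csmooth (DC i phi).
Proof. by case=> sr si; split; apply: smooth_Dr. Qed.

Lemma csmooth_cst (c : R[i]) : csmooth (fun=> c).
Proof. by split; apply: smooth_cst. Qed.

Lemma DC_cst i (c : R[i]) : DC i (fun=> c) = (fun=> 0).
Proof. by apply/funext => x; rewrite /DC !Dr_cst. Qed.

Lemma csmooth_real (f : X -> R) : smooth f -> csmooth (fun x => (f x)%:C).
Proof. by move=> sf; split => //; apply: smooth_cst. Qed.

Lemma csmoothD phi psi : csmooth phi -> csmooth psi ->
  csmooth (fun x => phi x + psi x).
Proof.
move=> [a b] [c e]; split.
  rewrite (_ : (fun x => _) = fun x => complex.Re (phi x) + complex.Re (psi x)).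
    exact: smoothD.
  by apply/funext => x; rewrite ReD.
rewrite (_ : (fun x => _) = fun x => complex.Im (phi x) + complex.Im (psi x)).
  exact: smoothD.
by apply/funext => x; rewrite ImD.
Qed.

Lemma DCD phi psi i : csmooth phi -> csmooth psi ->
  DC i (fun x => phi x + psi x) = fun x => DC i phi x + DC i psi x.
Proof.
move=> [a b] [c e]; apply/funext => x; apply: complexP; rewrite ?ReD ?ImD /DC /=.
  rewrite (_ : (fun x => _) = fun x => complex.Re (phi x) + complex.Re (psi x)).
    by rewrite DrD.
  by apply/funext => y; rewrite ReD.
rewrite (_ : (fun x => _) = fun x => complex.Im (phi x) + complex.Im (psi x)).
  by rewrite DrD.
by apply/funext => y; rewrite ImD.
Qed.

Lemma csmoothM phi psi : csmooth phi -> csmooth psi ->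
  csmooth (fun x => phi x * psi x).
Proof.
move=> [a b] [c e]; split.
  rewrite (_ : (fun x => _) = fun x => complex.Re (phi x) * complex.Re (psi x) -
     complex.Im (phi x) * complex.Im (psi x)).
    exact: (smoothB (smoothM a c) (smoothM b e)).
  by apply/funext => x; rewrite ReM.
rewrite (_ : (fun x => _) = fun x => complex.Re (phi x) * complex.Im (psi x) +
   complex.Im (phi x) * complex.Re (psi x)).
  exact: (smoothD (smoothM a e) (smoothM b c)).
by apply/funext => x; rewrite ImM.
Qed.

Lemma DCM phi psi i : csmooth phi -> csmooth psi ->
  DC i (fun x => phi x * psi x) =
  fun x => DC i phi x * psi x + phi x * DC i psi x.
Proof.
move=> [a b] [c e]; apply/funext => x; apply: complexP.
  rewrite ReD !ReM /DC /=.
  rewrite (_ : (fun x => _) = fun x => complex.Re (phi x) * complex.Re (psi x) -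
     complex.Im (phi x) * complex.Im (psi x)); last first.
    by apply/funext => y; rewrite ReM.
  by rewrite (DrB _ (smoothM a c) (smoothM b e)) (DrM _ a c) (DrM _ b e); ring.
rewrite ImD !ImM /DC /=.
rewrite (_ : (fun x => _) = fun x => complex.Re (phi x) * complex.Im (psi x) +
   complex.Im (phi x) * complex.Re (psi x)); last first.
  by apply/funext => y; rewrite ImM.
by rewrite (DrD _ (smoothM a e) (smoothM b c)) (DrM _ a e) (DrM _ b c); ring.
Qed.

Lemma csmoothZ (c : R[i]) phi : csmooth phi -> csmooth (fun x => c * phi x).
Proof. by move=> sp; apply: (csmoothM (csmooth_cst c) sp). Qed.

Lemma DCZ (c : R[i]) phi i : csmooth phi ->
  DC i (fun x => c * phi x) = fun x => c * DC i phi x.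
Proof.
move=> sp; rewrite (DCM _ (csmooth_cst c) sp) DC_cst.
by apply/funext => x; rewrite mul0r add0r.
Qed.

Lemma csmooth_lin (c : R[i]) phi psi : csmooth phi -> csmooth psi ->
  csmooth (fun x => c * phi x + psi x).
Proof. by move=> sp ss; apply: (csmoothD (csmoothZ c sp) ss). Qed.

Lemma iterDC_lin s (c : R[i]) phi psi : csmooth phi -> csmooth psi ->
  iterDC s (fun x => c * phi x + psi x) =
  fun x => c * iterDC s phi x + iterDC s psi x.
Proof.
elim/last_ind : s phi psi => [|s i ih] phi psi sp ss; first by rewrite !iterDC_nil.
rewrite !iterDC_rcons (DCD _ (csmoothZ c sp) ss) (DCZ _ _ sp).
exact: (ih _ _ (csmooth_DC i sp) (csmooth_DC i ss)).
Qed.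

Lemma iterDCD s phi psi : csmooth phi -> csmooth psi ->
  iterDC s (fun x => phi x + psi x) = fun x => iterDC s phi x + iterDC s psi x.
Proof.
move=> sp ss; under eq_fun do rewrite -[phi _]mul1r.
by rewrite (iterDC_lin s 1 sp ss); apply/funext => x; rewrite mul1r.
Qed.

Lemma csmooth_conj phi : csmooth phi -> csmooth (fun x => conjc (phi x)).
Proof.
move=> [a b]; split.
  by rewrite (_ : (fun x => _) = fun x => complex.Re (phi x)) //; apply/funext => x; case: (phi x).
rewrite (_ : (fun x => _) = fun x => - complex.Im (phi x)); first exact: smoothN.
by apply/funext => x; case: (phi x).
Qed.

Lemma DC_conj phi i : csmooth phi ->
  DC i (fun x => conjc (phi x)) = fun x => conjc (DC i phi x).
Proof.
move=> [a b]; apply/funext => x; rewrite /DC /=; congr (_ +i* _).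
  by congr Dr; apply/funext => y; case: (phi y).
rewrite (_ : (fun x => _) = fun x => - complex.Im (phi x)); first by rewrite (DrN _ b).
by apply/funext => y; case: (phi y).
Qed.

Lemma iterDC_conj s phi : csmooth phi ->
  iterDC s (fun x => conjc (phi x)) = fun x => conjc (iterDC s phi x).
Proof.
elim/last_ind : s phi => [|s i ih] phi sp; first by rewrite !iterDC_nil.
by rewrite !iterDC_rcons (DC_conj _ sp) (ih _ (csmooth_DC i sp)).
Qed.

Lemma csmooth_sum (I : Type) (s : seq I) (P : pred I) (u : I -> X -> R[i]) :
  (forall i, P i -> csmooth (u i)) -> csmooth (fun x => \sum_(i <- s | P i) u i x).
Proof.
move=> su; elim: s => [|i s ih].
  by under eq_fun do rewrite big_nil; apply: csmooth_cst.
under eq_fun do rewrite big_cons.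
by case: (P i) (su i) => // si; exact: (csmoothD (si isT) ih).
Qed.

Lemma csmooth_prod (I : Type) (s : seq I) (P : pred I) (u : I -> X -> R[i]) :
  (forall i, P i -> csmooth (u i)) -> csmooth (fun x => \prod_(i <- s | P i) u i x).
Proof.
move=> su; elim: s => [|i s ih].
  by under eq_fun do rewrite big_nil; apply: csmooth_cst.
under eq_fun do rewrite big_cons.
by case: (P i) (su i) => // si; exact: (csmoothM (si isT) ih).
Qed.

Lemma csmoothX phi k : csmooth phi -> csmooth (fun x => phi x ^+ k).
Proof.
move=> sp; elim: k => [|k ih].
  by under eq_fun do rewrite expr0; apply: csmooth_cst.
by under eq_fun do rewrite exprS; exact: (csmoothM sp ih).
Qed.

End ComplexCalculus.

(** * Seminorms of the smooth topology on a ball *)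

Section Seminorms.
Variables (R : realType) (n : nat) (r : R).
Hypothesis r0 : 0 <= r.
Local Notation X := 'rV[R]_n.
Implicit Types phi psi : X -> R[i].

(** A relation with an upper bound [M] rather than a supremum, in the form in which continuity is
    stated in [comp_supp_distribution]. *)
Definition bnd (N : nat) phi (M : R) := forall s : seq 'I_n, (size s <= N)%N ->
  forall x : X, `|x| <= r -> normc (iterDC s phi x) <= M.

Lemma bnd_ge0 N phi M : bnd N phi M -> 0 <= M.
Proof.
move=> /(_ [::] isT 0); rewrite normr0 => /(_ r0); exact/le_trans/normc_ge0.
Qed.

Lemma bnd_le N phi M M' : M <= M' -> bnd N phi M -> bnd N phi M'.
Proof. by move=> MM' b s sN x xr; apply: le_trans (b s sN x xr) MM'. Qed.

Lemma bnd_leN N N' phi M : (N' <= N)%N -> bnd N phi M -> bnd N' phi M.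
Proof. by move=> NN b s sN; apply: b; apply: leq_trans sN NN. Qed.

(** The innermost derivative is split off, so that the hypothesis on [DC i phi] is again of the form
    [bnd]; this drives the inductions on [N]. *)
Lemma bndS N phi M : bnd N.+1 phi M <->
  (forall x : X, `|x| <= r -> normc (phi x) <= M) /\ forall i, bnd N (DC i phi) M.
Proof.
split=> [b|[b0 b1] s].
  split=> [x xr|i s sN x xr]; first by have := b [::] isT x xr; rewrite iterDC_nil.
  by rewrite -iterDC_rcons; apply: b; rewrite ?size_rcons.
case/lastP : s => [|s i] sN x xr; first by rewrite iterDC_nil; apply: b0.
by rewrite iterDC_rcons; apply: b1 => //; rewrite size_rcons in sN.
Qed.

Lemma bnd0 phi M : bnd 0 phi M <-> forall x : X, `|x| <= r -> normc (phi x) <= M.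
Proof.
split=> [b x xr|b [|//] _ x xr]; last by rewrite iterDC_nil; apply: b.
by have := b [::] isT x xr; rewrite iterDC_nil.
Qed.

Lemma bndD N phi psi M M' : csmooth phi -> csmooth psi ->
  bnd N phi M -> bnd N psi M' -> bnd N (fun x => phi x + psi x) (M + M').
Proof.
move=> sp ss bp bs s sN x xr; rewrite (iterDCD s sp ss).
by apply: le_trans (normcD _ _) _; apply: lerD; [apply: bp | apply: bs].
Qed.

Lemma bnd_conj N phi M : csmooth phi -> bnd N phi M ->
  bnd N (fun x => conjc (phi x)) M.
Proof.
by move=> sp b s sN x xr; rewrite (iterDC_conj s sp) normc_conj; apply: b.
Qed.

Lemma bounded_ball (f : X -> R) : continuous f ->
  exists2 M, 0 <= M & forall x, `|x| <= r -> `|f x| <= M.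
Proof.
move=> cf; pose B := [set x : X | `|x| <= r].
have cB : compact B.
  apply: bounded_closed_compact.
    by exists r; split; [exact: num_real | move=> y ry x /= xr; apply: le_trans xr (ltW ry)].
  have -> : B = Num.norm @^-1` [set y | y <= r] by [].
  apply: closed_comp; last exact: closed_le.
  by move=> x _; apply: norm_continuous.
have cfn : {within B, continuous (fun x => `|f x|)}.
  apply: continuous_subspaceT => x.
  by apply: continuous_comp; [exact: cf | exact: norm_continuous].
have B0 : B !=set0 by exists 0; rewrite /B /= normr0.
have [c _ hc] := EVT_max_rV B0 cB cfn.
by exists `|f c|; [exact: normr_ge0 | move=> x xr; apply: hc; rewrite inE].
Qed.

Lemma bnd_ex0 phi : csmooth phi ->
  exists2 M, 0 <= M & forall x, `|x| <= r -> normc (phi x) <= M.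
Proof.
move=> [/smooth_cont c1 /smooth_cont c2].
have [M1 M10 h1] := bounded_ball c1; have [M2 M20 h2] := bounded_ball c2.
exists (M1 + M2); first exact: addr_ge0.
move=> x xr; apply: le_trans (normc_le_ReIm _) _.
by apply: lerD; [apply: h1 | apply: h2].
Qed.

Lemma bnd_ex N phi : csmooth phi -> exists2 M, 0 <= M & bnd N phi M.
Proof.
elim: N phi => [|N ih] phi sp; have [M M0 hM] := bnd_ex0 sp.
  by exists M => //; apply/bnd0.
have /choice[m hm] i : exists M, 0 <= M /\ bnd N (DC i phi) M.
  by have [M' ? ?] := ih _ (csmooth_DC i sp); exists M'.
exists (M + \sum_i m i).
  by apply: addr_ge0 => //; apply: sumr_ge0 => i _; case: (hm i).
apply/bndS; split=> [x xr|i].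
  apply: le_trans (hM x xr) _; rewrite lerDl.
  by apply: sumr_ge0 => i _; case: (hm i).
apply: bnd_le (proj2 (hm i)); rewrite (bigD1 i)//= addrCA lerDl addr_ge0//.
by apply: sumr_ge0 => j _; case: (hm j).
Qed.

(** Leibniz' rule by induction on [N]. The constant depends on [psi] and [N] but not on [phi], which
    is what makes [psi F] a distribution and permits iteration over powers. *)
Lemma bndM N psi : csmooth psi -> exists2 C, 0 <= C &
  forall phi M, csmooth phi -> bnd N phi M -> bnd N (fun x => psi x * phi x) (C * M).
Proof.
elim: N psi => [|N ih] psi ss; have [C0 C00 hC0] := bnd_ex0 ss.
  exists C0 => // phi M sp /bnd0 b; apply/bnd0 => x xr.
  by rewrite Normc.normcM ler_pM ?normc_ge0 ?hC0 ?b.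
have /choice[c hc] i : exists C, 0 <= C /\
   forall phi M, csmooth phi -> bnd N phi M -> bnd N (fun x => DC i psi x * phi x) (C * M).
  by have [C' ? ?] := ih _ (csmooth_DC i ss); exists C'.
have [C1 C10 hC1] := ih _ ss.
have sc : 0 <= \sum_i c i by apply: sumr_ge0 => j _; case: (hc j).
exists (C0 + (\sum_i c i + C1)) => [|phi M sp b]; first by rewrite !addr_ge0.
have M0 := bnd_ge0 b.
have /bndS[b0 b1] := b; apply/bndS; split=> [x xr|i].
  apply: (@le_trans _ _ (C0 * M)).
    by rewrite Normc.normcM ler_pM ?normc_ge0 ?hC0 ?b0.
  by rewrite ler_wpM2r// lerDl addr_ge0.
rewrite (DCM _ ss sp).
have bi := proj2 (hc i) _ _ sp (bnd_leN (leqnSn N) b).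
have b' := hC1 _ _ (csmooth_DC i sp) (b1 i).
have := bndD (csmoothM (csmooth_DC i ss) sp) (csmoothM ss (csmooth_DC i sp)) bi b'.
apply: bnd_le; rewrite -mulrDl ler_wpM2r// -[leLHS]add0r lerD// lerD2r.
rewrite (bigD1 i)//= lerDl.
by apply: sumr_ge0 => j _; case: (hc j).
Qed.

End Seminorms.

Section Distributions.
Variables (R : realType) (n : nat).
Local Notation X := 'rV[R]_n.
Implicit Types (phi psi : X -> R[i]) (F : (X -> R[i]) -> R[i]).

(** The given notion with [r] and [C] nonnegative: the origin then lies in the ball, so
    [bnd r N phi M] forces [0 <= M]. *)
Definition cdist F : Prop :=
  (forall (a : R[i]) phi psi, csmooth phi -> csmooth psi ->
     F (fun x => a * phi x + psi x) = a * F phi + F psi) /\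
  exists r C N, [/\ 0 <= r, 0 <= C & forall phi M, csmooth phi ->
     bnd r N phi M -> normc (F phi) <= C * M].

Lemma comp_supp_cdist F : comp_supp_distribution F -> cdist F.
Proof.
move=> [lF [r [C [N bF]]]]; split.
  by move=> a phi psi /csmoothP ? /csmoothP ?; apply: lF.
(* A larger ball only strengthens the premise on [phi], and [C * M <= |C| * M] because [M] is
   nonnegative. *)
exists (Num.max r 0), `|C|, N; split => //; first by rewrite le_max lexx orbT.
move=> phi M /csmoothP sp b.
have M0 : 0 <= M by apply: bnd_ge0 b; rewrite le_max lexx orbT.
apply: (@le_trans _ _ (C * M)); last by rewrite ler_wpM2r// ler_norm.
by apply: bF => // s sN x xr; apply: b => //; rewrite le_max xr.
Qed.

Variable F : (X -> R[i]) -> R[i].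
Hypothesis dF : cdist F.

Lemma cdist_lin (a : R[i]) phi psi : csmooth phi -> csmooth psi ->
  F (fun x => a * phi x + psi x) = a * F phi + F psi.
Proof. by case: dF => + _; apply. Qed.

Lemma cdistD phi psi : csmooth phi -> csmooth psi ->
  F (fun x => phi x + psi x) = F phi + F psi.
Proof.
move=> sp ss; under eq_fun do rewrite -[phi _]mul1r.
by rewrite cdist_lin// mul1r.
Qed.

Lemma cdist0 : F (fun=> 0) = 0.
Proof.
have := cdist_lin (-1) (@csmooth_cst _ _ 0) (@csmooth_cst _ _ 0).
by under eq_fun do rewrite mulr0 addr0; rewrite mulN1r addNr.
Qed.

Lemma cdistZ a phi : csmooth phi -> F (fun x => a * phi x) = a * F phi.
Proof.
move=> sp; under eq_fun do rewrite -[_ * _]addr0.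
by rewrite cdist_lin//; [rewrite cdist0 addr0 | exact: csmooth_cst].
Qed.

Lemma cdist_sum (I : Type) (s : seq I) (P : pred I) (u : I -> X -> R[i]) :
  (forall i, csmooth (u i)) ->
  F (fun x => \sum_(i <- s | P i) u i x) = \sum_(i <- s | P i) F (u i).
Proof.
move=> su; elim: s => [|i s ih].
  by under eq_fun do rewrite big_nil; rewrite big_nil cdist0.
under eq_fun do rewrite big_cons; rewrite big_cons.
case: (P i) => //; rewrite (cdistD (su i)) ?ih//.
by apply: csmooth_sum => j _; apply: su.
Qed.

Lemma cdist_mul psi : csmooth psi -> cdist (fun phi => F (fun x => psi x * phi x)).
Proof.
move=> ss; split=> [a phi phi' sp sp'|].
  rewrite -cdist_lin; [|exact: csmoothM..].
  by congr F; apply/funext => x; ring.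
case: dF => _ [r [C [N [r0 C0 bF]]]].
have [c c0 hc] := bndM r0 N ss.
exists r, (C * c), N; split; [by [] | exact: mulr_ge0 |].
move=> phi M sp b; rewrite -mulrA; apply: bF; first exact: csmoothM.
exact: hc.
Qed.

(** The conjugate distribution. Its moment matrix is the conjugate transpose of that of [F], so
    results on [z_i] carry over to [conj z_i]. *)
Lemma cdist_conj : cdist (fun phi => conjc (F (fun x => conjc (phi x)))).
Proof.
split=> [a phi psi sp ss|].
  have sp' := csmooth_conj sp; have ss' := csmooth_conj ss.
  rewrite -[in RHS](conjcK a) -rmorphM -rmorphD /= -cdist_lin//.
  by congr (conjc (F _)); apply/funext => x; rewrite rmorphD rmorphM.
case: dF => _ [r [C [N [r0 C0 bF]]]].
exists r, C, N; split => // phi M sp b; rewrite normc_conj; apply: bF.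
  exact: csmooth_conj.
exact: bnd_conj.
Qed.

End Distributions.

(** * Symmetry of partial derivatives *)

Section RowVectors.
Variables (R : realType) (n : nat).
Local Notation X := 'rV[R]_n.
Implicit Types x y : X.

Lemma rV_norm_leP x (M : R) : 0 <= M -> (`|x| <= M <-> forall l, `|x 0 l| <= M).
Proof.
move=> M0; split=> [xM l|h]; last first.
  rewrite [`|x|]mx_normrE; apply: bigmax_le => // -[i l] _ /=.
  by rewrite ord1.
apply: le_trans xM; rewrite [`|x|]mx_normrE.
exact: (le_bigmax _ (fun ij : 'I_1 * 'I_n => `|x ij.1 ij.2|) (0, l)).
Qed.

Lemma coord_norm_le x l : `|x 0 l| <= `|x|.
Proof. by have /rV_norm_leP := lexx `|x|; apply. Qed.

Lemma coord_lineE i (h : R) x l :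
  (h *: evec R i + x) 0 l = (if l == i then h else 0) + x 0 l.
Proof. by rewrite !mxE eqxx /=; case: (l == i); rewrite ?mulr1 ?mulr0. Qed.

Lemma evec_norm (i : 'I_n) : `|evec R i| <= 1.
Proof.
apply/rV_norm_leP => // l; rewrite mxE eqxx /=.
by case: (l == i); rewrite ?normr1 ?normr0.
Qed.

End RowVectors.

Section Lines.
Variables (R : realType) (n : nat).
Local Notation X := 'rV[R]_n.
Implicit Types (f g : X -> R) (x y : X).

Lemma is_derive_line f i x (t : R) : smooth f ->
  is_derive t 1 (fun h : R => f (h *: evec R i + x)) (Dr i f (t *: evec R i + x)).
Proof.
move=> sf.
have E : (fun h : R => h^-1 *: (((fun h : R => f (h *: evec R i + x)) \o shift t) (h *: 1)
       - f (t *: evec R i + x))) =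
   (fun h : R => h^-1 *: ((f \o shift (t *: evec R i + x)) (h *: evec R i)
       - f (t *: evec R i + x))).
  apply/funext => h /=; congr (_ *: (f _ - _)).
  by rewrite [h *: 1]mulr1 scalerDl addrA.
apply: DeriveDef.
  by rewrite /derivable E; exact: (smooth_derivable i _ sf).
by rewrite DrP /derive E.
Qed.

(** The segment is parametrized by [[0, 1]], so [h] may have either sign or vanish. *)
Lemma mvt_line f i x (h : R) : smooth f -> exists2 c,
  0 <= c <= 1 & f (h *: evec R i + x) - f x = h * Dr i f ((c * h) *: evec R i + x).
Proof.
move=> sf.
have D (t : R) : is_derive t 1 (fun s : R => f ((s * h) *: evec R i + x))
     (h * Dr i f ((t * h) *: evec R i + x)).
  rewrite mulrC.
  have -> : (fun s : R => f ((s * h) *: evec R i + x)) =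
     (fun s : R => f (s *: evec R i + x)) \o ( *%R^~ h) by [].
  apply: is_derive1_comp; first exact: is_derive_line.
  by apply: is_derive_eq; rewrite /GRing.scale /= mulr0 mulr1 add0r.
have cn : {within `[0, 1], continuous (fun s : R => f ((s * h) *: evec R i + x))}.
  apply: derivable_within_continuous => t _; apply: ex_derive.
have [c c01 hc] := MVT_segment ler01 (fun t _ => D t) cn.
exists c; first by rewrite in_itv /= in c01.
by move: hc; rewrite mul1r mul0r scale0r add0r subr0 mulr1.
Qed.

Lemma smooth_shift f (v : X) : smooth f -> smooth (fun x => f (v + x)).
Proof.
move=> sf; apply: (@smooth_coind _ _ (fun g => exists2 f, smooth f &
   g = fun x => f (v + x))); last by exists f.
move=> _ {f sf} [f sf ->].
have D i x : is_derive x (evec R i) (fun x => f (v + x)) (Dr i f (v + x)).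
  have E : (fun h : R => h^-1 *: (((fun x => f (v + x)) \o shift x) (h *: evec R i) - f (v + x)))
    = (fun h : R => h^-1 *: ((f \o shift (v + x)) (h *: evec R i) - f (v + x))).
    by apply/funext => h /=; congr (_ *: (f _ - _)); rewrite addrCA.
  apply: DeriveDef.
    by rewrite /derivable E; exact: (smooth_derivable i _ sf).
  by rewrite DrP /derive E.
split.
  move=> x; apply: (@continuous_comp _ _ _ (fun x => v + x) f).
    by apply: continuousD; [exact: cst_continuous | exact: id].
  exact: (smooth_cont sf).
move=> i; split; first by move=> x; have [] := D i x.
exists (Dr i f); first exact: smooth_Dr.
by apply/funext => x; rewrite DrP; have [_] := D i x.
Qed.

Lemma Dr_shift f (v : X) i : smooth f ->
  Dr i (fun x => f (v + x)) = fun x => Dr i f (v + x).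
Proof.
move=> sf; apply/funext => x; rewrite DrE.
have -> : (fun h : R => f (v + (h *: evec R i + x))) =
   (fun h : R => f (h *: evec R i + (v + x))).
  by apply/funext => h; rewrite addrCA.
have [_ ->] := is_derive_line i (v + x) 0 sf.
by rewrite scale0r add0r.
Qed.

(** The mean value theorem is applied in direction [i] to the difference of [f] along [e_j], then in
    direction [j] to [Dr i f]. The left-hand side is symmetric in [i] and [j], whence Schwarz'
    theorem [Dr_comm]. *)
Lemma second_difference f i j x (h : R) : smooth f -> 0 < h -> exists2 y,
  `|y - x| <= 2 * h &
  f (h *: evec R i + h *: evec R j + x) - f (h *: evec R i + x)
    - f (h *: evec R j + x) + f x = h * (h * Dr j (Dr i f) y).
Proof.
move=> sf h0; pose g y := f (h *: evec R j + y) - f y.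
have sg : smooth g by apply: smoothB => //; apply: smooth_shift.
have [c /andP[c0 c1] hc] := mvt_line i x h sg.
have [c' /andP[c'0 c'1] hc'] := mvt_line j ((c * h) *: evec R i + x) h (smooth_Dr i sf).
exists ((c' * h) *: evec R j + ((c * h) *: evec R i + x)).
  rewrite addrA addrK (le_trans (ler_normD _ _))// mulrDl !mul1r.
  by apply: lerD; rewrite normrZ ger0_norm ?mulr_ge0 ?(ltW h0)//;
    rewrite -[leRHS]mulr1 ler_pM ?evec_norm ?mulr_ge0 ?(ltW h0)// ler_piMl ?(ltW h0).
have Dg y : Dr i f (h *: evec R j + y) - Dr i f y = Dr i g y.
  by rewrite /g (DrB _ (smooth_shift _ sf) sf) (Dr_shift _ _ sf).
rewrite -hc' Dg -hc /g opprB addrA [LHS]addrAC -!addrA.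
by congr (f _ + _); rewrite addrCA.
Qed.

Lemma Dr_comm f i j : smooth f -> Dr i (Dr j f) = Dr j (Dr i f).
Proof.
move=> sf; apply/funext => x; apply/eqP; rewrite -subr_eq0 -normr_le0.
apply/ler_addgt0Pr => e e0; rewrite add0r.
have cA := smooth_cont (smooth_Dr i (smooth_Dr j sf)) x.
have cB := smooth_cont (smooth_Dr j (smooth_Dr i sf)) x.
have e20 : 0 < e / 2 by rewrite divr_gt0.
move/cvgr_dist_le : cA => /(_ _ e20)/nbhs_ballP[d1 /= d10 h1].
move/cvgr_dist_le : cB => /(_ _ e20)/nbhs_ballP[d2 /= d20 h2].
(* Both intermediate points lie within [2 h] of [x], hence in both balls of continuity. *)
pose h := Num.min d1 d2 / 3.
have d0 : 0 < Num.min d1 d2 by rewrite lt_min d10.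
have h0 : 0 < h by rewrite divr_gt0.
have hd : 2 * h < Num.min d1 d2 by rewrite /h; lra.
have [y1 y1x E1] := second_difference j i x sf h0.
have [y2 y2x E2] := second_difference i j x sf h0.
have Eq : Dr i (Dr j f) y1 = Dr j (Dr i f) y2.
  apply: (mulfI (lt0r_neq0 h0)); apply: (mulfI (lt0r_neq0 h0)).
  rewrite -E1 -E2 [h *: evec R j + h *: evec R i]addrC; ring.
have b1 : ball x d1 y1.
  rewrite -ball_normE /ball_ /= distrC (le_lt_trans y1x)// (lt_le_trans hd)//.
  by rewrite ge_min lexx.
have b2 : ball x d2 y2.
  rewrite -ball_normE /ball_ /= distrC (le_lt_trans y2x)// (lt_le_trans hd)//.
  by rewrite ge_min lexx orbT.
have := h1 _ b1; have := h2 _ b2; rewrite /= Eq => k2 k1.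
rewrite (_ : _ - _ = (Dr i (Dr j f) x - Dr j (Dr i f) y2) - (Dr j (Dr i f) x - Dr j (Dr i f) y2)); last by ring.
rewrite (le_trans (ler_normB _ _))//.
by rewrite [leRHS](splitr e) lerD.
Qed.

Lemma Dr_iterD f i s : smooth f -> Dr i (iterD s f) = iterD s (Dr i f).
Proof.
move=> sf; elim: s => // j s ih.
rewrite !iterD_cons.
by rewrite -ih -[RHS](Dr_comm _ _ (smooth_iterD s sf)).
Qed.

Lemma iterD_perm f s t : smooth f -> perm_eq s t -> iterD s f = iterD t f.
Proof.
move=> sf; apply: (@catCA_perm_subst _ _ (fun v => iterD v f)) => s1 s2 s3.
rewrite !iterD_cat; move: (smooth_iterD s3 sf); move: (iterD s3 f) => g sg.
elim: s2 s1 {s3} => // i s2 ih s1.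
rewrite !iterD_cons.
by rewrite -ih (Dr_iterD i s1 (smooth_iterD _ sg)).
Qed.

End Lines.

(** * Density of polynomials in the smooth functions *)

Section Bernstein.
Variable R : realType.

(** The Bernstein polynomial [C(K,k) t^k (1-t)^(K-k)], that is, the probability of [k] successes in
    [K] trials. The recursion conditions on one trial, so the moments below follow by induction
    without binomial identities. *)
Fixpoint bern (K k : nat) (t : R) : R := match K with
  | 0 => (k == 0)%:R
  | K'.+1 => (1 - t) * bern K' k t + t * (if k is k'.+1 then bern K' k' t else 0)
  end.

Lemma bern_out K k t : (K < k)%N -> bern K k t = 0.
Proof.
elim: K k => [|K ih] [|k] //= Kk; rewrite !ih ?mulr0 ?addr0//; exact: ltnW.
Qed.

Lemma bern_ge0 K k t : 0 <= t <= 1 -> 0 <= bern K k t.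
Proof.
move=> /andP[t0 t1]; elim: K k => [|K ih] k /=; first exact: ler0n.
rewrite addr_ge0// mulr_ge0// ?subr_ge0//; by case: k.
Qed.

Lemma bern_sumS K (g : nat -> R) t :
  \sum_(k < K.+2) bern K.+1 k t * g k =
  (1 - t) * (\sum_(k < K.+1) bern K k t * g k) +
  t * (\sum_(k < K.+1) bern K k t * g k.+1).
Proof.
under eq_bigr do rewrite /= mulrDl -!mulrA.
rewrite big_split /= -!mulr_sumr; congr (_ * _ + _).
  by rewrite big_ord_recr /= bern_out// mul0r addr0.
by rewrite big_ord_recl /= mul0r add0r.
Qed.

Lemma bern_sum1 K t : \sum_(k < K.+1) bern K k t = 1.
Proof.
elim: K => [|K ih]; first by rewrite big_ord1.
under eq_bigr do rewrite -[bern _ _ _]mulr1.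
rewrite (bern_sumS _ (fun=> 1)); under eq_bigr do rewrite mulr1.
by rewrite ih; ring.
Qed.

(** Variance plus squared bias. The centre [a] stays arbitrary because the inductive step moves it
    to [a - 1]. *)
Lemma bern_var K t a : \sum_(k < K.+1) bern K k t * (k%:R - a) ^+ 2 =
  K%:R * t * (1 - t) + (K%:R * t - a) ^+ 2.
Proof.
elim: K a => [|K ih] a; first by rewrite big_ord1 /=; ring.
rewrite (bern_sumS _ (fun k => (k%:R - a) ^+ 2)) ih.
rewrite (_ : \sum_(k < _) _ = \sum_(k < K.+1) bern K k t * (k%:R - (a - 1)) ^+ 2); last first.
  by apply: eq_bigr => k _; rewrite -natr1; congr (_ * _ ^+ 2); ring.
by rewrite ih -natr1; ring.
Qed.

End Bernstein.

Section RealPolynomials.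
Variables (R : realType) (n : nat).
Local Notation X := 'rV[R]_n.
Implicit Types (f g p q : X -> R) (x y c : X) (m : 'I_n -> nat).

Lemma smooth_prod (I : Type) (s : seq I) (P : pred I) (u : I -> X -> R) :
  (forall i, smooth (u i)) -> smooth (fun x => \prod_(i <- s | P i) u i x).
Proof.
move=> su; elim: s => [|i s ih].
  by under eq_fun do rewrite big_nil; apply: smooth_cst.
under eq_fun do rewrite big_cons.
by case: (P i) => //; exact: (smoothM (su i) ih).
Qed.

Lemma smoothX f k : smooth f -> smooth (fun x => f x ^+ k).
Proof.
move=> sp; elim: k => [|k ih].
  by under eq_fun do rewrite expr0; apply: smooth_cst.
by under eq_fun do rewrite exprS; exact: (smoothM sp ih).
Qed.

Definition tmon c m x : R := \prod_(j < n) (x 0 j - c 0 j) ^+ m j.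

Lemma smooth_tmon c m : smooth (tmon c m).
Proof.
apply: smooth_prod => j; apply: smoothX.
exact: (smoothB (smooth_coord _ j) (smooth_cst _ (c 0 j))).
Qed.

(** If [m i = 0], the truncated subtraction in the exponent is harmless, as the coefficient
    vanishes. *)
Lemma Dr_tmon c m i :
  Dr i (tmon c m) = fun x => (m i)%:R * tmon c (fun j => m j - (j == i))%N x.
Proof.
apply/funext => x; rewrite DrE.
pose C := \prod_(j < n | j != i) (x 0 j - c 0 j) ^+ m j.
have -> : (fun h : R => tmon c m (h *: evec R i + x)) =
   (fun h : R => C * (h + (x 0 i - c 0 i)) ^+ m i).
  apply/funext => h; rewrite /tmon (bigD1 i)//= mulrC coord_lineE eqxx -addrA.
  congr (_ * _); apply: eq_bigr => j /negbTE ji.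
  by rewrite coord_lineE ji add0r.
have -> : (fun h : R => C * (h + (x 0 i - c 0 i)) ^+ m i) =
   horner (C *: ('X + (x 0 i - c 0 i)%:P) ^+ m i).
  by apply/funext => h; rewrite !hornerE.
rewrite derive_val derivZ deriv_exp derivD derivX derivC addr0 mul1r.
rewrite hornerZ hornerMn !hornerE ?add0r.
rewrite /tmon (bigD1 i)//= eqxx subn1.
rewrite (eq_bigr (fun j => (x 0 j - c 0 j) ^+ m j)); last first.
  by move=> j /negbTE ->; rewrite subn0.
by rewrite -/C -mulr_natl; ring.
Qed.

Lemma tmonM c m1 m2 x : tmon c m1 x * tmon c m2 x = tmon c (fun j => m1 j + m2 j)%N x.
Proof. by rewrite -big_split; apply: eq_bigr => j _; rewrite exprD. Qed.

Inductive rpoly : (X -> R) -> Prop :=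
| Rpoly0 : rpoly (fun=> 0)
| RpolyD a m p : rpoly p -> rpoly (fun x => a * tmon 0 m x + p x).

Lemma rpoly_smooth p : rpoly p -> smooth p.
Proof.
elim=> [|a m q _ sq]; first exact: smooth_cst.
exact: (smoothD (smoothZ a (smooth_tmon 0 m)) sq).
Qed.

Lemma rpolyD p q : rpoly p -> rpoly q -> rpoly (fun x => p x + q x).
Proof.
elim=> [|a m p' _ ih] rq; first by under eq_fun do rewrite add0r.
by under eq_fun do rewrite -addrA; apply: RpolyD; apply: ih.
Qed.

Lemma rpolyZ a p : rpoly p -> rpoly (fun x => a * p x).
Proof.
elim=> [|b m p' _ ih]; first by under eq_fun do rewrite mulr0; apply: Rpoly0.
by under eq_fun do rewrite mulrDr mulrA; apply: RpolyD.
Qed.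

Lemma rpolyM p q : rpoly p -> rpoly q -> rpoly (fun x => p x * q x).
Proof.
move=> rp rq; elim: rp => [|a m p' _ ih].
  by under eq_fun do rewrite mul0r; apply: Rpoly0.
under eq_fun do rewrite mulrDl -mulrA; apply: rpolyD => //; apply: rpolyZ.
elim: rq {ih} => [|b m' q' _ ih]; first by under eq_fun do rewrite mulr0; apply: Rpoly0.
by under eq_fun do rewrite mulrDr mulrCA tmonM; apply: RpolyD.
Qed.

Lemma rpoly_tmon m : rpoly (tmon 0 m).
Proof.
rewrite (_ : tmon 0 m = fun x => 1 * tmon 0 m x + 0); first exact/RpolyD/Rpoly0.
by apply/funext => x; rewrite mul1r addr0.
Qed.

Lemma rpoly_cst a : rpoly (fun=> a).
Proof.
rewrite (_ : (fun=> a) = fun x => a * tmon 0 (fun=> 0%N) x + 0).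
  exact/RpolyD/Rpoly0.
by apply/funext => x; rewrite /tmon big1 ?mulr1 ?addr0// => j _; rewrite expr0.
Qed.

Lemma rpoly_coord l : rpoly (fun x => x 0 l).
Proof.
rewrite (_ : (fun x => _) = tmon 0 (fun j => (j == l) : nat)); first exact: rpoly_tmon.
apply/funext => x; rewrite /tmon (bigD1 l)//= eqxx expr1 big1 ?mulr1 ?mxE ?subr0//.
by move=> j /negbTE ->; rewrite expr0.
Qed.

Lemma rpoly_prod (I : Type) (s : seq I) (u : I -> X -> R) :
  (forall i, rpoly (u i)) -> rpoly (fun x => \prod_(i <- s) u i x).
Proof.
move=> su; elim: s => [|i s ih].
  by under eq_fun do rewrite big_nil; apply: rpoly_cst.
by under eq_fun do rewrite big_cons; exact: (rpolyM (su i) ih).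
Qed.

Lemma rpoly_sum (I : Type) (s : seq I) (u : I -> X -> R) :
  (forall i, rpoly (u i)) -> rpoly (fun x => \sum_(i <- s) u i x).
Proof.
move=> su; elim: s => [|i s ih].
  by under eq_fun do rewrite big_nil; apply: Rpoly0.
by under eq_fun do rewrite big_cons; exact: (rpolyD (su i) ih).
Qed.

Lemma rpoly_bern K k p : rpoly p -> rpoly (fun x => bern K k (p x)).
Proof.
move=> rp; elim: K k => [|K ih] k; first exact: rpoly_cst.
under eq_fun do rewrite /= -[1 - _]/(1 + - _) -mulN1r.
apply: rpolyD; apply: rpolyM => //; last by case: k => // ; apply: Rpoly0.
exact: (rpolyD (rpoly_cst 1) (rpolyZ (-1) rp)).
Qed.

Definition proj (i : 'I_n) x : X := x - x 0 i *: evec R i.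

Lemma projE i x l : proj i x 0 l = if l == i then 0 else x 0 l.
Proof.
by rewrite !mxE eqxx /=; case: eqP => [->|_]; rewrite ?mulr1 ?subrr ?mulr0 ?subr0.
Qed.

Lemma proj_decomp i x : x 0 i *: evec R i + proj i x = x.
Proof. by rewrite addrC subrK. Qed.

(** A primitive in [x_i] normalized to vanish on the hyperplane [x_i = 0], which leaves the values
    there free to be prescribed. *)
Lemma rpoly_prim i p : rpoly p ->
  exists q, [/\ rpoly q, Dr i q = p & forall x, q (proj i x) = 0].
Proof.
elim=> [|a m p' _ [q [rq Dq q0]]].
  by exists (fun=> 0); split; [exact: Rpoly0 | exact: Dr_cst |].
pose m' j := (m j + (j == i))%N.
have sm : smooth (fun x => a / (m' i)%:R * tmon 0 m' x).
  by apply: smoothZ; apply: smooth_tmon.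
exists (fun x => a / (m' i)%:R * tmon 0 m' x + q x); split; first exact: RpolyD.
  rewrite (DrD _ sm (rpoly_smooth rq)) Dq (DrZ _ _ (smooth_tmon 0 m')) Dr_tmon.
  apply/funext => x; congr (_ + _); rewrite mulrA divfK; last first.
    by rewrite /m' eqxx addn1 pnatr_eq0.
  by congr (_ * tmon _ _ _); apply/funext => j; rewrite /m' addnK.
move=> x; rewrite q0 addr0 /tmon (bigD1 i)//= projE eqxx /m' eqxx addn1 mxE subr0.
by rewrite expr0n /= mul0r mulr0.
Qed.

Lemma rpoly_proj i p : rpoly p -> rpoly (fun x => p (proj i x)).
Proof.
elim=> [|a m p' _ ih]; first exact: Rpoly0.
case: (posnP (m i)) => mi.
  rewrite (_ : (fun x => _) = fun x => a * tmon 0 m x + p' (proj i x)).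
    exact: RpolyD.
  apply/funext => x; congr (_ * _ + _); apply: eq_bigr => j _; rewrite projE.
  by case: eqP => // ->; rewrite mi !expr0.
rewrite (_ : (fun x => _) = fun x => p' (proj i x)) //.
apply/funext => x; rewrite /tmon (bigD1 i)//= projE eqxx mxE subr0 expr0n.
by rewrite eqn0Ngt mi /= mul0r mulr0 add0r.
Qed.

Lemma smooth_proj i f : smooth f -> smooth (fun x => f (proj i x)) /\
  forall j, Dr j (fun x => f (proj i x)) =
    if j == i then (fun=> 0) else (fun x => Dr j f (proj i x)).
Proof.
have L j (h : R) x : proj i (h *: evec R j + x) =
    (if j == i then 0 else h) *: evec R j + proj i x.
  apply/rowP => l; rewrite projE !coord_lineE projE.
  case: (eqVneq l j) => [<-|_]; last by case: (l == i); rewrite ?add0r.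
  by case: (l == i); rewrite ?add0r.
pose P g := exists2 f, smooth f & g = fun x => f (proj i x).
have key g j : smooth g -> (forall x, derivable (fun x => g (proj i x)) x (evec R j)) /\
    Dr j (fun x => g (proj i x)) = if j == i then (fun=> 0) else (fun x => Dr j g (proj i x)).
  move=> sg.
  have D x : is_derive 0 (1 : R) (fun h : R => g (proj i (h *: evec R j + x)))
     (if j == i then 0 else Dr j g (proj i x)).
    under eq_fun do rewrite L.
    case: (j == i); first by under eq_fun do rewrite scale0r; apply: is_derive_cst.
    have := is_derive_line j (proj i x) 0 sg.
    by rewrite scale0r add0r.
  split=> [x|]; first by apply/derivable1P; have [] := D x.
  by apply/funext => x; rewrite DrE; have [_ ->] := D x; case: (j == i).
move=> sf; split; last by move=> j; have [] := key f j sf.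
apply: (@smooth_coind _ _ P); last by exists f.
move=> _ {f sf} [f sf ->]; split.
  move=> x; apply: (@continuous_comp _ _ _ (proj i) f); last exact: (smooth_cont sf).
  apply: (@continuousB _ _ _ (fun x => x) (fun x => x 0 i *: evec R i)).
    exact: id.
  have h := @coord_continuous R 1 n 0 i x.
  exact: (@cvgZr_tmp _ _ _ _ _ (fun x : X => x 0 i) (x 0 i) (evec R i) h).
move=> j; have [d1 ->] := key f j sf; split=> //.
case: (j == i); last by exists (Dr j f) => //; apply: smooth_Dr.
by exists (fun=> 0) => //; apply: smooth_cst.
Qed.

Lemma iterD_proj i f s : smooth f -> i \notin s ->
  iterD s (fun x => f (proj i x)) = fun x => iterD s f (proj i x).
Proof.
elim/last_ind : s f => [//|s j ih] f sf.
rewrite mem_rcons in_cons negb_or eq_sym => /andP[ji si].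
rewrite !iterD_rcons (proj2 (smooth_proj i sf)) (negbTE ji).
by rewrite (ih _ (smooth_Dr j sf) si).
Qed.

Lemma proj_norm i x : `|proj i x| <= `|x|.
Proof.
apply/rV_norm_leP => // l; rewrite projE.
by case: (l == i); rewrite ?normr0// coord_norm_le.
Qed.

Lemma mvt_proj f i x r M : smooth f -> `|x| <= r ->
  (forall y, `|y| <= r -> `|Dr i f y| <= M) ->
  `|f x - f (proj i x)| <= `|x| * M.
Proof.
move=> sf xr hM; have [c /andP[c0 c1]] := mvt_line i (proj i x) (x 0 i) sf.
rewrite proj_decomp => ->; rewrite normrM ler_pM// ?coord_norm_le//; apply: hM.
apply: le_trans xr; apply/rV_norm_leP => // l.
rewrite coord_lineE projE; case: eqP => _.
  by rewrite addr0 normrM ger0_norm// (le_trans (ler_piMl _ c1))// coord_norm_le.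
by rewrite add0r coord_norm_le.
Qed.

Lemma smooth_lipschitz f r : 0 <= r -> smooth f -> exists2 L, 0 <= L &
  forall x y, `|x| <= r -> `|y| <= r ->
    `|f x - f y| <= \sum_(l < n) L * `|x 0 l - y 0 l|.
Proof.
move=> r0 sf; have /choice[M hM] l : exists M : R, 0 <= M /\ forall x, `|x| <= r -> `|Dr l f x| <= M.
  by have [M ? ?] := bounded_ball r0 (smooth_cont (smooth_Dr l sf)); exists M.
have L0 : 0 <= \sum_l M l by apply: sumr_ge0 => l _; case: (hM l).
exists (\sum_l M l) => // x y xr yr.
(* A path from [y] to [x] that changes one coordinate at a time; by convexity of [[-r, r]] its
   segments stay in the ball. *)
pose p (k : nat) : X := \row_l (if (l < k)%N then x 0 l else y 0 l).
have p0 : p 0%N = y by apply/rowP => l; rewrite mxE.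
have pn : p n = x by apply/rowP => l; rewrite mxE ltn_ord.
suff H k : (k <= n)%N -> `|f (p k) - f (p 0%N)| <=
    \sum_(l < n | (l < k)%N) (\sum_l M l) * `|x 0 l - y 0 l|.
  have := H n (leqnn n); rewrite p0 pn => /le_trans; apply.
  by rewrite (eq_bigl xpredT) // => l; rewrite ltn_ord.
elim: k => [|k ih] kn; first by rewrite subrr normr0 big_pred0.
pose i := Ordinal kn.
have pS : p k.+1 = (x 0 i - y 0 i) *: evec R i + p k.
  apply/rowP => l; rewrite coord_lineE !mxE ltnS leq_eqVlt.
  rewrite -[(l == k :> nat)]/(l == i); case: eqP => [->|_] /=; last by rewrite add0r.
  by rewrite ltnn subrK.
have [c /andP[c0 c1] hc] := mvt_line i (p k) (x 0 i - y 0 i) sf.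
rewrite -(subrK (f (p k)) (f (p k.+1))) -addrA (le_trans (ler_normD _ _))//.
rewrite (bigD1 i)//= lerD//.
  rewrite pS hc normrM mulrC ler_wpM2r//.
  have [_ hi] := hM i; apply: (le_trans (hi _ _)); last first.
    by rewrite (bigD1 i)//= lerDl; apply: sumr_ge0 => l _; case: (hM l).
  apply/rV_norm_leP => // l; rewrite coord_lineE mxE.
  case: (eqVneq l i) => [->|_]; last first.
    rewrite add0r; case: ifP => _; [move: xr|move: yr]; apply: le_trans;
    exact: coord_norm_le.
  rewrite ltnn (_ : _ + _ = c * x 0 i + (1 - c) * y 0 i); last by ring.
  rewrite (le_trans (ler_normD _ _))// !normrM (ger0_norm c0).
  have -> : `|1 - c| = 1 - c by rewrite ger0_norm// subr_ge0.
  have xi := le_trans (coord_norm_le x i) xr; have yi := le_trans (coord_norm_le y i) yr.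
  rewrite (_ : r = c * r + (1 - c) * r); last by ring.
  by apply: lerD; [exact: (ler_wpM2l c0 xi) | apply: ler_wpM2l yi; rewrite subr_ge0].
rewrite (le_trans (ih (ltnW kn)))//.
rewrite le_eqVlt; apply/orP; left; apply/eqP; apply: eq_bigl => l.
by rewrite ltnS ltn_neqAle andbC -(val_eqE l i).
Qed.

End RealPolynomials.

Section Density.
Variables (R : realType) (n : nat).
Local Notation X := 'rV[R]_n.
Implicit Types (f g p q : X -> R) (x y : X).

(** The approximant is the tensor-product Bernstein operator on a grid of [[-r, r]^n]. The weights
    are nonnegative and sum to 1, so the error is an average of [|f x - f (nd k)|], controlled by a
    Lipschitz bound and the variance. *)
Lemma bernstein_approx f (r : R) : 0 < r -> smooth f -> forall e : R, 0 < e ->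
  exists2 p, rpoly p & forall x, `|x| <= r -> `|f x - p x| <= e.
Proof.
move=> r0 sf e e0; have [L L0 hL] := smooth_lipschitz (ltW r0) sf.
(* Each coordinate costs [2 d], for a total of [n / (n + 1) * e]; the successor covers [n = 0]. *)
pose d := e / (2 * n.+1%:R); have d0 : 0 < d by rewrite divr_gt0// mulr_gt0.
(* The value for which [d + A u^2 - L |u|] is a perfect square: it trades the Lipschitz bound for a
   quadratic one, whose average is a variance. *)
pose A := L ^+ 2 / (4 * d).
have A0 : 0 <= A by rewrite divr_ge0 ?sqr_ge0// mulr_ge0// ltW.
have amgm (u : R) : L * `|u| <= d + A * u ^+ 2.
  rewrite -subr_ge0 -[u ^+ 2]real_normK ?num_real//.
  have -> : d + A * `|u| ^+ 2 - L * `|u| = (2 * d - L * `|u|) ^+ 2 / (4 * d).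
    by rewrite /A; field; rewrite lt0r_neq0.
  by rewrite divr_ge0 ?sqr_ge0// mulr_ge0// ltW.
(* Large enough that [A] times the variance bound [4 r^2 / K] is at most [d]. *)
pose K := (Num.Def.archi_bound (A * (4 * r ^+ 2) / d)).+1.
have K0 : 0 < K%:R :> R by rewrite ltr0n.
have hK : A * (4 * r ^+ 2 / K%:R) <= d.
  have : A * (4 * r ^+ 2) / d < K%:R.
    apply: lt_trans (archi_boundP _) _; last by rewrite ltr_nat.
    by rewrite divr_ge0 ?(ltW d0)// mulr_ge0// mulr_ge0 ?sqr_ge0.
  by rewrite ltr_pdivrMr// [A * (_ / _)]mulrA ler_pdivrMr// [d * _]mulrC => /ltW.
pose node (k : nat) : R := 2 * r / K%:R * k%:R - r.
pose nd (k : {ffun 'I_n -> 'I_K.+1}) : X := \row_l node (k l).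
pose y (l : 'I_n) x := (2 * r)^-1 * x 0 l + 2^-1.
pose w (k : {ffun 'I_n -> 'I_K.+1}) x := \prod_l bern K (k l) (y l x).
exists (fun x => \sum_k f (nd k) * w k x).
  apply: rpoly_sum => k; apply: rpolyZ; apply: rpoly_prod => l; apply: rpoly_bern.
  rewrite /y; apply: rpolyD; last exact: rpoly_cst.
  by apply: rpolyZ; exact: rpoly_coord.
move=> x xr.
have r2 : (2 * r) != 0 by rewrite mulf_neq0 ?lt0r_neq0// .
have y01 l : 0 <= y l x <= 1.
  have /ler_normlP[x1 x2] := le_trans (coord_norm_le x l) xr.
  have -> : y l x = (x 0 l + r) / (2 * r) by rewrite /y; field; exact: lt0r_neq0.
  by rewrite divr_ge0 ?ler_pdivrMr ?mulr_gt0 ?mulr_ge0 ?(ltW r0)//; lra.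
have w0 k : 0 <= w k x by apply: prodr_ge0 => l _; apply: bern_ge0.
have w1 : \sum_k w k x = 1.
  rewrite /w -(bigA_distr_bigA (fun l (j : 'I_K.+1) => bern K j (y l x))).
  by rewrite big1// => l _; apply: bern_sum1.
have wl l : \sum_k w k x * (x 0 l - node (k l)) ^+ 2 <= 4 * r ^+ 2 / K%:R.
  pose G j (i : 'I_K.+1) := bern K i (y j x) * (if j == l then (x 0 l - node i) ^+ 2 else 1).
  have -> : \sum_k w k x * (x 0 l - node (k l)) ^+ 2 =
      \sum_(k : {ffun 'I_n -> 'I_K.+1}) \prod_j G j (k j).
    apply: eq_bigr => k _; rewrite big_split /=; congr (_ * _).
    by rewrite -big_mkcond big_pred1_eq.
  rewrite -bigA_distr_bigA (bigD1 l)//= [X in _ * X]big1; last first.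
    move=> j /negbTE jl; rewrite /G jl; under eq_bigr do rewrite mulr1.
    exact: bern_sum1.
  rewrite mulr1 /G eqxx.
  under eq_bigr => i _.
    have -> : (x 0 l - node i) ^+ 2 = (2 * r / K%:R) ^+ 2 * (i%:R - K%:R * y l x) ^+ 2.
      rewrite /node /y; field.
      by rewrite (lt0r_neq0 r0) (lt0r_neq0 K0).
    rewrite mulrCA; over.
  rewrite -mulr_sumr bern_var subrr expr0n addr0.
  have /andP[y0 y1] := y01 l.
  have -> : (2 * r / K%:R) ^+ 2 * (K%:R * y l x * (1 - y l x)) =
     4 * r ^+ 2 / K%:R * (y l x * (1 - y l x)).
    by field; rewrite (lt0r_neq0 K0).
  rewrite ler_piMr ?divr_ge0 ?mulr_ge0 ?sqr_ge0 ?(ltW r0) ?(ltW K0)//.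
  by rewrite mulr_ile1// ?subr_ge0// lerBlDr lerDl.
have ndr k : `|nd k| <= r.
  apply/rV_norm_leP => [|l]; first exact: ltW.
  rewrite mxE /node ler_norml lerBlDr lerBrDr addNr.
  rewrite mulr_ge0 ?ler0n//=; last by rewrite divr_ge0 ?mulr_ge0 ?(ltW r0) ?(ltW K0).
  have kK : (k l)%:R <= K%:R :> R by rewrite ler_nat -ltnS.
  rewrite -mulrA (_ : r + r = 2 * r); last by ring.
  by rewrite ler_piMr ?mulr_ge0 ?(ltW r0)// mulrC ler_pdivrMr// mul1r.
have -> : f x - \sum_k f (nd k) * w k x = \sum_k (f x - f (nd k)) * w k x.
  by under [RHS]eq_bigr do rewrite mulrBl; rewrite sumrB -mulr_sumr w1 mulr1.
apply: le_trans (ler_norm_sum _ _ _) _.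
apply: (@le_trans _ _ (\sum_(k : {ffun 'I_n -> 'I_K.+1}) \sum_(l < n) (d + A * (x 0 l - node (k l)) ^+ 2) * w k x)).
  apply: ler_sum => k _; rewrite normrM (ger0_norm (w0 k)) -mulr_suml ler_wpM2r//.
  apply: le_trans (hL _ _ xr (ndr k)) _; apply: ler_sum => l _.
  by rewrite mxE amgm.
rewrite exchange_big /=.
apply: (@le_trans _ _ (\sum_(l < n) (d + d))).
  apply: ler_sum => l _; rewrite (eq_bigr (fun k : {ffun 'I_n -> 'I_K.+1} =>
    d * w k x + A * (w k x * (x 0 l - node (k l)) ^+ 2))) => [|k _]; last by ring.
  rewrite big_split /= -!mulr_sumr w1 mulr1 lerD2l.
  by apply: le_trans hK; apply: ler_wpM2l.
rewrite sumr_const card_ord -mulr2n -mulrnA -mulr_natl natrM /d.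
rewrite (_ : _ * (_ / _) = n%:R / n.+1%:R * e); last by field; rewrite ?nat1r ?natr1 pnatr_eq0.
by rewrite ler_piMl ?(ltW e0)// ler_pdivrMr ?ltr0n// mul1r ler_nat.
Qed.

Lemma iterDB s f g : smooth f -> smooth g ->
  iterD s (fun x => f x - g x) = fun x => iterD s f x - iterD s g x.
Proof.
elim/last_ind : s f g => [//|s i ih] f g sf sg.
by rewrite !iterD_rcons (DrB _ sf sg) (ih _ _ (smooth_Dr i sf) (smooth_Dr i sg)).
Qed.

Lemma iterD_rem s i f : smooth f -> i \in s -> iterD s f = iterD (rem i s) (Dr i f).
Proof.
move=> sf si; rewrite -iterD_rcons; apply: iterD_perm => //.
by rewrite perm_sym perm_rcons perm_sym perm_to_rem.
Qed.

(* Induction on the total order of the multi-index [D]: for [D i > 0], recover [f] from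
   an approximation of its [i]-th derivative and one of its restriction to [x_i = 0]. *)
Lemma smooth_approx (r : R) (D : 'I_n -> nat) f (e : R) : 0 < r -> smooth f -> 0 < e ->
  exists2 p, rpoly p & forall s, (forall i, (count_mem i s <= D i)%N) ->
    forall x, `|x| <= r -> `|iterD s f x - iterD s p x| <= e.
Proof.
move=> r0; have [N] := ubnP (\sum_i D i); elim: N D f e => // N ih D f e.
rewrite ltnS => DN sf e0.
have [D0|] := pselect (forall i, D i = 0%N).
  have [p rp hp] := bernstein_approx r0 sf e0; exists p => // s sD.
  suff -> : s = [::] by [].
  by case: s sD => // i s /(_ i); rewrite /= eqxx D0.
move=> /existsNP[i /eqP]; rewrite -lt0n => Di.
(* [D'] is the budget of derivatives left for [Dr i f]; [D0] is that of the restriction to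
   [x_i = 0], where no derivative in [x_i] is needed. *)
pose D' j := (D j - (j == i))%N; pose D0 j := if j == i then 0%N else D j.
have D'N : (\sum_j D' j < N)%N.
  apply: leq_trans DN; rewrite (bigD1 i)//= [leqRHS](bigD1 i)//= /D' eqxx -addSn.
  by rewrite subn1 prednK//; apply: leq_add => //; apply: leq_sum => j _; apply: leq_subr.
have D0N : (\sum_j D0 j < N)%N.
  apply: leq_trans DN; rewrite (bigD1 i)//= [leqRHS](bigD1 i)//= /D0 eqxx add0n.
  rewrite -add1n leq_add//; apply: leq_sum => j /negbTE -> //.
(* The bound [e / (2 r)] gives [e / 2] after integration over a length of at most [r]; the bound
   [e / 2] handles words that contain [i]. *)
have e1 : 0 < Num.min (e / 2) (e / (2 * r)).
  by rewrite lt_min !divr_gt0// mulr_gt0.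
have [p rp hp] := ih D' _ _ D'N (smooth_Dr i sf) e1.
have [q0 rq0 hq0] := ih D0 _ (e / 2) D0N sf (divr_gt0 e0 (ltr0n _ 2)).
have [q1 [rq1 Dq1 q10]] := rpoly_prim i rp.
pose q x := q1 x + q0 (proj i x).
have rq : rpoly q := rpolyD rq1 (rpoly_proj i rq0).
have sq := rpoly_smooth rq; have sq0 := rpoly_smooth rq0; have sp := rpoly_smooth rp.
have Dq : Dr i q = p.
  rewrite (DrD _ (rpoly_smooth rq1) (rpoly_smooth (rpoly_proj i rq0))) Dq1.
  rewrite (proj2 (smooth_proj i sq0)) eqxx.
  by apply/funext => x; rewrite addr0.
have key s x : (forall j, (count_mem j s <= D' j)%N) -> `|x| <= r ->
    `|iterD s (Dr i f) x - iterD s (Dr i q) x| <= Num.min (e / 2) (e / (2 * r)).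
  by move=> sD xr; rewrite Dq; apply: hp.
(* If [i] occurs in [s], one copy is moved innermost and [Dr i q = p] applies. Otherwise the error
   at [x] is compared with the error at [proj i x], where [q] reduces to [q0]. *)
exists q => // s sD x xr; have [si|si] := boolP (i \in s).
  rewrite !(iterD_rem _ si)//; apply: (@le_trans _ _ (Num.min (e / 2) (e / (2 * r)))).
    apply: key => // j; rewrite count_rem si /= /D'.
    by rewrite [i == j]eq_sym leq_sub2r.
  by rewrite ge_min; apply/orP; left; rewrite ler_pdivrMr// ler_peMr ?(ltW e0)// ler1n.
pose E x := f x - q x; have sE : smooth E := smoothB sf sq.
have -> : iterD s f x - iterD s q x = iterD s E x by rewrite iterDB.
have cs : count_mem i s = 0%N by apply/count_memPn.
have bD y : `|y| <= r -> `|Dr i (iterD s E) y| <= e / (2 * r).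
  move=> yr; rewrite (Dr_iterD _ _ sE) (DrB _ sf sq) iterDB; last 2 first.
    exact: smooth_Dr.
    exact: smooth_Dr.
  apply: (le_trans (key s y _ yr)); last by rewrite ge_min lexx orbT.
  move=> j; rewrite /D'; case: eqP => [->|_]; first by rewrite cs.
  by rewrite subn0.
have := mvt_proj (smooth_iterD s sE) xr bD.
have -> : iterD s E (proj i x) = iterD s f (proj i x) - iterD s q0 (proj i x).
  rewrite -[LHS]/((fun x => iterD s E (proj i x)) x) -(iterD_proj sE si).
  have -> : (fun x => E (proj i x)) = fun x => (fun x => f x - q0 x) (proj i x).
    apply/funext => y; rewrite /E /q q10 add0r; congr (_ - q0 _).
    by apply/rowP => l; rewrite !projE; case: (l == i).
  by rewrite (iterD_proj (smoothB sf sq0) si) iterDB.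
move=> h1; have h2 : `|iterD s f (proj i x) - iterD s q0 (proj i x)| <= e / 2.
  apply: hq0; last exact: le_trans (proj_norm i x) xr.
  by move=> j; rewrite /D0; case: eqP => [->|_]; rewrite ?cs.
rewrite -[iterD s E x](subrK (iterD s f (proj i x) - iterD s q0 (proj i x))).
rewrite (le_trans (ler_normD _ _))// [leRHS](splitr e) lerD// (le_trans h1)//.
apply: (@le_trans _ _ (r * (e / (2 * r)))).
  by rewrite ler_wpM2r// divr_ge0 ?mulr_ge0 ?(ltW r0) ?(ltW e0).
by rewrite (_ : r * _ = e / 2)//; field; exact: lt0r_neq0.
Qed.

Lemma iterD_cst0 s : iterD s ((fun=> 0) : X -> R) = fun=> 0.
Proof. by elim/last_ind : s => [//|s i ih]; rewrite iterD_rcons Dr_cst ih. Qed.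

Lemma iterDC_real s f : iterDC s (fun x => (f x)%:C) = fun x => (iterD s f x)%:C.
Proof. by apply/funext => x; rewrite /iterDC /= iterD_cst0. Qed.

Lemma cdist_tmon0 (F : (X -> R[i]) -> R[i]) : cdist F ->
  (forall m, F (fun x => (tmon 0 m x)%:C) = 0) -> forall phi, csmooth phi -> F phi = 0.
Proof.
move=> dF F0.
have Fp p : rpoly p -> F (fun x => (p x)%:C) = 0.
  elim=> [|a m q rq ih]; first exact: (cdist0 dF).
  under eq_fun do rewrite rmorphD rmorphM.
  rewrite (cdist_lin dF); last 2 first.
    exact/csmooth_real/smooth_tmon.
    exact/csmooth_real/rpoly_smooth.
  by rewrite F0 ih mulr0 addr0.
have Ff f : smooth f -> F (fun x => (f x)%:C) = 0.
  move=> sf; apply: Normc.eq0_normc; apply/eqP; rewrite -normr_le0 ger0_norm ?normc_ge0//.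
  have [_ [r [C [N [r0 C0 bF]]]]] := dF.
  apply/ler_addgt0Pr => e e0; rewrite add0r.
  have e1 : 0 < e / (C + 1) by rewrite divr_gt0// ltr_wpDl.
  (* The radius [r + 1] and the denominator [C + 1] are positive even if [r] or [C] is 0. A word of
     length at most [N] uses each letter at most [N] times. *)
  have [p rp hp] := @smooth_approx (r + 1) (fun=> N) f _ (ltr_wpDl r0 ltr01) sf e1.
  have sp := rpoly_smooth rp.
  have -> : F (fun x => (f x)%:C) = F (fun x => (f x - p x)%:C).
    have -> : (fun x => (f x)%:C) = fun x => (f x - p x)%:C + (p x)%:C.
      by apply/funext => x; rewrite -rmorphD subrK.
    by rewrite (cdistD dF (csmooth_real (smoothB sf sp)) (csmooth_real sp)) (Fp _ rp) addr0.
  apply: (@le_trans _ _ (C * (e / (C + 1)))).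
    apply: bF; first exact: (csmooth_real (smoothB sf sp)).
    move=> s sN x xr; rewrite iterDC_real normc_real iterDB//; apply: hp.
      by move=> i; apply: leq_trans (count_size _ _) sN.
    by rewrite (le_trans xr)// lerDl.
  rewrite mulrCA ler_piMr ?(ltW e0)// ler_pdivrMr ?mul1r ?lerDl//.
  by rewrite ltr_wpDl.
move=> phi [sr si].
have -> : phi = fun x => 'i%C * (complex.Im (phi x))%:C + (complex.Re (phi x))%:C.
  by apply/funext => x; rewrite addrC -complexE.
by rewrite (cdist_lin dF) ?Ff ?mulr0 ?addr0//; apply: csmooth_real.
Qed.

End Density.

(** * Growth of the Fourier transform *)

Section TruncatedExponential.
Variable K : numFieldType.
Implicit Types x y : K.

Definition texp (N : nat) x : K := \sum_(k < N) x ^+ k / k`!%:R.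

Lemma texpS N x : texp N.+1 x = texp N x + x ^+ N / N`!%:R.
Proof. by rewrite /texp big_ord_recr. Qed.

Lemma texpD N x y : texp N (x + y) =
  \sum_(k < N) \sum_(l < N - k) x ^+ k * y ^+ l * (k`!%:R * l`!%:R)^-1.
Proof.
elim: N => [|N ih]; first by rewrite /texp !big_ord0.
rewrite texpS ih [RHS]big_ord_recr /= subSnn big_ord1.
have -> : \sum_(k < N) \sum_(l < N.+1 - k) x ^+ k * y ^+ l * (k`!%:R * l`!%:R)^-1 =
    \sum_(k < N) (\sum_(l < N - k) x ^+ k * y ^+ l * (k`!%:R * l`!%:R)^-1 +
      x ^+ k * y ^+ (N - k) * (k`!%:R * (N - k)`!%:R)^-1).
  by apply: eq_bigr => k _; rewrite subSn ?(ltnW (ltn_ord k))// big_ord_recr.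
rewrite big_split /= -addrA; congr (_ + _).
have -> : x ^+ N * y ^+ 0 * (N`!%:R * 0`!%:R)^-1 =
    x ^+ N * y ^+ (N - N) * (N`!%:R * (N - N)`!%:R)^-1 by rewrite subnn.
suff -> : (x + y) ^+ N / N`!%:R = \sum_(k < N.+1) x ^+ k * y ^+ (N - k) *
    (k`!%:R * (N - k)`!%:R)^-1 by rewrite big_ord_recr.
rewrite addrC exprDn mulr_suml; apply: eq_bigr => k _.
have kN : (k <= N)%N by rewrite -ltnS.
have := bin_fact kN => /(congr1 (fun u => u%:R : K)); rewrite !natrM => <-.
have f0 j : (j`!%:R : K) != 0 by rewrite pnatr_eq0 -lt0n fact_gt0.
have b0 : ('C(N, k)%:R : K) != 0 by rewrite pnatr_eq0 -lt0n bin_gt0.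
rewrite -mulr_natl [y ^+ _ * _]mulrC; field.
by rewrite b0 !f0.
Qed.

(** The truncation at [x + y] keeps exactly the terms with [k + l < N]. All coefficients are
    nonnegative, so bounding the remaining terms by their moduli gives the same expression at
    nonnegative reals. *)
Lemma texp_cross N x y : texp N x * texp N y - texp N (x + y) =
  \sum_(k < N) \sum_(l < N | (N <= k + l)%N) x ^+ k * y ^+ l * (k`!%:R * l`!%:R)^-1.
Proof.
have -> : texp N x * texp N y =
    \sum_(k < N) \sum_(l < N) x ^+ k * y ^+ l * (k`!%:R * l`!%:R)^-1.
  rewrite /texp mulr_suml; apply: eq_bigr => k _; rewrite mulr_sumr.
  by apply: eq_bigr => l _; rewrite invfM; ring.
rewrite texpD -sumrB; apply: eq_bigr => k _.
rewrite (bigID (fun l : 'I_N => (N <= k + l)%N)) /=.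
rewrite (big_ord_widen N (fun l => x ^+ k * y ^+ l * (k`!%:R * l`!%:R)^-1)) ?leq_subr//.
rewrite [X in _ + X - _](eq_bigl (fun l : 'I_N => (l < N - k)%N)) ?addrK// => l.
by rewrite -ltnNge ltn_subRL.
Qed.

End TruncatedExponential.

Section ExponentialLimits.
Variable R : realType.

Lemma texp_series N (y : R) : texp N y = series (exp_coeff y) N.
Proof. by rewrite /series /= big_mkord. Qed.

Lemma texp_cvg (y : R) : texp N y @[N --> \oo] --> expR y.
Proof.
have -> : (fun N => texp N y) = series (exp_coeff y).
  by apply/funext => N; apply: texp_series.
exact: is_cvg_series_exp_coeff.
Qed.

Lemma texp_near (y e : R) : 0 < e ->
  exists N0, forall N, (N0 <= N)%N -> `|expR y - texp N y| <= e.
Proof.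
move=> e0; have /cvgr_dist_le/(_ _ e0)[N0 _ h] := @texp_cvg y.
by exists N0 => N NN; apply: h.
Qed.

Lemma texp_mono (y : R) M N : 0 <= y -> (N <= M)%N -> texp N y <= texp M y.
Proof.
move=> y0 /subnK <-; elim: (M - N)%N => // k; rewrite addSn => h.
by rewrite texpS (le_trans h)// lerDl divr_ge0// exprn_ge0.
Qed.

Lemma texp_le_exp (y : R) N : 0 <= y -> texp N y <= expR y.
Proof.
move=> y0; apply/ler_addgt0Pr => e e0; have [N0 h] := texp_near y e0.
apply: le_trans (texp_mono y0 (leq_maxr N0 N)) _.
have /ler_normlP[h1 _] := h _ (leq_maxl N0 N).
by rewrite -lerBlDl -opprB.
Qed.

Lemma i_pow k : ('i%C : R[i]) ^+ k =
  ((~~ odd k)%:R * (-1) ^+ k./2) +i* ((odd k)%:R * (-1) ^+ k.-1./2).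
Proof.
have D j : ('i%C : R[i]) ^+ j.*2 = ((-1) ^+ j)%:C.
  by rewrite -mul2n exprM sqr_i rmorphXn /= rmorphN1.
rewrite -(odd_double_half k); case: (odd k); rewrite ?add0n ?add1n.
  rewrite exprS D /= odd_double /= doubleK uphalf_double !(mul0r, mul1r).
  by apply: complexP; rewrite ?ReM ?ImM /= !(mul0r, mul1r, mulr0) ?subr0 ?add0r ?addr0.
by rewrite D odd_double /= doubleK !(mul0r, mul1r).
Qed.

Definition cis (y : R) : R[i] := cos y +i* sin y.

Lemma normc_cis y : normc (cis y) = 1.
Proof. by rewrite /= cos2Dsin2 sqrtr1. Qed.

Lemma texp_i N (y : R) :
  texp N ('i * y%:C) = series (cos_coeff y) N +i* series (sin_coeff y) N.
Proof.
elim: N => [|N ih]; first by rewrite /texp /series /= !big_ord0 !big_geq.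
rewrite texpS ih /series /= !big_nat_recr //= exprMn i_pow -rmorphXn /=.
rewrite -[N`!%:R in LHS](rmorph_nat (real_complex R)) -fmorphV.
apply: complexP; rewrite ?ReD ?ImD !(ReM, ImM) /= !(mulr0, mul0r, subr0, addr0, add0r).
  by rewrite /cos_coeff /=.
by rewrite /sin_coeff /=.
Qed.

Lemma normc_texp_diff N M (w : R[i]) Y : (N <= M)%N -> normc w <= Y ->
  normc (texp M w - texp N w) <= texp M Y - texp N Y.
Proof.
move=> NM wY; have Y0 : 0 <= Y := le_trans (normc_ge0 w) wY.
rewrite -(subnK NM); elim: (M - N)%N => [|k ih].
  by rewrite !subrr normc0.
rewrite addSn !texpS addrAC [leRHS]addrAC (le_trans (normcD _ _))// lerD//.
rewrite Normc.normcM normcX Normc.normcV.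
rewrite -[_%:R in leLHS](rmorph_nat (real_complex R)) normc_real ger0_norm//.
by rewrite ler_wpM2r ?invr_ge0// lerXn2r// nnegrE normc_ge0.
Qed.

Lemma lim_dist (u : nat -> R) (l : R) N (c : R) : u @ \oo --> l ->
  (forall M, (N <= M)%N -> `|u M - u N| <= c) -> `|l - u N| <= c.
Proof.
move=> ul h; apply/ler_addgt0Pr => e e0.
have /cvgr_dist_le/(_ _ e0)[N0 _ hN0] := ul.
have h1 := hN0 _ (leq_maxl N0 N); have h2 := h _ (leq_maxr N0 N).
rewrite -(subrK (u (maxn N0 N)) l) -addrA (le_trans (ler_normD _ _))//.
by rewrite [leRHS]addrC lerD.
Qed.

(** The tail is dominated termwise by the real tail at [Y]; the factor 2 comes from treating the
    cosine and sine series separately. *)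
Lemma cis_texp N (y Y : R) : `|y| <= Y ->
  normc (cis y - texp N ('i * y%:C)) <= 2 * (expR Y - texp N Y).
Proof.
move=> yY; have Y0 : 0 <= Y := le_trans (normr_ge0 y) yY.
have nw : normc ('i * y%:C) <= Y.
  rewrite Normc.normcM normc_real /= expr0n expr1n add0r sqrtr1 mul1r//.
have B M : (N <= M)%N -> normc (texp M ('i * y%:C) - texp N ('i * y%:C)) <= expR Y - texp N Y.
  by move=> NM; apply: le_trans (normc_texp_diff NM nw) _; rewrite lerB// texp_le_exp.
rewrite (le_trans (normc_le_ReIm _))// mulrDl mul1r texp_i /=.
apply: lerD.
  apply: lim_dist => [|M NM].
    by rewrite unlock; apply: is_cvg_series_cos_coeff.
  by have := le_trans (normc_Re _) (B M NM); rewrite !texp_i.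
apply: lim_dist => [|M NM].
  by rewrite unlock; apply: is_cvg_series_sin_coeff.
by have := le_trans (normc_Im _) (B M NM); rewrite !texp_i.
Qed.

End ExponentialLimits.

Section ExponentialCalculus.
Variables (R : realType) (n : nat).
Local Notation X := 'rV[R]_n.
Implicit Types (f : X -> R) (phi psi : X -> R[i]).

Lemma is_derive_comp (g g' : R -> R) f i x : smooth f ->
  (forall y : R, is_derive y 1 g (g' y)) ->
  is_derive x (evec R i) (fun x => g (f x)) (g' (f x) * Dr i f x).
Proof.
move=> sf dg.
have D : is_derive 0 (1 : R) (fun h : R => g (f (h *: evec R i + x))) (g' (f x) * Dr i f x).
  have h1 := is_derive_line i x 0 sf; rewrite scale0r add0r in h1.
  have h2 := dg (f (0 *: evec R i + x)); rewrite scale0r add0r in h2.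
  apply: (@is_derive1_comp _ g (fun h : R => f (h *: evec R i + x))) => //.
  by rewrite scale0r add0r.
apply: DeriveDef; first by apply/derivable1P; have [] := D.
by rewrite -DrP DrE; have [] := D.
Qed.

(** The functions [u cos f + v sin f] with [u], [v] smooth form a class stable under [Dr]. *)
Lemma smooth_trig f (al be : R) : smooth f ->
  smooth (fun x => al * cos (f x) + be * sin (f x)).
Proof.
move=> sf; pose P (h : X -> R) := exists u v, [/\ smooth u, smooth v &
  h = fun x => u x * cos (f x) + v x * sin (f x)].
apply: (@smooth_coind _ _ P); last first.
  by exists (fun=> al), (fun=> be); split => //; apply: smooth_cst.
move=> _ [u [v [su sv ->]]].
have dc i x := is_derive_comp i x sf (@is_derive_cos R).
have ds i x := is_derive_comp i x sf (@is_derive_sin R).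
have cc x : {for x, continuous (fun x => cos (f x))}.
  by apply: (@continuous_comp _ _ _ f (@cos R)); [exact: (smooth_cont sf) | exact: continuous_cos].
have cs x : {for x, continuous (fun x => sin (f x))}.
  by apply: (@continuous_comp _ _ _ f (@sin R)); [exact: (smooth_cont sf) | exact: continuous_sin].
split.
  move=> x; exact: (continuousD (continuousM (smooth_cont su x) (cc x))
    (continuousM (smooth_cont sv x) (cs x))).
have dcx i x : derivable (fun x => cos (f x)) x (evec R i) by have [] := dc i x.
have dsx i x : derivable (fun x => sin (f x)) x (evec R i) by have [] := ds i x.
move=> i; split.
  move=> x; apply: derivableD; apply: derivableM => //; exact: smooth_derivable.
exists (fun x => Dr i u x + v x * Dr i f x), (fun x => Dr i v x - u x * Dr i f x); split.
- exact: (smoothD (smooth_Dr i su) (smoothM sv (smooth_Dr i sf))).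
- exact: (smoothB (smooth_Dr i sv) (smoothM su (smooth_Dr i sf))).
apply/funext => x; rewrite DrP.
rewrite [LHS]deriveD; last 2 first.
- by apply: derivableM => //; exact: smooth_derivable.
- by apply: derivableM => //; exact: smooth_derivable.
rewrite [X in X + _]deriveM//; last exact: smooth_derivable.
rewrite [X in _ + X]deriveM//; last exact: smooth_derivable.
have [_ ->] := dc i x; have [_ ->] := ds i x.
by rewrite -!DrP /GRing.scale /=; ring.
Qed.

Lemma csmooth_cis f : smooth f -> csmooth (fun x => cis (f x)).
Proof.
move=> sf; split.
  rewrite (_ : (fun x => _) = fun x => 1 * cos (f x) + 0 * sin (f x)); first exact: smooth_trig.
  by apply/funext => x; rewrite /= mul1r mul0r addr0.
rewrite (_ : (fun x => _) = fun x => 0 * cos (f x) + 1 * sin (f x)); first exact: smooth_trig.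
by apply/funext => x; rewrite /= mul1r mul0r add0r.
Qed.

Lemma DC_cis f i : smooth f ->
  DC i (fun x => cis (f x)) = fun x => 'i * (Dr i f x)%:C * cis (f x).
Proof.
move=> sf; apply/funext => x; apply: complexP; rewrite !(ReM, ImM) /= !DrP.
  have [_ ->] := is_derive_comp i x sf (@is_derive_cos R).
  by rewrite DrP; ring.
have [_ ->] := is_derive_comp i x sf (@is_derive_sin R).
by rewrite DrP; ring.
Qed.

Lemma DCX phi i k : csmooth phi ->
  DC i (fun x => phi x ^+ k.+1) = fun x => k.+1%:R * phi x ^+ k * DC i phi x.
Proof.
move=> sp; elim: k => [|k ih].
  under eq_fun do rewrite expr1; apply/funext => x.
  by rewrite expr0 !mul1r.
under eq_fun do rewrite exprS; rewrite (DCM _ sp (csmoothX k.+1 sp)) ih.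
by apply/funext => x; rewrite exprS -[k.+2%:R]natr1; ring.
Qed.

Lemma csmooth_texp N phi : csmooth phi -> csmooth (fun x => texp N (phi x)).
Proof.
move=> sp; apply: csmooth_sum => k _; under eq_fun do rewrite mulrC.
by apply: csmoothZ; apply: csmoothX.
Qed.

Lemma DC_texp N phi i : csmooth phi ->
  DC i (fun x => texp N (phi x)) = fun x => DC i phi x * texp N.-1 (phi x).
Proof.
move=> sp; elim: N => [|[|N] ih].
- under eq_fun do rewrite /texp big_ord0; rewrite DC_cst.
  by apply/funext => x; rewrite /texp big_ord0 mulr0.
- under eq_fun do rewrite /texp big_ord1 expr0; rewrite DC_cst.
  by apply/funext => x; rewrite /texp big_ord0 mulr0.
under eq_fun do rewrite texpS mulrC.
rewrite DCD; [|exact: csmooth_texp|by apply: csmoothZ; apply: csmoothX].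
rewrite ih DCZ ?DCX//; last exact: csmoothX.
apply/funext => x /=; rewrite texpS mulrDr; congr (_ + _).
have f0 : ((N`!)%:R : R[i]) != 0 by rewrite pnatr_eq0 -lt0n fact_gt0.
have N0 : (N.+1%:R : R[i]) != 0 by rewrite pnatr_eq0.
by rewrite factS natrM; field; rewrite ?nat1r N0 f0.
Qed.

Lemma iterDCZ s (c : R[i]) phi : csmooth phi ->
  iterDC s (fun x => c * phi x) = fun x => c * iterDC s phi x.
Proof.
elim/last_ind : s phi => [|s i ih] phi sp; first by rewrite !iterDC_nil.
by rewrite !iterDC_rcons (DCZ _ _ sp) (ih _ (csmooth_DC i sp)).
Qed.

(** Serves the exponential remainders: differentiating along a linear phase gives a constant factor
    and lowers the truncation index. *)
Lemma iterDC_family (u : nat -> X -> R[i]) (c : 'I_n -> R[i]) s k :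
  (forall k, csmooth (u k)) ->
  (forall k j, DC j (u k) = fun x => c j * u k.-1 x) ->
  iterDC s (u k) = fun x => (\prod_(j <- s) c j) * u (k - size s)%N x.
Proof.
move=> su Du; elim/last_ind : s k => [|s j ih] k.
  by rewrite iterDC_nil; apply/funext => x; rewrite big_nil mul1r subn0.
rewrite iterDC_rcons Du (iterDCZ _ _ (su _)) ih.
apply/funext => x; rewrite size_rcons -cats1 big_cat big_seq1 /=.
by rewrite -subn1 -subnDA add1n; ring.
Qed.

End ExponentialCalculus.

Section Growth.
Variables (R : realType) (n : nat) (a b : 'I_n).
Local Notation X := 'rV[R]_n.
Variable F : (X -> R[i]) -> R[i].
Hypothesis dF : cdist F.

Let z (x : X) : R[i] := x 0 a +i* x 0 b.

Lemma csmooth_z : csmooth z.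
Proof. by split; apply: smooth_coord. Qed.

(** This is [2 Im (t z)], the real phase of [exp (t z - conj (t z))]. *)
Let ell (t : R[i]) (x : X) : R :=
  2 * (complex.Re t * x 0 b) + 2 * (complex.Im t * x 0 a).

Let ellE t x : 'i * (ell t x)%:C = t * z x + - conjc t * conjc (z x).
Proof.
case: t => p q; apply: complexP; rewrite !(ReD, ImD, ReM, ImM) /ell /z /=; ring.
Qed.

Let smooth_ell t : smooth (ell t).
Proof.
apply: smoothD; apply: smoothZ; apply: smoothZ; exact: smooth_coord.
Qed.

Let Dr_ell t j : Dr j (ell t) =
  fun=> 2 * (complex.Re t * (j == b)%:R) + 2 * (complex.Im t * (j == a)%:R).
Proof.
rewrite DrD ?DrZ ?Dr_coord//; do ?apply: smoothZ; exact: smooth_coord.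
Qed.

(** At [k = 0] the remainder is the exponential itself, so the estimate [bnd_u] covers both the main
    term and the truncation error. *)
Let u (t : R[i]) (k : nat) (x : X) : R[i] := cis (ell t x) - texp k ('i * (ell t x)%:C).

Let csmooth_u t k : csmooth (u t k).
Proof.
apply: csmoothD; first exact: csmooth_cis.
rewrite (_ : (fun x => _) = fun x => -1 * texp k ('i * (ell t x)%:C)); last first.
  by apply/funext => x; rewrite mulN1r.
by apply: csmoothZ; apply: csmooth_texp; apply: csmoothZ; apply: csmooth_real.
Qed.

Let DC_u t k j : DC j (u t k) = fun x =>
  ('i * (2 * (complex.Re t * (j == b)%:R) + 2 * (complex.Im t * (j == a)%:R))%:C) * u t k.-1 x.
Proof.
have s1 : csmooth (fun x => 'i * (ell t x)%:C : R[i]).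
  by apply: csmoothZ; apply: csmooth_real.
have E : u t k = fun x => cis (ell t x) + -1 * texp k ('i * (ell t x)%:C).
  by apply/funext => x; rewrite mulN1r.
rewrite E DCD; [|exact: csmooth_cis|by apply: csmoothZ; apply: csmooth_texp].
rewrite DCZ; last exact: csmooth_texp.
rewrite DC_cis// DC_texp// DCZ; last exact: csmooth_real.
have -> : DC j (fun x => (ell t x)%:C) = fun x => (Dr j (ell t) x)%:C.
  by rewrite /DC /= Dr_cst.
by rewrite Dr_ell; apply/funext => x; rewrite /u; ring.
Qed.

(** A derivative contributes a factor of modulus at most [4 rho]; adding 1 makes the powers
    increasing, so that all orders up to [N] share one bound. *)
Let bnd_u t rho r N k T : 0 <= r -> 0 <= rho -> normc t <= rho ->
  (forall l x, (l <= N)%N -> `|x| <= r -> normc (u t (k - l) x) <= T) ->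
  bnd r N (u t k) ((1 + 4 * rho) ^+ N * T).
Proof.
move=> r0 rho0 trho hT s sN x xr.
rewrite (iterDC_family s k (csmooth_u t) (DC_u t)) Normc.normcM ler_pM ?normc_ge0//; last exact: hT.
apply: (@le_trans _ _ ((1 + 4 * rho) ^+ size s)); last first.
  by rewrite ler_weXn2l// lerDl mulr_ge0.
have tR := le_trans (normc_Re t) trho; have tI := le_trans (normc_Im t) trho.
elim: s {sN} => [|j s ih]; first by rewrite big_nil [normc _]Normc.normc1.
rewrite big_cons Normc.normcM exprS ler_pM ?normc_ge0//.
rewrite Normc.normcM normc_real /= expr0n expr1n add0r sqrtr1 mul1r.
have B (y : R) (c : bool) : `|y| <= rho -> `|2 * (y * c%:R)| <= 2 * rho.
  move=> yr; rewrite !normrM normr_nat ler_wpM2l// -[leRHS]mulr1 ler_pM//.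
  by case: c; rewrite ?normr1 ?normr0.
rewrite (le_trans (ler_normD _ _))//.
rewrite (le_trans (lerD (B _ _ tR) (B _ _ tI)))//; lra.
Qed.

(* [texp N (t z) * texp N (- conj t * conj z)] converges to [cis (2 Im (t z))], which has
   modulus 1 and whose derivatives grow polynomially in [t]. *)
Lemma exp_growth : exists D : nat, forall psi, csmooth psi -> exists2 C : R, 0 <= C &
  forall rho, 0 <= rho -> exists N0, forall N, (N0 <= N)%N -> forall t, normc t <= rho ->
    normc (F (fun x => psi x * (texp N (t * z x) * texp N (- conjc t * conjc (z x)))))
      <= C * (1 + rho) ^+ D.
Proof.
(* [D] is the number of derivatives in the continuity estimate of [F], fixed before [psi]. *)
have [_ [r [C [D [r0 C0 bF]]]]] := dF; exists D => psi spsi.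
have [Cp Cp0 hCp] := bndM r0 D spsi.
have [M M0 hM] := bnd_ex r0 D spsi.
have [B1 B10 hB1] := bndM r0 D csmooth_z.
have [B2 B20 hB2] := bndM r0 D (csmooth_conj csmooth_z).
pose B := B1 + B2.
have B0 : 0 <= B by apply: addr_ge0.
have smono k l : csmooth (fun x => z x ^+ k * (conjc (z x) ^+ l * psi x)).
  apply: csmoothM; first by apply: csmoothX; exact: csmooth_z.
  by apply: csmoothM => //; apply: csmoothX; apply: csmooth_conj; exact: csmooth_z.
have mono k l : bnd r D (fun x => z x ^+ k * (conjc (z x) ^+ l * psi x)) (B ^+ (k + l) * M).
  elim: k => [|k ih].
    under eq_fun do rewrite expr0 mul1r; rewrite add0n.
    elim: l => [|l ih]; first by under eq_fun do rewrite expr0 mul1r; rewrite expr0 mul1r.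
    under eq_fun do rewrite exprS -mulrA; rewrite exprS -mulrA.
    have sl : csmooth (fun x => conjc (z x) ^+ l * psi x).
      by apply: csmoothM => //; apply: csmoothX; apply: csmooth_conj; exact: csmooth_z.
    apply: bnd_le (hB2 _ _ sl ih).
    by rewrite ler_wpM2r ?mulr_ge0 ?exprn_ge0// /B lerDr.
  under eq_fun do rewrite exprS -mulrA; rewrite addSn exprS -mulrA.
  apply: bnd_le (hB1 _ _ (smono k l) ih).
  by rewrite ler_wpM2r ?mulr_ge0 ?exprn_ge0// /B lerDl.
(* The first summand bounds the main term, through [1 + 4 rho <= 4 (1 + rho)]; the 2 allows an error
   of 1 for the Taylor remainder and 1 for the cross terms. *)
exists (C * (Cp * 4 ^+ D) + 2).
  by rewrite addr_ge0// !mulr_ge0// exprn_ge0.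
move=> rho rho0.
pose Y := 4 * rho * r.
pose K1 := C * Cp * (1 + 4 * rho) ^+ D * 2 + 1.
have K10 : 0 < K1.
  by rewrite /K1 ltr_wpDl// !mulr_ge0// exprn_ge0// addr_ge0// mulr_ge0.
pose K2 := C * M + 1; have K20 : 0 < K2 by rewrite /K2 ltr_wpDl// mulr_ge0.
have [N1 hN1] := @texp_near R Y _ (etrans (invr_gt0 K1) K10).
pose Z := rho * B; have Z0 : 0 <= Z by apply: mulr_ge0.
have [N2 hN2] := @texp_near R (Z + Z) _ (etrans (invr_gt0 K2) K20).
(* Up to [D] derivatives lower the truncation index by at most [D], hence [N1 + D]. The index [N2]
   belongs to [Z + Z], at which the cross terms are compared with [exp (2 Z) - texp N (2 Z)]. *)
exists (maxn (N1 + D) N2) => N; rewrite geq_max => /andP[NN1 NN2] t trho.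
have ellY x : `|x| <= r -> `|ell t x| <= Y.
  move=> xr; have tR := le_trans (normc_Re t) trho; have tI := le_trans (normc_Im t) trho.
  have xa := le_trans (coord_norm_le x a) xr; have xb := le_trans (coord_norm_le x b) xr.
  have h (p q : R) : `|p| <= rho -> `|q| <= r -> `|2 * (p * q)| <= 2 * (rho * r).
    by move=> pr qr; rewrite !normrM normr_nat ler_wpM2l// ler_pM.
  rewrite (le_trans (ler_normD _ _))//.
  by rewrite (le_trans (lerD (h _ _ tR xb) (h _ _ tI xa)))// /Y; lra.
pose cross (x : X) : R[i] := texp N (t * z x) * texp N (- conjc t * conjc (z x)) -
  texp N (t * z x + - conjc t * conjc (z x)).
have scis : csmooth (fun x => cis (ell t x)) by apply: csmooth_cis.
have s1 : csmooth (fun x => psi x * cis (ell t x)) by apply: csmoothM.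
have s2 : csmooth (fun x => psi x * u t N x) by apply: csmoothM.
have scr : csmooth cross.
  have stz : csmooth (fun x => t * z x) by apply: csmoothZ; exact: csmooth_z.
  have stb : csmooth (fun x => - conjc t * conjc (z x)).
    by apply: csmoothZ; apply: csmooth_conj; exact: csmooth_z.
  rewrite (_ : cross = fun x => -1 * texp N (t * z x + - conjc t * conjc (z x)) +
     texp N (t * z x) * texp N (- conjc t * conjc (z x))); last first.
    by apply/funext => x; rewrite mulN1r addrC.
  apply: csmooth_lin; first by apply: csmooth_texp; apply: csmoothD.
  by apply: csmoothM; apply: csmooth_texp.
have s3 : csmooth (fun x => psi x * cross x) by apply: csmoothM.
have -> : (fun x => psi x * (texp N (t * z x) * texp N (- conjc t * conjc (z x)))) =
    fun x => -1 * (psi x * u t N x) + (psi x * cis (ell t x) + psi x * cross x).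
  by apply/funext => x; rewrite /cross /u ellE; ring.
rewrite (cdist_lin dF _ s2 (csmoothD s1 s3)) (cdistD dF s1 s3) mulN1r.
have b1 : normc (F (fun x => psi x * cis (ell t x))) <= C * (Cp * 4 ^+ D) * (1 + rho) ^+ D.
  have -> : (fun x => psi x * cis (ell t x)) = fun x => psi x * u t 0 x.
    by apply/funext => x; rewrite /u /texp big_ord0 subr0.
  have := bF _ _ (csmoothM spsi (csmooth_u t 0)) (hCp _ _ (csmooth_u t 0)
    (@bnd_u t rho r D 0 1 r0 rho0 trho _)).
  move=> /(_ _)/le_trans; apply.
    by move=> l x _ _; rewrite sub0n /u /texp big_ord0 subr0 normc_cis.
  rewrite mulr1 -!mulrA ler_wpM2l// ler_wpM2l// -exprMn lerXn2r ?nnegrE//.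
  - by rewrite addr_ge0// mulr_ge0.
  - by rewrite mulr_ge0// addr_ge0.
  - by rewrite mulrDr mulr1 lerD2r// ler1n.
have b2 : normc (F (fun x => psi x * u t N x)) <= 1.
  have := bF _ _ s2 (hCp _ _ (csmooth_u t N)
    (@bnd_u t rho r D N (2 * K1^-1) r0 rho0 trho _)).
  move=> /(_ _)/le_trans; apply.
    move=> l x lD xr; rewrite /u.
    apply: le_trans (cis_texp _ (ellY x xr)) _; rewrite ler_wpM2l//.
    apply: le_trans (ler_norm _) _; apply: hN1.
    by rewrite leq_subRL ?(leq_trans lD)// ?(leq_trans _ NN1)// ?leq_addl// addnC leq_add2l.
  have -> : C * (Cp * ((1 + 4 * rho) ^+ D * (2 * K1^-1))) =
      (C * Cp * (1 + 4 * rho) ^+ D * 2) / K1 by ring.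
  by rewrite ler_pdivrMr// mul1r /K1 lerDl.
have b3 : normc (F (fun x => psi x * cross x)) <= 1.
  pose c k l : R[i] := t ^+ k * (- conjc t) ^+ l * (k`!%:R * l`!%:R)^-1.
  have -> : (fun x => psi x * cross x) = fun x => \sum_(k < N) \sum_(l < N | (N <= k + l)%N)
      c k l * (z x ^+ k * (conjc (z x) ^+ l * psi x)).
    apply/funext => x; rewrite /cross texp_cross mulr_sumr; apply: eq_bigr => k _.
    by rewrite mulr_sumr; apply: eq_bigr => l _; rewrite /c !exprMn; ring.
  rewrite (cdist_sum dF); last first.
    by move=> k; apply: csmooth_sum => l _; apply: csmoothZ; exact: smono.
  have cn k l : normc (c k l) <= rho ^+ k * rho ^+ l * (k`!%:R * l`!%:R)^-1.
    rewrite /c !(Normc.normcM, Normc.normcV, normcX) normcN normc_conj.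
    rewrite -[k`!%:R in leLHS](rmorph_nat (real_complex R)).
    rewrite -[l`!%:R in leLHS](rmorph_nat (real_complex R)) !normc_real !ger0_norm//.
    rewrite ler_wpM2r ?invr_ge0 ?mulr_ge0//.
    by rewrite ler_pM ?exprn_ge0 ?normc_ge0// lerXn2r ?nnegrE ?normc_ge0.
  apply: (@le_trans _ _ (\sum_(k < N) \sum_(l < N | (N <= k + l)%N)
      C * M * (Z ^+ k * Z ^+ l * (k`!%:R * l`!%:R)^-1))).
    apply: le_trans (normc_sum _ _ _) _; apply: ler_sum => k _.
    rewrite (cdist_sum dF); last by move=> l; apply: csmoothZ; exact: smono.
    apply: le_trans (normc_sum _ _ _) _; apply: ler_sum => l _.
    rewrite (cdistZ dF _ (smono k l)) Normc.normcM.
    apply: le_trans (ler_pM (normc_ge0 _) (normc_ge0 _) (cn k l) (bF _ _ (smono k l) (mono k l))) _.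
    by rewrite /Z !exprMn exprD le_eqVlt; apply/orP; left; apply/eqP; ring.
  under eq_bigr do rewrite -mulr_sumr.
  rewrite -mulr_sumr -texp_cross.
  apply: (@le_trans _ _ (C * M * K2^-1)); last first.
    by rewrite ler_pdivrMr// mul1r /K2 lerDl.
  rewrite ler_wpM2l ?mulr_ge0// (le_trans _ (hN2 _ NN2))// (le_trans _ (ler_norm _))//.
  by rewrite lerB// expRD ler_pM ?texp_le_exp// sumr_ge0// => k _; rewrite divr_ge0 ?exprn_ge0.
have rD : 1 <= (1 + rho) ^+ D by rewrite exprn_ege1// lerDl.
rewrite (le_trans (normcD _ _))// normcN.
apply: le_trans (lerD b2 (le_trans (normcD _ _) (lerD b1 b3))) _.
rewrite mulrDl; lra.
Qed.

End Growth.

(** * Finite rank and recurrences *)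

Section TruncatedPolynomials.
Variable F : fieldType.
Implicit Types p q : {poly F}.

(** Congruence modulo [X^N], in place of equality of power series known through their
    truncations. *)
Definition eqX (N : nat) p q := forall i, (i < N)%N -> p`_i = q`_i.

Lemma eqX_sym N p q : eqX N p q -> eqX N q p.
Proof. by move=> h i iN; rewrite h. Qed.

Lemma eqX_trans N p q s : eqX N p q -> eqX N q s -> eqX N p s.
Proof. by move=> h1 h2 i iN; rewrite h1 ?h2. Qed.

Lemma eqXD N p p' q q' : eqX N p p' -> eqX N q q' -> eqX N (p + q) (p' + q').
Proof. by move=> h h' i iN; rewrite !coefD h ?h'. Qed.

Lemma eqXM N p p' q q' : eqX N p p' -> eqX N q q' -> eqX N (p * q) (p' * q').
Proof.
move=> h h' i iN; rewrite !coefM; apply: eq_bigr => j _.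
rewrite h ?h' //; first exact: leq_ltn_trans (leq_subr _ _) iN.
by apply: leq_ltn_trans iN; rewrite -ltnS.
Qed.

Lemma eqX_sum N (I : Type) (s : seq I) (P : pred I) (u v : I -> {poly F}) :
  (forall i, eqX N (u i) (v i)) ->
  eqX N (\sum_(i <- s | P i) u i) (\sum_(i <- s | P i) v i).
Proof. by move=> h; elim/big_rec2 : _ => // i x y _; apply: eqXD. Qed.

Lemma eqX_prod N (I : Type) (s : seq I) (P : pred I) (u v : I -> {poly F}) :
  (forall i, eqX N (u i) (v i)) ->
  eqX N (\prod_(i <- s | P i) u i) (\prod_(i <- s | P i) v i).
Proof. by move=> h; elim/big_rec2 : _ => // i x y _; apply: eqXM. Qed.

Lemma eqX_det N n (A B : 'M[{poly F}]_n) :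
  (forall i j, eqX N (A i j) (B i j)) -> eqX N (\det A) (\det B).
Proof.
by move=> h; apply: eqX_sum => s; apply: eqXM => //; apply: eqX_prod.
Qed.

(** The inverse is built one coefficient at a time: [c] repairs the coefficient of [X^N], where
    [N == 0] stands for that of the constant 1. *)
Lemma eqX_inv N p : p`_0 != 0 -> exists q, eqX N (q * p) 1.
Proof.
move=> p0; elim: N => [|N [q hq]]; first by exists 0.
pose c := (((N == 0%N)%:R - (q * p)`_N) / p`_0).
exists (q + c *: 'X^N) => i; rewrite ltnS leq_eqVlt mulrDl coefD => /orP[/eqP->|iN].
  by rewrite -scalerAl coefZ coefXnM ltnn subnn divfK// subrKC coef1.
by rewrite -scalerAl coefZ coefXnM iN mulr0 addr0 hq.
Qed.

Lemma kernel_vector (I : finType) (B : I -> 'I_(#|I|.+1) -> F) :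
  exists v : 'I_(#|I|.+1) -> F, (exists l, v l != 0) /\
    forall x, \sum_l B x l * v l = 0.
Proof.
pose A := \matrix_(l < #|I|.+1, k < #|I|) B (enum_val k) l.
have : kermx A != 0.
  rewrite kermx_eq0; apply/negP; rewrite -row_leq_rank => h.
  by have := leq_trans h (rank_leq_col A); rewrite ltnn.
case/rowV0Pn => v /sub_kermxP vA v0; exists (v 0); split.
  by case/rV0Pn : v0 => l hl; exists l.
move=> x; move/rowP : vA => /(_ (enum_rank x)); rewrite !mxE => h; rewrite -[RHS]h.
by apply: eq_bigr => l _; rewrite mxE enum_rankK mulrC.
Qed.

(** Cramer's rule without division, from [u * adj A * A = det A * u]: the entry [k] of [u * adj A]
    is the determinant of [A] with row [k] replaced by [u]. *)
Lemma cramer_row (S : comNzRingType) m (A : 'M[S]_m) (u : 'rV[S]_m) j :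
  \det A * u 0 j =
  \sum_k \det (\matrix_(r, s) if r == k then u 0 s else A r s) * A k j.
Proof.
have := mulmxA u (\adj A) A; rewrite mul_adj_mx mul_mx_scalar => /rowP/(_ j).
rewrite !mxE => ->; apply: eq_bigr => k _; congr (_ * _); rewrite !mxE.
rewrite (expand_det_row _ k); apply: eq_bigr => s _; rewrite !mxE eqxx; congr (_ * _).
rewrite /cofactor; congr (_ * \det _); apply/matrixP => a b; rewrite !mxE.
by rewrite eq_sym (negbTE (neq_lift _ _)).
Qed.

End TruncatedPolynomials.

(** * Cauchy's inequality for polynomials *)

Section Cauchy.
Variable R : realType.

Lemma prim_root_exists (n : nat) : (0 < n)%N -> exists z : R[i], n.-primitive_root z.
Proof.
pose p : {poly R[i]} := 'X^n - 1; have [r Dp] := closed_field_poly_normal p.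
move=> n_gt0; rewrite (monicP _) ?monicXnsubC // scale1r in Dp.
have rn1 : all n.-unity_root r by apply/allP=> z; rewrite -root_prod_XsubC -Dp.
have sz_r : (n < (size r).+1)%N.
  by rewrite -(size_prod_XsubC r id) -Dp size_XnsubC.
have [|z] := hasP (has_prim_root n_gt0 rn1 _ sz_r); last by exists z.
by rewrite -separable_prod_XsubC -Dp separable_Xn_sub_1 // pnatr_eq0 -lt0n.
Qed.

(** The contour integral is replaced by the mean over the [N]-th roots of unity; it extracts the
    coefficient exactly because [N] exceeds both [k] and the degree of [f]. *)
Lemma poly_cauchy (f : {poly R[i]}) (rho C : R) k : 0 <= rho ->
  (forall t, normc t = rho -> normc f.[t] <= C) -> normc f`_k * rho ^+ k <= C.
Proof.
move=> rho0 hf; pose N := (size f + k).+1.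
have [w pw] := prim_root_exists (ltn0Sn (size f + k)).
have w1 : normc w = 1.
  apply/eqP; rewrite -(@pexpr_eq1 _ _ N)// ?normc_ge0//.
  by rewrite -normcX (prim_expr_order pw) [normc _]Normc.normc1.
have w0 : w != 0 by rewrite -normc_eq0 w1 oner_eq0.
have wX j : normc (w ^+ j) = 1 by rewrite normcX w1 expr1n.
have N0 : 0 < N%:R :> R by rewrite ltr0n.
have E : \sum_(j < N) (w ^+ (j * k))^-1 * f.[w ^+ j * rho%:C] = N%:R * (f`_k * rho%:C ^+ k).
  have orth l : (l < N)%N -> \sum_(j < N) (w ^+ (j * k))^-1 * (w ^+ j) ^+ l = (l == k)%:R * N%:R.
    move=> lN; pose x := w ^+ l / w ^+ k.
    have -> : \sum_(j < N) (w ^+ (j * k))^-1 * (w ^+ j) ^+ l = \sum_(j < N) x ^+ j.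
      apply: eq_bigr => j _; rewrite /x exprMn exprVn -!exprM mulrC.
      by rewrite [(j * l)%N]mulnC [(j * k)%N]mulnC.
    have xE : (x == 1) = (l == k).
      rewrite /x -(inj_eq (mulIf (expf_neq0 k w0))) mulfVK ?expf_neq0// mul1r.
      rewrite (eq_prim_root_expr pw) !modn_small//.
      by rewrite /N ltnS leq_addl.
    case: (eqVneq l k) xE => [_ /eqP ->|_ /negbT x1].
      by under eq_bigr do rewrite expr1n; rewrite sumr_const card_ord mul1r.
    have : (x - 1) * \sum_(j < N) x ^+ j = 0.
      rewrite -subrX1 /x exprMn exprVn -!exprM mulnC exprM (prim_expr_order pw).
      by rewrite mulnC exprM (prim_expr_order pw) !expr1n divr1 subrr.
    by move/eqP; rewrite mulf_eq0 subr_eq0 (negbTE x1) /= mul0r => /eqP.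
  under eq_bigr => j _.
    rewrite (@horner_coef_wide _ N); last by rewrite /N ltnW// ltnS leq_addr.
    rewrite mulr_sumr (eq_bigr (fun l : 'I_N => (f`_l * rho%:C ^+ l) *
      ((w ^+ (j * k))^-1 * (w ^+ j) ^+ l))) => [|l _]; last by rewrite exprMn; ring.
    over.
  rewrite exchange_big /=.
  under eq_bigr => l _ do rewrite -mulr_sumr orth//.
  have kN : (k < N)%N by rewrite /N ltnS leq_addl.
  rewrite (bigD1 (Ordinal kN))//= eqxx mul1r big1 ?addr0 1?mulrC// => l lk.
  by rewrite (_ : (l == k :> nat) = false) ?mul0r ?mulr0//; apply/negbTE.
rewrite -(ler_pM2l N0).
have -> : N%:R * (normc f`_k * rho ^+ k) = normc (N%:R * (f`_k * rho%:C ^+ k)).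
  rewrite !Normc.normcM normcX normc_real (ger0_norm rho0); congr (_ * _).
  by rewrite -[N%:R in RHS](rmorph_nat (real_complex R)) normc_real ger0_norm.
rewrite -E (le_trans (normc_sum _ _ _))//.
have -> : N%:R * C = \sum_(j < N) C by rewrite sumr_const card_ord mulr_natl.
apply: ler_sum => j _.
rewrite Normc.normcM Normc.normcV wX invr1 mul1r; apply: hf.
by rewrite Normc.normcM wX mul1r normc_real ger0_norm.
Qed.

Lemma normc_det_le m (A : 'M[R[i]]_m) (c : 'M[R]_m) (X : R) :
  (forall i j, normc (A i j) <= c i j * X) ->
  normc (\det A) <= (\sum_(s : {perm 'I_m}) \prod_i c i (s i)) * X ^+ m.
Proof.
move=> h; rewrite /determinant (le_trans (normc_sum _ _ _))// mulr_suml.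
apply: ler_sum => s _; rewrite Normc.normcM normcX normcN [normc 1]Normc.normc1.
rewrite expr1n mul1r.
have -> : normc (\prod_i A i (s i)) = \prod_i normc (A i (s i)).
  by elim/big_rec2 : _ => [|i y x _ <-]; [rewrite [normc _]Normc.normc1 | rewrite Normc.normcM].
rewrite -[m in X ^+ m]card_ord -prodr_const -big_split /=.
by apply: ler_prod => i _; rewrite normc_ge0 h.
Qed.

End Cauchy.

(** * From polynomial growth to a linear recurrence *)

Section FiniteRank.
Variables (R : realType) (I : Type) (S : I -> I) (A : I -> I -> R[i]).
Variables (m : nat) (al be : 'I_m -> I).

Let M := \matrix_(i, j) A (al i) (be j).
Hypothesis uM : M \in unitmx.
Hypothesis rankA : forall a b,
  A a b = \sum_j \sum_i A a (be j) * invmx M j i * A (al i) b.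

(** For the moment matrix and the shift of the exponent of [z_i], this is [F] applied to [Z^a Zbar^b
    texp N (t z_i) texp N (- conj (t z_i))]. *)
Definition trunc_sum (N : nat) (a b : I) (t : R[i]) : R[i] :=
  \sum_(k < N) \sum_(l < N) t ^+ k * (- conjc t) ^+ l * (k`!%:R * l`!%:R)^-1 *
     A (iter k S a) (iter l S b).

Variable D : nat.
Hypothesis growth : forall a b, exists2 C : R, 0 <= C & forall rho, 0 <= rho ->
  exists N0, forall N, (N0 <= N)%N -> forall t, normc t <= rho ->
    normc (trunc_sum N a b t) <= C * (1 + rho) ^+ D.

(** Truncated generating functions of the two factors of the rank factorization. The coefficients of
    [V] are conjugated so that [V] too is a polynomial in [t]; conjugating its value restores the
    dependence on [- conj t]. *)
Let U (N : nat) (a : I) (j : 'I_m) : {poly R[i]} :=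
  \poly_(k < N) (A (iter k S a) (be j) / k`!%:R).
Let V (N : nat) (j : 'I_m) (b : I) : {poly R[i]} :=
  \poly_(l < N) conjc ((-1) ^+ l / l`!%:R * \sum_i invmx M j i * A (al i) (iter l S b)).
Let UU N (a : 'I_m -> I) := \matrix_(r, j) U N (a r) j.
Let VV N := \matrix_(j, s) V N j (be s).
Let f N a := \det (UU N a) * \det (VV N).

Let conjX (z : R[i]) k : conjc (z ^+ k) = conjc z ^+ k.
Proof. exact: rmorphXn. Qed.

Let UV_sum N a b t :
  \sum_j (U N a j).[t] * conjc (V N j b).[t] = trunc_sum N a b t.
Proof.
rewrite /trunc_sum /U /V; under eq_bigr => j _.
  rewrite !horner_poly rmorph_sum mulr_suml /=.
  under eq_bigr => k _ do rewrite mulr_sumr.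
  over.
rewrite exchange_big /=; apply: eq_bigr => k _.
rewrite exchange_big /=; apply: eq_bigr => l _.
rewrite [in RHS]rankA mulr_sumr; apply: eq_bigr => j _.
rewrite rmorphM /= conjcK conjX invfM !(mulr_sumr, mulr_suml); apply: eq_bigr => i _.
rewrite (exprNn (conjc t)); ring.
Qed.

(** Conjugating the second determinant preserves the modulus and turns the product into the
    determinant of the matrix of truncated sums, each entry of which is bounded by [growth]. *)
Let det_growth a : exists2 C : R, 0 <= C & forall rho, 0 <= rho ->
  exists N0, forall N, (N0 <= N)%N -> forall t, normc t <= rho ->
    normc (f N a).[t] <= C * (1 + rho) ^+ (m * D).
Proof.
have /choice[c hc] (rs : 'I_m * 'I_m) : exists C : R, 0 <= C /\ forall rho, 0 <= rho ->
    exists N0, forall N, (N0 <= N)%N -> forall t, normc t <= rho ->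
    normc (trunc_sum N (a rs.1) (be rs.2) t) <= C * (1 + rho) ^+ D.
  by have [C C0 hC] := growth (a rs.1) (be rs.2); exists C.
exists (\sum_(s : {perm 'I_m}) \prod_i c (i, s i)).
  by apply: sumr_ge0 => s _; apply: prodr_ge0 => i _; case: (hc (i, s i)).
move=> rho rho0.
have /choice[N0 hN0] rs := proj2 (hc rs) rho rho0.
exists (\max_rs N0 rs)%N => N NN t tr.
have -> : normc (f N a).[t] = normc (\det (\matrix_(r, s) trunc_sum N (a r) (be s) t)).
  rewrite /f hornerM Normc.normcM -[normc (\det (VV N)).[t]]normc_conj -Normc.normcM.
  have detE (B : 'M[{poly R[i]}]_m) : (\det B).[t] = \det (map_mx (horner_eval t) B).
    by rewrite det_map_mx.
  rewrite !detE -(det_map_mx (conjc : {rmorphism R[i] -> R[i]})) -det_mulmx.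
  congr (normc (\det _)); apply/matrixP => r s; rewrite !mxE -UV_sum.
  by apply: eq_bigr => j _; rewrite !mxE.
rewrite mulnC exprM.
have := @normc_det_le R m (\matrix_(r, s) trunc_sum N (a r) (be s) t)
  (\matrix_(r, s) c (r, s)) ((1 + rho) ^+ D).
under eq_bigr => s _ do under eq_bigr => i _ do rewrite mxE.
apply=> r s; rewrite !mxE; apply: (hN0 (r, s)) => //.
by apply: leq_trans NN; apply: (leq_bigmax (r, s)).
Qed.

Let U_eqX N N' a j : (N <= N')%N -> eqX N (U N a j) (U N' a j).
Proof. by move=> NN i iN; rewrite !coef_poly iN (leq_trans iN NN). Qed.

Let f_eqX N N' a : (N <= N')%N -> eqX N (f N a) (f N' a).
Proof.
move=> NN; apply: eqXM; apply: eqX_det => i j; rewrite !mxE; first exact: U_eqX.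
by move=> k kN; rewrite !coef_poly kN (leq_trans kN NN).
Qed.

(** Liouville's argument. The truncation [N'] needed for the growth bound depends on [rho], but
    passing from [N] to [N'] does not change the coefficient of index [k < N]. *)
Let f_coef0 N a k : (m * D < k < N)%N -> (f N a)`_k = 0.
Proof.
move=> /andP[Dk kN]; have [C C0 hC] := det_growth a.
apply: Normc.eq0_normc; apply/eqP; apply: contraT => c0.
have {}c0 : 0 < normc (f N a)`_k by rewrite lt_def c0 normc_ge0.
(* If [c] denotes the modulus of this coefficient, then [c * rho > C * 2^(m D)], so
   [c * rho^(m D + 1)] exceeds [C (2 rho)^(m D) >= C (1 + rho)^(m D)]. *)
pose rho := 1 + C * 2 ^+ (m * D) / normc (f N a)`_k.
have rho1 : 1 <= rho.
  by rewrite lerDl divr_ge0 ?mulr_ge0 ?exprn_ge0// ltW.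
have rho0 : 0 < rho := lt_le_trans ltr01 rho1.
have [N0 hN0] := hC rho (ltW rho0).
pose N' := maxn N0 N.
have := @poly_cauchy R (f N' a) rho (C * (1 + rho) ^+ (m * D)) k (ltW rho0)
   (fun t ht => hN0 N' (leq_maxl _ _) t (eq_ind_r (fun x => x <= rho) (lexx rho) ht)).
rewrite -(f_eqX a (leq_maxr N0 N) kN) leNgt => /negP; case.
apply: (@le_lt_trans _ _ (C * 2 ^+ (m * D) * rho ^+ (m * D))).
  have [h1 h2 h3] : [/\ 0 <= 1 + rho, 0 <= 2 * rho & 1 + rho <= 2 * rho].
    by split; lra.
  by rewrite -mulrA ler_wpM2l// -exprMn lerXn2r.
apply: (@lt_le_trans _ _ (normc (f N a)`_k * rho ^+ (m * D).+1)); last first.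
  by rewrite ler_wpM2l ?normc_ge0// ler_weXn2l.
rewrite exprS mulrA ltr_pM2r ?exprn_gt0// -ltr_pdivrMl//.
by rewrite [_^-1 * _]mulrC ltrDr.
Qed.

(** The limit of the [f N a]: the coefficient of index [k] is read at [k + 1], the first truncation
    that determines it. *)
Let P a := \poly_(k < (m * D).+1) (f k.+1 a)`_k.

Let P_eqX N a : eqX N (f N a) (P a).
Proof.
move=> k kN; rewrite coef_poly; case: ltnP => [kD|Dk]; last first.
  by rewrite f_coef0// Dk.
by rewrite -(f_eqX a kN (ltnSn k)).
Qed.

(** At [t = 0] the two matrices are [M] and [invmx M *m M], so the value is the determinant of
    [M]. *)
Let P0 : (P al)`_0 != 0.
Proof.
rewrite coef_poly /= -horner_coef0 /f hornerM.
have detE (B : 'M[{poly R[i]}]_m) : (\det B).[0] = \det (map_mx (horner_eval 0) B).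
  by rewrite det_map_mx.
rewrite !detE.
have -> : map_mx (horner_eval 0) (UU 1 al) = M.
  apply/matrixP => i j; rewrite !mxE /horner_eval horner_coef0 coef_poly /=.
  by rewrite divr1.
have -> : map_mx (horner_eval 0) (VV 1) = 1%:M.
  apply/matrixP => i j; rewrite !mxE /horner_eval horner_coef0 coef_poly /=.
  rewrite expr0 divr1 mul1r.
  have := mulVmx uM => /matrixP/(_ i j); rewrite !mxE => E.
  rewrite (_ : \sum_i0 _ = (i == j)%:R) ?rmorph_nat // -E.
  by apply: eq_bigr => l _; rewrite !mxE.
by rewrite det1 mulr1 -unitfE -[_ \is a GRing.unit]/(M \in unitmx).
Qed.

Definition upd (a : 'I_m -> I) k x := fun r => if r == k then x else a r.

(** Cramer's rule for [UU], multiplied by the determinant of [VV]: each determinant becomes some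
    [f N], hence modulo [X^N] a polynomial of degree at most [m D]. *)
Let cramerP N a j : eqX N (P al * U N a j) (\sum_k P (upd al k a) * U N (al k) j).
Proof.
have E : f N al * U N a j = \sum_k f N (upd al k a) * U N (al k) j.
  have := cramer_row (UU N al) (\row_j U N a j) j; rewrite mxE => E.
  rewrite /f mulrAC [\det _ * U _ _ _]E mulr_suml; apply: eq_bigr => k _; rewrite mulrAC mxE.
  congr (\det _ * _ * _); apply/matrixP => r s; rewrite !mxE /upd.
  by case: (r == k).
apply: (@eqX_trans _ N _ (f N al * U N a j)).
  by apply: eqXM => //; apply/eqX_sym/P_eqX.
by rewrite E; apply: eqX_sum => k; apply: eqXM => //; apply: P_eqX.
Qed.

(** As [P al] has an inverse [Q] modulo [X^N], every [U N a j] is, modulo [X^N], a combination of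
    the polynomials [X^e Q U N (al k) j] with [e <= m D], which do not involve [a]. A relation
    between the coefficients of these holds for all [a]. *)
Lemma shift_recurrence j : exists2 p : {poly R[i]}, p != 0 &
  forall a, \sum_(l < size p) p`_l * A (iter l S a) (be j) = 0.
Proof.
(* One coefficient more than there are generators, so the homogeneous system has a nonzero
   solution. *)
pose J := ('I_m * 'I_(m * D).+1)%type; pose N := #|{: J}|.+1.
have [Q hQ] := eqX_inv N P0.
pose B (x : J) (l : 'I_N) := ('X^(x.2) * (Q * U N (al x.1) j))`_l.
have [v [[l0 hl0] hv]] := kernel_vector B.
(* Dividing by [l!] passes from the coefficients of [U] to the entries of [A]. *)
pose p := \poly_(l < N) (if insub l is Some l' then v l' / (l : nat)`!%:R else 0).
have pE (l : 'I_N) : p`_l = v l / l`!%:R by rewrite coef_poly ltn_ord valK.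
exists p.
  apply/eqP => p0; have := pE l0; rewrite p0 coef0 => /esym/eqP.
  by rewrite mulf_eq0 (negbTE hl0) invr_eq0 pnatr_eq0 eqn0Ngt fact_gt0.
move=> a.
have UE : eqX N (U N a j) (\sum_k P (upd al k a) * (Q * U N (al k) j)).
  apply: (@eqX_trans _ N _ (Q * P al * U N a j)).
    by rewrite -{1}[U N a j]mul1r; apply: eqXM => //; apply: eqX_sym.
  rewrite -mulrA; apply: (@eqX_trans _ N _ (Q * \sum_k P (upd al k a) * U N (al k) j)).
    by apply: eqXM => //; apply: cramerP.
  by rewrite mulr_sumr; under eq_bigr do rewrite mulrCA.
have szp : (size p <= N)%N by apply: size_poly.
have -> : \sum_(l < size p) p`_l * A (iter l S a) (be j) =
    \sum_(l < N) p`_l * A (iter l S a) (be j).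
  rewrite (big_ord_widen N (fun l => p`_l * A (iter l S a) (be j)) szp).
  rewrite [RHS](bigID (fun l : 'I_N => (l < size p)%N)) /= [X in _ + X]big1 ?addr0//.
  by move=> l; rewrite -leqNgt => h; rewrite nth_default// mul0r.
have -> : \sum_(l < N) p`_l * A (iter l S a) (be j) = \sum_(l < N) v l * (U N a j)`_l.
  by apply: eq_bigr => l _; rewrite pE coef_poly ltn_ord; ring.
under eq_bigr => l _.
  rewrite (UE l (ltn_ord l)) coef_sum mulr_sumr.
  under eq_bigr => k _.
    rewrite /P poly_def mulr_suml coef_sum mulr_sumr.
    under eq_bigr => e _ do rewrite -scalerAl coefZ mulrCA.
    over.
  over.
rewrite exchange_big big1 //= => k _; rewrite exchange_big big1 //= => e _.
rewrite -mulr_sumr; under eq_bigr do rewrite mulrC.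
by have := hv (k, e); rewrite /B /= => ->; rewrite mulr0.
Qed.

End FiniteRank.

(** * Factorization of an infinite matrix of finite rank *)

Section RankFactorization.
Variable R : realType.

(** The determinant of the bordered matrix is [det M] times the Schur complement [x - r M^-1 c], and
    it vanishes for rank reasons. *)
Lemma schur_zero (K : fieldType) m (M : 'M[K]_m) (c : 'M[K]_(m, 1)) (r : 'M[K]_(1, m))
    (x : 'M[K]_1) : M \in unitmx -> (\rank (block_mx M c r x) <= m)%N ->
  x = r *m invmx M *m c.
Proof.
move=> uM rk; have d0 : \det (block_mx M c r x) = 0.
  apply/eqP; apply: contraTT rk; rewrite -unitfE -ltnNge => u.
  have : block_mx M c r x \in unitmx by rewrite unitmxE.
  by move/mxrank_unit => ->; rewrite addn1.
have : \det (block_mx M c r x *m block_mx 1%:M (- (invmx M *m c)) 0 1%:M) = 0.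
  by rewrite det_mulmx d0 mul0r.
rewrite mulmx_block !mulmx1 !mulmx0 !addr0 !mulmxN !mulmxA mulmxV// mul1mx addNr.
rewrite det_lblock => /eqP; rewrite mulf_eq0.
have /negbTE -> : \det M != 0 by rewrite -unitfE -unitmxE.
rewrite /= det_mx11 mxE => /eqP h; apply/matrixP => i j; rewrite !ord1.
move: h; rewrite !mxE => /eqP; rewrite addrC subr_eq0 => /eqP ->.
by [].
Qed.

(** A minor that attains the rank is bordered by an arbitrary row [a] and column [b]; the bordered
    matrix still has rank at most [m]. *)
Lemma rank_factor (I : Type) (A : I -> I -> R[i]) m : inf_rank A m ->
  exists al be : 'I_m -> I, let M := \matrix_(i, j) A (al i) (be j) in
    M \in unitmx /\
    forall a b, A a b = \sum_j \sum_i A a (be j) * invmx M j i * A (al i) b.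
Proof.
move=> [hle [k [rows [cols hm]]]]; set N := (X in \rank X) in hm.
subst m; pose f := maxrankfun N.
have fB : row_full (rowsub f N)^T.
  by rewrite -col_leq_rank mxrank_tr; have := maxrowsub_free N; rewrite -row_leq_rank.
pose g := fullrankfun fB.
pose al (i : 'I_(\rank N)) := rows (f i); pose be (j : 'I_(\rank N)) := cols (g j).
have uM : \matrix_(i, j) A (al i) (be j) \in unitmx.
  rewrite -unitmx_tr; have := fullrowsub_unit fB.
  by congr (_ \in unitmx); apply/matrixP => i j; rewrite !mxE.
exists al, be; split=> // a b.
set M := \matrix_(i, j) _ in uM *.
pose rw (i : 'I_(\rank N + 1)) := if fintype.split i is inl i' then al i' else a.
pose cl (i : 'I_(\rank N + 1)) := if fintype.split i is inl i' then be i' else b.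
have := hle _ rw cl.
have -> : \matrix_(i, j) A (rw i) (cl j) =
   block_mx M (\col_i A (al i) b) (\row_j A a (be j)) (const_mx (A a b)).
  apply/matrixP => i j; rewrite !mxE /rw /cl.
  by case: (fintype.split i) => i'; rewrite !mxE; case: (fintype.split j) => j'; rewrite !mxE.
move/(schur_zero uM)/matrixP/(_ 0 0); rewrite !mxE => ->.
under eq_bigr do rewrite !mxE mulr_suml.
rewrite exchange_big; apply: eq_bigr => j _; apply: eq_bigr => i _.
by rewrite !mxE.
Qed.

End RankFactorization.

(** * Distributions supported at a point *)

Section Spans.
Variables (R : realType) (n : nat).
Local Notation X := 'rV[R]_n.
Implicit Types (phi psi : X -> R[i]) (F G : (X -> R[i]) -> R[i]).

Inductive cspan (I : Type) (M : I -> X -> R[i]) : (X -> R[i]) -> Prop :=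
| Cspan0 : cspan M (fun=> 0)
| CspanS a i phi : cspan M phi -> cspan M (fun x => a * M i x + phi x).

Section Closure.
Variables (I : Type) (M : I -> X -> R[i]).
Hypothesis sM : forall i, csmooth (M i).

Lemma cspan_smooth phi : cspan M phi -> csmooth phi.
Proof.
elim=> [|a i psi _ sp]; first exact: csmooth_cst.
exact: (csmooth_lin a (sM i) sp).
Qed.

Lemma cspan0_cdist F phi : cdist F -> (forall i, F (M i) = 0) -> cspan M phi -> F phi = 0.
Proof.
move=> dF F0; elim=> [|a i psi cs ih]; first exact: (cdist0 dF).
by rewrite (cdist_lin dF _ (sM i) (cspan_smooth cs)) F0 ih mulr0 addr0.
Qed.

Lemma cspanD phi psi : cspan M phi -> cspan M psi -> cspan M (fun x => phi x + psi x).
Proof.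
elim=> [|a i phi' _ ih] cs; first by under eq_fun do rewrite add0r.
by under eq_fun do rewrite -addrA; apply: CspanS; apply: ih.
Qed.

Lemma cspanZ a phi : cspan M phi -> cspan M (fun x => a * phi x).
Proof.
elim=> [|b i phi' _ ih]; first by under eq_fun do rewrite mulr0; apply: Cspan0.
by under eq_fun do rewrite mulrDr mulrA; apply: CspanS.
Qed.

Lemma cspan_sum (J : Type) (s : seq J) (u : J -> X -> R[i]) :
  (forall j, cspan M (u j)) -> cspan M (fun x => \sum_(j <- s) u j x).
Proof.
move=> h; elim: s => [|j s ih].
  by under eq_fun do rewrite big_nil; apply: Cspan0.
by under eq_fun do rewrite big_cons; exact: (cspanD (h j) ih).
Qed.

Lemma cspan_gen i : cspan M (M i).
Proof.
rewrite (_ : M i = fun x => 1 * M i x + 0); first exact/CspanS/Cspan0.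
by apply/funext => x; rewrite mul1r addr0.
Qed.

Variable i1 : I.
Hypothesis M1 : M i1 = fun=> 1.
Variable op : I -> I -> I.
Hypothesis MM : forall i j x, M i x * M j x = M (op i j) x.

Lemma cspan_cst a : cspan M (fun=> a).
Proof.
rewrite (_ : (fun=> a) = fun x => a * M i1 x); first exact/cspanZ/cspan_gen.
by apply/funext => x; rewrite M1 mulr1.
Qed.

Lemma cspanM phi psi : cspan M phi -> cspan M psi -> cspan M (fun x => phi x * psi x).
Proof.
move=> cp cs; elim: cp => [|a i phi' _ ih].
  by under eq_fun do rewrite mul0r; apply: Cspan0.
under eq_fun do rewrite mulrDl -mulrA; apply: cspanD => //; apply: cspanZ.
elim: cs {ih} => [|b j q' _ ih]; first by under eq_fun do rewrite mulr0; apply: Cspan0.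
by under eq_fun do rewrite mulrDr mulrCA MM; apply: CspanS.
Qed.

Lemma cspanX phi k : cspan M phi -> cspan M (fun x => phi x ^+ k).
Proof.
move=> cp; elim: k => [|k ih].
  by under eq_fun do rewrite expr0; apply: cspan_cst.
by under eq_fun do rewrite exprS; exact: (cspanM cp ih).
Qed.

Lemma cspan_prod (J : Type) (s : seq J) (u : J -> X -> R[i]) :
  (forall j, cspan M (u j)) -> cspan M (fun x => \prod_(j <- s) u j x).
Proof.
move=> h; elim: s => [|j s ih].
  by under eq_fun do rewrite big_nil; apply: cspan_cst.
by under eq_fun do rewrite big_cons; exact: (cspanM (h j) ih).
Qed.

Lemma cspan_horner (p : {poly R[i]}) phi : cspan M phi -> cspan M (fun x => p.[phi x]).
Proof.
move=> cp; under eq_fun do rewrite horner_coef.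
by apply: cspan_sum => k; apply: cspanZ; apply: cspanX.
Qed.

(** Density for any multiplicative family whose span contains the constants and the real
    coordinates; it serves both the monomials centred at a point and the [Z^a Zbar^b]. *)
Lemma cdist_dense F : (forall l, cspan M (fun x => (x 0 l)%:C)) -> cdist F ->
  (forall i, F (M i) = 0) -> forall phi, csmooth phi -> F phi = 0.
Proof.
move=> hc dF F0; apply: cdist_tmon0 => // m; apply: cspan0_cdist => //.
under eq_fun do rewrite /tmon rmorph_prod.
apply: cspan_prod => l; under eq_fun do rewrite rmorphXn /= mxE subr0.
exact: cspanX.
Qed.

End Closure.

End Spans.

(** * The annihilator ideal of a distribution *)

Section Annihilators.
Variables (R : realType) (n : nat).
Local Notation X := 'rV[R]_n.
Implicit Types (phi psi u v : X -> R[i]) (F G : (X -> R[i]) -> R[i]).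

Definition kills F psi := csmooth psi /\ forall phi, csmooth phi -> F (fun x => psi x * phi x) = 0.

Lemma killsM F psi chi : kills F psi -> csmooth chi -> kills F (fun x => chi x * psi x).
Proof.
move=> [sp kp] sc; split=> [|phi sphi]; first exact: csmoothM.
by under eq_fun do rewrite -mulrA mulrCA; apply: kp; apply: csmoothM.
Qed.

Lemma killsD F u v : cdist F -> kills F u -> kills F v -> kills F (fun x => u x + v x).
Proof.
move=> dF [su ku] [sv kv]; split=> [|phi sphi]; first exact: csmoothD.
under eq_fun do rewrite mulrDl.
by rewrite (cdistD dF (csmoothM su sphi) (csmoothM sv sphi)) ku// kv// addr0.
Qed.

Lemma kills_sum F (J : Type) (s : seq J) (u : J -> X -> R[i]) : cdist F ->
  (forall j, kills F (u j)) -> kills F (fun x => \sum_(j <- s) u j x).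
Proof.
move=> dF h; elim: s => [|j s ih].
  under eq_fun do rewrite big_nil; split=> [|phi _]; first exact: csmooth_cst.
  by under eq_fun do rewrite mul0r; apply: (cdist0 dF).
by under eq_fun do rewrite big_cons; exact: (killsD dF (h j) ih).
Qed.

(** Each term of the binomial expansion of [(u + v)^(2k)] contains [u^k] or [v^k]. *)
Lemma kills_addX F u v k : cdist F ->
  kills F (fun x => u x ^+ k) -> kills F (fun x => v x ^+ k) ->
  csmooth u -> csmooth v -> kills F (fun x => (u x + v x) ^+ (k + k)).
Proof.
move=> dF ku kv su sv; under eq_fun do rewrite exprDn.
apply: kills_sum => // j; have [kj|jk] := leqP k j.
  have -> : (fun x => u x ^+ (k + k - j) * v x ^+ j *+ 'C(k + k, j)) =
     fun x => (u x ^+ (k + k - j) * v x ^+ (j - k) *+ 'C(k + k, j)) * v x ^+ k.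
    by apply/funext => x; rewrite mulrnAl -mulrA -exprD subnK.
  apply: killsM => //; under eq_fun do rewrite -mulr_natl.
  by apply: csmoothZ; apply: csmoothM; apply: csmoothX.
have -> : (fun x => u x ^+ (k + k - j) * v x ^+ j *+ 'C(k + k, j)) =
   fun x => (u x ^+ (k - j) * v x ^+ j *+ 'C(k + k, j)) * u x ^+ k.
  apply/funext => x; rewrite mulrnAl mulrAC -exprD; congr (_ ^+ _ * _ *+ _).
  by rewrite addnC addnBA // ltnW.
apply: killsM => //; under eq_fun do rewrite -mulr_natl.
by apply: csmoothZ; apply: csmoothM; apply: csmoothX.
Qed.

Lemma kills_nonvanish F u v : cdist F -> kills F u -> kills F v ->
  (forall x, u x = 0 -> v x != 0) -> forall phi, csmooth phi -> F phi = 0.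
Proof.
move=> dF [su ku] [sv kv] uv phi sphi.
have [[ru iu] [rv iv]] := (su, sv).
pose f x := (complex.Re (u x) * complex.Re (u x) + complex.Im (u x) * complex.Im (u x)) +
   (complex.Re (v x) * complex.Re (v x) + complex.Im (v x) * complex.Im (v x)).
have sf : smooth f by apply: smoothD; apply: smoothD; apply: smoothM.
have f0 x : f x != 0.
  have sq (y : R) : 0 <= y * y by rewrite -expr2 sqr_ge0.
  apply/eqP => /eqP; rewrite paddr_eq0 ?addr_ge0// !paddr_eq0// !mulf_eq0 !orbb.
  move=> /andP[/andP[/eqP r1 /eqP i1] /andP[/eqP r2 /eqP i2]].
  have /uv : u x = 0 by apply: complexP.
  by rewrite (_ : v x = 0) ?eqxx//; apply: complexP.
have sV := csmooth_real (smooth_inv sf f0).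
have E : phi = fun x => u x * (conjc (u x) * ((f x)^-1%:C * phi x)) +
    v x * (conjc (v x) * ((f x)^-1%:C * phi x)).
  apply/funext => x.
  have cc (z : R[i]) : z * conjc z =
      (complex.Re z * complex.Re z + complex.Im z * complex.Im z)%:C.
    by case: z => a b; apply: complexP; rewrite !(ReM, ImM) /=; ring.
  rewrite !mulrA !cc -!mulrA -mulrDl -rmorphD mulrA -rmorphM divff ?mul1r//.
  exact: f0.
have sw z : csmooth z -> csmooth (fun x => conjc (z x) * ((f x)^-1%:C * phi x)).
  by move=> sz; apply: csmoothM; [apply: csmooth_conj | apply: csmoothM].
rewrite E (cdistD dF (csmoothM su (sw _ su)) (csmoothM sv (sw _ sv))).
by rewrite ku ?kv ?addr0//; apply: sw.
Qed.

End Annihilators.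

Section PointSupport.
Variables (R : realType) (n : nat).
Local Notation X := 'rV[R]_n.
Implicit Types (phi psi u v : X -> R[i]) (F G : (X -> R[i]) -> R[i]) (c : X).
Implicit Types (m : 'I_n -> nat).

Lemma cdist_zero : cdist ((fun=> 0) : (X -> R[i]) -> R[i]).
Proof.
split=> [a phi psi _ _|]; first by rewrite mulr0 addr0.
by exists 0, 0, 0%N; split=> // phi M _ _; rewrite mul0r normc0.
Qed.

Lemma cdist_axpy a F G : cdist F -> cdist G -> cdist (fun phi => a * F phi + G phi).
Proof.
move=> [lF [rF [CF [NF [rF0 CF0 bF]]]]] [lG [rG [CG [NG [rG0 CG0 bG]]]]].
split=> [b phi psi sp ss|]; first by rewrite lF// lG//; ring.
exists (Num.max rF rG), (normc a * CF + CG), (maxn NF NG); split.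
- by rewrite le_max rF0.
- by rewrite addr_ge0// mulr_ge0// normc_ge0.
move=> phi M sp b; rewrite (le_trans (normcD _ _))// Normc.normcM mulrDl -mulrA.
have hF : bnd rF NF phi M.
  by move=> s sN x xr; apply: b; rewrite ?le_max ?xr// (leq_trans sN)// leq_maxl.
have hG : bnd rG NG phi M.
  by move=> s sN x xr; apply: b; rewrite ?le_max ?xr ?orbT// (leq_trans sN)// leq_maxr.
by apply: lerD; [apply: ler_wpM2l; [exact: normc_ge0 | exact: bF] | exact: bG].
Qed.

Lemma cdist_iterDC s c : cdist (fun phi => iterDC s phi c).
Proof.
split=> [a phi psi sp ss|]; first by rewrite iterDC_lin.
exists `|c|, 1, (size s); split=> // phi M sp b.
by rewrite mul1r; apply: b.
Qed.

Lemma cdist_comb (L : seq (R[i] * seq 'I_n)) c :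
  cdist (fun phi => \sum_(cs <- L) cs.1 * iterDC cs.2 phi c).
Proof.
elim: L => [|cs L ih].
  under eq_fun do rewrite big_nil; exact: cdist_zero.
under eq_fun do rewrite big_cons; exact: (cdist_axpy cs.1 (cdist_iterDC cs.2 c) ih).
Qed.

(** When a letter occurs more often than the exponent allows, the falling factorial is 0, so the
    truncated subtraction is harmless. *)
Lemma iterD_tmon s c m : iterD s (tmon c m) = fun x =>
  (\prod_l (m l ^_ count_mem l s))%:R * tmon c (fun l => m l - count_mem l s)%N x.
Proof.
elim/last_ind : s m => [|s i ih] m.
  apply/funext => x /=; rewrite big1 ?mul1r//.
  by congr (tmon _ _ x); apply/funext => l; rewrite subn0.
rewrite iterD_rcons Dr_tmon.
have iterDZ (k : R) g : smooth g -> iterD s (fun x => k * g x) = fun x => k * iterD s g x.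
  elim/last_ind : (s) g => [//|t j iht] g sg.
  by rewrite !iterD_rcons DrZ// iht//; apply: smooth_Dr.
rewrite iterDZ; last exact: smooth_tmon.
rewrite ih; apply/funext => x; rewrite mulrA -natrM; congr (_ * tmon _ _ x).
  congr _%:R; rewrite (bigD1 i)//= [RHS](bigD1 i)//= mulnA; congr (_ * _)%N.
    by rewrite eqxx subn1 -cats1 count_cat /= eqxx addn0 addn1 ffactnS.
  apply: eq_bigr => l /negbTE li.
  by rewrite li subn0 -cats1 count_cat /= eq_sym li !addn0.
apply/funext => l; rewrite -cats1 count_cat /= addn0 [i == l]eq_sym.
by rewrite -subnDA addnC.
Qed.

Lemma tmon_center c m : tmon c m c = (\prod_l (m l == 0)%N)%:R.
Proof.
rewrite /tmon natr_prod; apply: eq_bigr => l _; rewrite subrr.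
by case: (m l) => [|k]; rewrite ?expr0// exprS mul0r.
Qed.

Definition word (g : 'I_n -> nat) : seq 'I_n := flatten [seq nseq (g l) l | l <- enum 'I_n].

Lemma count_word g l : count_mem l (word g) = g l.
Proof.
rewrite /word count_flatten -map_comp sumnE big_map big_enum /= (bigD1 l)//=.
rewrite count_nseq /= eqxx mul1n big1 ?addn0// => j jl.
by rewrite count_nseq /= (negbTE jl).
Qed.

Lemma tmon_dense c F : cdist F -> (forall m, F (fun x => (tmon c m x)%:C) = 0) ->
  forall phi, csmooth phi -> F phi = 0.
Proof.
move=> dF F0.
have sM m : csmooth (fun x => (tmon c m x)%:C) by apply/csmooth_real/smooth_tmon.
have M1 : (fun x => (tmon c (fun=> 0%N) x)%:C) = fun=> 1.
  by apply/funext => x; rewrite /tmon big1 // => l _; rewrite expr0.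
have MM m1 m2 x : (tmon c m1 x)%:C * (tmon c m2 x)%:C = (tmon c (fun j => m1 j + m2 j)%N x)%:C.
  by rewrite -rmorphM tmonM.
apply: (@cdist_dense R n _ (fun m x => (tmon c m x)%:C) sM _ M1 _ MM) => // l.
rewrite (_ : (fun x => _) = fun x => (tmon c (fun j => (j == l) : nat) x)%:C + (c 0 l)%:C).
  apply: cspanD; first exact: (@cspan_gen R n _ (fun m x => (tmon c m x)%:C)).
  exact: (@cspan_cst R n _ (fun m x => (tmon c m x)%:C) _ M1).
apply/funext => x; rewrite /tmon (bigD1 l)//= eqxx expr1 big1 ?mulr1.
  by rewrite -rmorphD subrK.
by move=> j /negbTE ->; rewrite expr0.
Qed.

(** The coefficients are [F ((x - c)^g) / g!] for the multi-indices [g] with all entries below [K].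
    Both sides agree on every monomial centred at [c], and density replaces Taylor's formula: a
    monomial with an exponent at least [K] is killed on the left and has zero derivatives of these
    orders at [c]. *)
Lemma local_structure F c (K : nat) : cdist F ->
  (forall l, kills F (fun x => (x 0 l - c 0 l)%:C ^+ K)) ->
  exists L : seq (R[i] * seq 'I_n), forall phi, csmooth phi ->
    F phi = \sum_(cs <- L) cs.1 * iterDC cs.2 phi c.
Proof.
move=> dF kF.
pose fl (g : {ffun 'I_n -> 'I_K}) (l : 'I_n) : nat := g l.
pose L := [seq ((\prod_l (fl g l)`!)%:R^-1 * F (fun x => (tmon c (fl g) x)%:C), word (fl g))
  | g <- enum {ffun 'I_n -> 'I_K}] : seq (R[i] * seq 'I_n).
exists L => phi sphi; apply/eqP; rewrite -subr_eq0 -opprB oppr_eq0; apply/eqP.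
pose G phi := -1 * F phi + \sum_(cs <- L) cs.1 * iterDC cs.2 phi c.
suff : G phi = 0 by rewrite /G mulN1r addrC.
apply: (@tmon_dense c G) => //; first exact: (cdist_axpy _ dF (cdist_comb L c)).
move=> m; rewrite /G /L big_map big_enum /= mulN1r.
under eq_bigr => g _.
  rewrite iterDC_real iterD_tmon tmon_center -natrM -big_split /=.
  under [X in X%:R%:C]eq_bigr => l _ do rewrite count_word.
  over.
have F0 l : (K <= m l)%N -> F (fun x => (tmon c m x)%:C) = 0.
  move=> Kl; pose m' j := (m j - (j == l) * K)%N.
  have -> : (fun x => (tmon c m x)%:C) = fun x => (x 0 l - c 0 l)%:C ^+ K * (tmon c m' x)%:C.
    apply/funext => x; rewrite -rmorphXn -rmorphM; congr (_ %:C).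
    rewrite /tmon (bigD1 l)//= [in RHS](bigD1 l)//= mulrA -exprD /m' eqxx mul1n subnKC//.
    congr (_ * _); apply: eq_bigr => j /negbTE jl.
    by rewrite jl subn0.
  by have [_ ->] := kF l => //; apply/csmooth_real/smooth_tmon.
have [[l Kl]|mK] := pselect (exists l, (K <= m l)%N).
  rewrite (F0 l Kl) oppr0 add0r big1// => g _.
  rewrite [X in X%:R%:C](bigD1 l)//= subn_eq0 leqNgt (leq_trans (ltn_ord _) Kl) muln0 mul0n.
  by rewrite mulr0.
have {}mK l : (m l < K)%N by rewrite ltnNge; apply/negP => h; apply: mK; exists l.
(* Only the term [g = m] survives at [c]: a smaller entry leaves a factor vanishing at [c], a larger
   one kills the falling factorial. *)
pose g0 : {ffun 'I_n -> 'I_K} := [ffun l => Ordinal (mK l)].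
have g0E : fl g0 = m by apply/funext => l; rewrite /fl ffunE.
rewrite (bigD1 g0)//= [X in _ + (_ + X)]big1 ?addr0.
  rewrite g0E; under [X in X%:R%:C]eq_bigr do rewrite ffactnn subnn eqxx muln1.
  rewrite mulrAC rmorph_nat mulVf ?mul1r ?addNr//.
  by rewrite pnatr_eq0 -lt0n prodn_gt0// => l; apply: fact_gt0.
move=> g /eqP gg0.
have [l hl] : exists l, fl g l != m l.
  apply: contrapT => h; apply: gg0; apply/ffunP => l; apply: val_inj => /=.
  rewrite -[LHS]/(fl g l) -[RHS]/(fl g0 l) g0E; apply/eqP/negPn/negP => hl.
  by apply: h; exists l.
rewrite [X in X%:R%:C](bigD1 l)//=.
move: hl; rewrite neq_ltn => /orP[h|h].
  by rewrite subn_eq0 leqNgt h muln0 mul0n mulr0.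
by rewrite ffact_small// !mul0n mulr0.
Qed.

End PointSupport.

(** * Decomposition of a distribution of finite rank *)

Section Idempotents.
Variables (K : fieldType) (s : nat) (ze : 'I_s -> K) (k : nat).
Hypothesis ze_inj : injective ze.

Let fac a : {poly K} := ('X - (ze a)%:P) ^+ k.

Let fac_coprime a b : a != b -> coprimep (fac a) (fac b).
Proof.
move=> ab; apply: coprimep_expl; apply: coprimep_expr.
apply: coprimep_XsubC2; rewrite subr_eq0; apply: contra ab => /eqP/ze_inj ->.
by [].
Qed.

Let fac_coprime_prod (r : seq 'I_s) a : a \notin r -> coprimep (fac a) (\prod_(b <- r) fac b).
Proof.
elim: r => [|b r ih]; first by rewrite big_nil coprimep1.
rewrite in_cons negb_or big_cons => /andP[ab ar].
by rewrite coprimepMr fac_coprime// ih.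
Qed.

(** Chinese remainders: a Bezout relation makes [eps a] equal to 1 modulo its own factor and 0
    modulo the others. The sum is then 1 modulo each of the coprime factors, hence modulo their
    product. *)
Lemma poly_idempotents : exists eps : 'I_s -> {poly K},
  [/\ forall a, \prod_(b | b != a) ('X - (ze b)%:P) ^+ k %| eps a,
      forall a, ('X - (ze a)%:P) ^+ k %| 1 - eps a &
      \prod_b ('X - (ze b)%:P) ^+ k %| 1 - \sum_a eps a].
Proof.
have /choice[u hu] a : exists u : {poly K} * {poly K},
    u.1 * (\prod_(b | b != a) fac b) + u.2 * fac a = 1.
  apply/Bezout_eq1_coprimepP; rewrite coprimep_sym -big_filter.
  by apply: fac_coprime_prod; rewrite mem_filter eqxx.
pose eps a := (u a).1 * (\prod_(b | b != a) fac b).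
have h1 a : \prod_(b | b != a) fac b %| eps a by apply: dvdp_mull.
have h2 a : fac a %| 1 - eps a.
  by rewrite -(hu a) addrAC subrr add0r dvdp_mull.
exists eps; split => //.
suff H (r : seq 'I_s) : uniq r -> \prod_(b <- r) fac b %| 1 - \sum_a eps a.
  by have := H _ (index_enum_uniq _).
elim: r => [|b r ih]; first by rewrite big_nil dvd1p.
rewrite cons_uniq big_cons => /andP[br ur].
rewrite Gauss_dvdp ?fac_coprime_prod// ih// andbT.
rewrite (bigD1 b)//= opprD addrA dvdp_sub// ?h2//.
apply: (big_ind (fun p => fac b %| p)) => [||a ab]; first exact: dvdp0.
  by move=> p q; apply: dvdp_add.
apply: dvdp_trans (h1 a); rewrite (bigD1 b) 1?eq_sym//=.
exact: dvdp_mulr.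
Qed.

End Idempotents.

Section Monomials.
Variables (R : realType) (d : nat).
Local Notation X := 'rV[R]_(d + d).
Implicit Types (phi psi : X -> R[i]) (F : (X -> R[i]) -> R[i]) (a b : 'I_d -> nat).

Lemma zbcE i (x : X) : zbc i x = conjc (zc i x).
Proof. by []. Qed.

Lemma csmooth_zc i : csmooth (@zc R d i).
Proof. exact: csmooth_z. Qed.

Lemma csmooth_zbc i : csmooth (@zbc R d i).
Proof. exact: (csmooth_conj (csmooth_zc i)). Qed.

Lemma csmooth_monomZ a b : csmooth (@monomZ R d a b).
Proof.
apply: csmooth_prod => j _; apply: csmoothM; apply: csmoothX.
  exact: csmooth_zc.
exact: csmooth_zbc.
Qed.

Lemma csmooth_horner (n : nat) (p : {poly R[i]}) (u : 'rV[R]_n -> R[i]) :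
  csmooth u -> csmooth (fun x => p.[u x]).
Proof.
move=> su; under eq_fun do rewrite horner_coef.
by apply: csmooth_sum => k _; apply: csmoothZ; apply: csmoothX.
Qed.

Lemma monomZM a b a' b' (x : X) : monomZ a b x * monomZ a' b' x =
  monomZ (fun j => a j + a' j)%N (fun j => b j + b' j)%N x.
Proof.
rewrite /monomZ -big_split; apply: eq_bigr => j _; rewrite !exprD /=; ring.
Qed.

Lemma monomZ0 : monomZ (fun=> 0%N) (fun=> 0%N) = (fun=> 1 : R[i]) :> (X -> R[i]).
Proof. by apply/funext => x; rewrite /monomZ big1// => j _; rewrite !expr0 mulr1. Qed.

Lemma conj_monomZ a b (x : X) : conjc (monomZ a b x) = monomZ b a x.
Proof.
rewrite /monomZ rmorph_prod; apply: eq_bigr => j _.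
rewrite rmorphM !rmorphXn /= zbcE mulrC; congr (_ ^+ _ * _).
by rewrite /zc opprK.
Qed.

Definition shift_at (i : 'I_d) a : 'I_d -> nat := fun j => (a j + (j == i))%N.

Lemma shift_atE i a b (x : X) : zc i x * monomZ a b x = monomZ (shift_at i a) b x.
Proof.
rewrite /monomZ (bigD1 i)//= [RHS](bigD1 i)//= /shift_at eqxx addn1 exprS -!mulrA.
congr (_ * (_ * (_ * _))); apply: eq_bigr => j /negbTE ji.
by rewrite ji addn0.
Qed.

Lemma iter_shift_at i l a b (x : X) :
  zc i x ^+ l * monomZ a b x = monomZ (iter l (shift_at i) a) b x.
Proof.
elim: l => [|l ih]; first by rewrite expr0 mul1r.
by rewrite exprS -mulrA ih shift_atE.
Qed.

Lemma iter_shift_conj i l a b (x : X) :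
  zbc i x ^+ l * monomZ a b x = monomZ a (iter l (shift_at i) b) x.
Proof.
rewrite -[RHS]conj_monomZ -iter_shift_at rmorphM rmorphXn /= conj_monomZ.
by [].
Qed.

Lemma monomZ_dense F : cdist F -> (forall a b, F (monomZ a b) = 0) ->
  forall phi, csmooth phi -> F phi = 0.
Proof.
move=> dF F0.
pose M (p : ('I_d -> nat) * ('I_d -> nat)) : X -> R[i] := monomZ p.1 p.2.
have sM p : csmooth (M p) by apply: csmooth_monomZ.
have M1 : M (fun=> 0%N, fun=> 0%N) = fun=> 1 by apply: monomZ0.
have MM p q x : M p x * M q x = M (fun j => p.1 j + q.1 j, fun j => p.2 j + q.2 j)%N x.
  by rewrite /M monomZM.
have cz i : cspan M (zc i).
  rewrite (_ : zc i = M (shift_at i (fun=> 0%N), fun=> 0%N)); first exact: cspan_gen.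
  by apply/funext => x; rewrite /M -shift_atE monomZ0 mulr1.
have cb i : cspan M (zbc i).
  rewrite (_ : zbc i = M (fun=> 0%N, shift_at i (fun=> 0%N))); first exact: cspan_gen.
  apply/funext => x; rewrite /M.
  by have := iter_shift_conj i 1 (fun=> 0%N) (fun=> 0%N) x; rewrite expr1 monomZ0 mulr1.
have half : (2 : R[i]) != 0 by rewrite pnatr_eq0.
have iN0 : ('i%C : R[i]) != 0 by rewrite eq_complex /= oner_eq0 andbF.
apply: (@cdist_dense R _ _ M sM _ M1 _ MM) => // [l|p]; last exact: F0.
case: (splitP l) => i li.
  have -> : l = lshift d i by apply: val_inj.
  rewrite (_ : (fun x => _) = fun x => 2^-1 * (zc i x + zbc i x)).
    by apply: cspanZ; apply: cspanD.
  apply/funext => x; apply: (mulfI half); rewrite mulVKf//.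
  by apply: complexP; rewrite !(ReM, ImM, ReD, ImD) /=; ring.
have -> : l = rshift d i by apply: val_inj.
rewrite (_ : (fun x => _) = fun x => (2 * 'i)^-1 * (zc i x + -1 * zbc i x)).
  by apply: cspanZ; apply: cspanD => //; apply: cspanZ.
apply/funext => x; apply: (mulfI (mulf_neq0 half iN0)); rewrite mulVKf ?mulf_neq0//.
by apply: complexP; rewrite !(ReM, ImM, ReD, ImD) /=; ring.
Qed.

Lemma kills_monomZ F psi : cdist F -> csmooth psi ->
  (forall a b, F (fun x => psi x * monomZ a b x) = 0) -> kills F psi.
Proof.
move=> dF sp h; split => // phi sphi.
exact: (monomZ_dense (cdist_mul dF sp) h).
Qed.

End Monomials.

(** * Polynomials in one coordinate that annihilate the distribution *)

Section Recurrence.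
Variables (R : realType) (d m : nat).
Local Notation X := 'rV[R]_(d + d).
Variable F : (X -> R[i]) -> R[i].
Hypothesis dF : cdist F.

Lemma cdist_horner_monomZ i (p : {poly R[i]}) a b :
  F (fun x => p.[zc i x] * monomZ a b x) =
  \sum_(l < size p) p`_l * F (monomZ (iter l (shift_at i) a) b).
Proof.
under eq_fun do rewrite horner_coef mulr_suml.
rewrite (cdist_sum dF) => [|l].
  apply: eq_bigr => l _; under eq_fun do rewrite -mulrA iter_shift_at.
  by rewrite (cdistZ dF _ (csmooth_monomZ _ _ _)).
by under eq_fun do rewrite -mulrA iter_shift_at; apply: csmoothZ; apply: csmooth_monomZ.
Qed.

(** Multiplication by [z_i] shifts the rows, so a recurrence in column [be j] is an annihilation
    tested against the [Zbar^(be j)]. The product over [j] handles all these columns, and the rank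
    factorization expresses every other column through them. *)
Lemma coordinate_annihilator i : inf_rank (AF F) m ->
  exists2 p : {poly R[i]}, p != 0 & kills F (fun x => p.[zc i x]).
Proof.
move=> rF; have [al [be [uM hA]]] := rank_factor rF.
have [D hD] := exp_growth (lshift d i) (rshift d i) dF.
have growth a b : exists2 C : R, 0 <= C & forall rho, 0 <= rho ->
    exists N0, forall N, (N0 <= N)%N -> forall t, normc t <= rho ->
      normc (trunc_sum (shift_at i) (AF F) N a b t) <= C * (1 + rho) ^+ D.
  have [C C0 hC] := hD _ (csmooth_monomZ R a b); exists C => // rho rho0.
  have [N0 hN0] := hC rho rho0; exists N0 => N NN t trho.
  have := hN0 N NN t trho; congr (normc _ <= _).
  have E x : monomZ a b x * (texp N (t * zc i x) * texp N (- conjc t * conjc (zc i x))) =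
      \sum_(k < N) \sum_(l < N) (t ^+ k * (- conjc t) ^+ l * (k`!%:R * l`!%:R)^-1) *
        monomZ (iter k (shift_at i) a) (iter l (shift_at i) b) x.
    rewrite /texp mulr_suml mulr_sumr; apply: eq_bigr => k _.
    rewrite mulr_sumr mulr_sumr; apply: eq_bigr => l _.
    by rewrite -iter_shift_at -iter_shift_conj zbcE !exprMn invfM; ring.
  rewrite -[(fun x => _)]/(fun x => monomZ a b x *
     (texp N (t * zc i x) * texp N (- conjc t * conjc (zc i x)))).
  under eq_fun do rewrite E.
  rewrite (cdist_sum dF) => [|k]; last first.
    by apply: csmooth_sum => l _; apply: csmoothZ; apply: csmooth_monomZ.
  apply: eq_bigr => k _; rewrite (cdist_sum dF) => [|l]; last first.
    by apply: csmoothZ; apply: csmooth_monomZ.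
  by apply: eq_bigr => l _; rewrite (cdistZ dF _ (csmooth_monomZ _ _ _)).
have /choice[p hp] j : exists p : {poly R[i]}, p != 0 /\
    forall a, F (fun x => p.[zc i x] * monomZ a (be j) x) = 0.
  have [p p0 hp] := shift_recurrence uM hA growth j.
  by exists p; split=> // a; rewrite cdist_horner_monomZ; apply: hp.
pose P := \prod_j p j.
have P0 : P != 0 by apply/prodf_neq0 => j _; case: (hp j).
have hP j a : F (fun x => P.[zc i x] * monomZ a (be j) x) = 0.
  rewrite /P (bigD1 j)//=; set q := \prod_(_ | _) _.
  have E x : (p j * q).[zc i x] * monomZ a (be j) x =
      \sum_(l < size q) q`_l * ((p j).[zc i x] * monomZ (iter l (shift_at i) a) (be j) x).
    rewrite hornerM [q.[_]]horner_coef mulr_sumr mulr_suml; apply: eq_bigr => l _.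
    by rewrite -iter_shift_at; ring.
  have sl (l : nat) : csmooth (fun x => (p j).[zc i x] * monomZ (iter l (shift_at i) a) (be j) x).
    apply: csmoothM; last exact: csmooth_monomZ.
    by apply: csmooth_horner; apply: csmooth_zc.
  under eq_fun do rewrite E; rewrite (cdist_sum dF) => [|l]; last exact: csmoothZ.
  apply: big1 => l _; rewrite (cdistZ dF _ (sl l)).
  by have [_ ->] := hp j; rewrite mulr0.
exists P => //; apply: kills_monomZ => //.
  by apply: csmooth_horner; apply: csmooth_zc.
move=> a b; rewrite cdist_horner_monomZ.
under eq_bigr => l _.
  rewrite -[F _]/(AF F _ _) hA mulr_sumr.
  under eq_bigr => j _ do rewrite mulr_sumr.
  over.
rewrite exchange_big big1//= => j _; rewrite exchange_big big1//= => k _.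
under eq_bigr => l _ do rewrite mulrA mulrA.
rewrite -mulr_suml -mulr_suml -cdist_horner_monomZ.
by rewrite hP !mul0r.
Qed.

Lemma inf_rank_conj : inf_rank (AF F) m ->
  inf_rank (AF (fun phi => conjc (F (fun x => conjc (phi x))))) m.
Proof.
have E (k : nat) (rows cols : 'I_k -> 'I_d -> nat) :
  \rank (\matrix_(i < k, j < k) AF (fun phi => conjc (F (fun x => conjc (phi x)))) (rows i) (cols j))
  = \rank (\matrix_(i < k, j < k) AF F (cols i) (rows j)).
  rewrite -[RHS]mxrank_tr -[RHS](mxrank_map (conjc : {rmorphism R[i] -> R[i]})).
  congr (\rank _); apply/matrixP => i j; rewrite !mxE /AF; congr (conjc (F _)).
  by apply/funext => x; rewrite conj_monomZ.
move=> [h1 [k [rows [cols h2]]]]; split=> [k' rows' cols'|]; first by rewrite E.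
by exists k, cols, rows; rewrite E.
Qed.

End Recurrence.

Section Decomposition.
Variables (R : realType) (d : nat).
Local Notation X := 'rV[R]_(d + d).
Variable F : (X -> R[i]) -> R[i].
Hypothesis dF : cdist F.

(** The product of all annihilators serves every coordinate and its conjugate at once, so the
    candidate points form a grid indexed by functions from coordinates to roots. *)
Lemma common_annihilator m : inf_rank (AF F) m ->
  exists s (ze : 'I_s -> R[i]) k, [/\ injective ze,
    forall i, kills F (fun x => (\prod_a ('X - (ze a)%:P) ^+ k).[zc i x]) &
    forall i, kills F (fun x => conjc (\prod_a ('X - (ze a)%:P) ^+ k).[zc i x])].
Proof.
move=> rF.
have /choice[p hp] i : exists p : {poly R[i]}, p != 0 /\ kills F (fun x => p.[zc i x]).
  by have [p p0 kp] := coordinate_annihilator dF i rF; exists p.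
have /choice[q hq] i : exists q : {poly R[i]},
    q != 0 /\ kills F (fun x => conjc q.[zc i x]).
  have [q q0 [sq kq]] := coordinate_annihilator (cdist_conj dF) i (inf_rank_conj rF).
  exists q; split=> //; split; first exact: csmooth_conj.
  move=> phi sphi; apply: (can_inj (@conjcK R)); rewrite conjc0.
  rewrite -(kq _ (csmooth_conj sphi)); congr (conjc (F _)).
  by apply/funext => x; rewrite rmorphM /= conjcK.
pose Q := \prod_i (p i * q i).
have Q0 : Q != 0.
  apply/prodf_neq0 => i _; apply: mulf_neq0; first by case: (hp i).
  by case: (hq i).
have [r Dr] := closed_field_poly_normal Q.
pose Z := undup r; pose ze (a : 'I_(size Z)) := Z`_a.
exists (size Z), ze, (size r).
have zi : injective ze.
  by move=> a b /eqP; rewrite nth_uniq ?undup_uniq// => /eqP/val_inj.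
set P := \prod_a _.
have QP : Q %| P.
  (* The exponent [size r] dominates every multiplicity: each linear factor of [Q] divides its own
     copy of the product over the distinct roots. *)
  have -> : P = \prod_(z <- r) \prod_(a < size Z) ('X - (ze a)%:P).
    rewrite /P exchange_big /=; apply: eq_bigr => a _.
    by rewrite big_const_seq count_predT -Monoid.iteropE.
  rewrite Dr dvdpZl ?lead_coef_eq0// [X in X %| _]big_seq [X in _ %| X]big_seq.
  apply: (big_ind2 (fun p q : {poly R[i]} => p %| q)) => [|p1 p2 q1 q2|z zr].
  - exact: dvd1p.
  - exact: dvdp_mul.
  have zZ : (index z Z < size Z)%N by rewrite index_mem mem_undup.
  rewrite (bigD1 (Ordinal zZ))//= /ze /= nth_index ?mem_undup//.
  exact: dvdp_mulr.
split=> // i.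
  have /dvdpP[w ->] : p i %| P.
    by apply: dvdp_trans QP; rewrite /Q (bigD1 i)//= -mulrA dvdp_mulr.
  under eq_fun do rewrite hornerM.
  apply: killsM; first by case: (hp i).
  by apply: csmooth_horner; apply: csmooth_zc.
have /dvdpP[w ->] : q i %| P.
  by apply: dvdp_trans QP; rewrite /Q (bigD1 i)//= mulrAC dvdp_mull.
under eq_fun do rewrite hornerM rmorphM.
apply: killsM; first by case: (hq i).
by apply: csmooth_conj; apply: csmooth_horner; apply: csmooth_zc.
Qed.

Section Pieces.
Variables (s : nat) (ze : 'I_s -> R[i]) (k : nat).
Hypothesis ze_inj : injective ze.
Let P : {poly R[i]} := \prod_a ('X - (ze a)%:P) ^+ k.
Hypothesis killP : forall i, kills F (fun x => P.[zc i x]).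
Hypothesis killPc : forall i, kills F (fun x => conjc P.[zc i x]).
Variable eps : 'I_s -> {poly R[i]}.
Hypothesis eps_other : forall a, \prod_(b | b != a) ('X - (ze b)%:P) ^+ k %| eps a.
Hypothesis eps_one : forall a, ('X - (ze a)%:P) ^+ k %| 1 - eps a.
Hypothesis eps_sum : P %| 1 - \sum_a eps a.

Let csmooth_pz (p : {poly R[i]}) i : csmooth (fun x : X => p.[zc i x]).
Proof. by apply: csmooth_horner; apply: csmooth_zc. Qed.

Let csmooth_pzc (p : {poly R[i]}) i : csmooth (fun x : X => conjc p.[zc i x]).
Proof. exact: csmooth_conj. Qed.

Definition fixes (G : (X -> R[i]) -> R[i]) psi :=
  csmooth psi /\ forall phi, csmooth phi -> G (fun x => psi x * phi x) = G phi.

Lemma fixes_prod G (J : Type) (t : seq J) (u : J -> X -> R[i]) :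
  (forall j, fixes G (u j)) -> fixes G (fun x => \prod_(j <- t) u j x).
Proof.
move=> h; elim: t => [|j t [st ht]].
  under eq_fun do rewrite big_nil; split=> [|phi _]; first exact: csmooth_cst.
  by congr G; apply/funext => x; rewrite mul1r.
have [sj hj] := h j; under eq_fun do rewrite big_cons; split; first exact: csmoothM.
move=> phi sphi; under eq_fun do rewrite -mulrA.
by rewrite hj ?ht//; apply: csmoothM.
Qed.

Lemma fixes_kills G psi : cdist G -> csmooth psi -> kills G (fun x => 1 - psi x) ->
  fixes G psi.
Proof.
move=> dG sp [s1 k1]; split=> // phi sphi.
have -> : (fun x => psi x * phi x) = fun x => -1 * ((1 - psi x) * phi x) + phi x.
  by apply/funext => x; ring.
by rewrite (cdist_lin dG _ (csmoothM s1 sphi) sphi) k1// mulr0 add0r.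
Qed.

(** A polynomial in [z_1, ..., z_d] that acts on [F] like a cutoff around the grid point with
    coordinates [ze (q i)]. *)
Let e (q : {ffun 'I_d -> 'I_s}) (x : X) := \prod_i (eps (q i)).[zc i x].

Let csmooth_e q : csmooth (e q).
Proof. by apply: csmooth_prod => i _. Qed.

Definition piece q phi := F (fun x => e q x * phi x).

Lemma cdist_piece q : cdist (piece q).
Proof. exact: cdist_mul. Qed.

(** For each [i] the sum of the [eps a] at [z_i] acts on [F] as 1; expanding the product of these
    sums over [i] gives the sum of the [e q]. *)
Lemma piece_sum phi : csmooth phi -> F phi = \sum_q piece q phi.
Proof.
move=> sphi; have fx i : fixes F (fun x => \sum_a (eps a).[zc i x]).
  apply: fixes_kills => //; first exact: csmooth_sum.
  have /dvdpP[w hw] := eps_sum.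
  have -> : (fun x : X => 1 - \sum_a (eps a).[zc i x]) = fun x => w.[zc i x] * P.[zc i x].
    by apply/funext => x; rewrite -hornerM -hw hornerD hornerN horner_sum hornerC.
  exact: killsM.
have [_ h] := fixes_prod (index_enum _) fx; rewrite -h// -(cdist_sum dF) => [|q]; last exact: csmoothM.
congr F; apply/funext => x; rewrite -mulr_suml; congr (_ * _).
by rewrite bigA_distr_bigA.
Qed.

Lemma piece_kills q psi : kills F psi -> kills (piece q) psi.
Proof.
move=> [sp kp]; split=> // phi sphi; rewrite /piece.
by under eq_fun do rewrite mulrCA; apply: kp; apply: csmoothM.
Qed.

Lemma piece_kills_zc q i : kills (piece q) (fun x => (zc i x - ze (q i)) ^+ k).
Proof.
have sz : csmooth (fun x : X => (zc i x - ze (q i)) ^+ k).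
  have := csmooth_pz (('X - (ze (q i))%:P) ^+ k) i.
  by under eq_fun do rewrite !hornerE.
split=> // phi sphi; rewrite /piece.
have /dvdpP[w hw] := eps_other (q i).
have E : ('X - (ze (q i))%:P) ^+ k * eps (q i) = w * P.
  by rewrite hw mulrCA /P [in RHS](bigD1 (q i)).
have -> : (fun x => e q x * ((zc i x - ze (q i)) ^+ k * phi x)) = fun x =>
    P.[zc i x] * (w.[zc i x] * (\prod_(j | j != i) (eps (q j)).[zc j x] * phi x)).
  apply/funext => x; rewrite /e (bigD1 i)//=.
  have := congr1 (horner^~ (zc i x)) E; rewrite /= !hornerM horner_exp hornerXsubC => h.
  by rewrite [RHS]mulrA [_ * w.[_]]mulrC -h; ring.
have [_ kp] := killP i; apply: kp; apply: csmoothM => //; apply: csmoothM => //.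
by apply: csmooth_prod.
Qed.

Lemma piece_kills_zbc q i : kills (piece q) (fun x => conjc (zc i x - ze (q i)) ^+ k).
Proof.
have [su ku] := piece_kills_zc q i.
have sv : csmooth (fun x : X => conjc (zc i x - ze (q i)) ^+ k).
  by under eq_fun do rewrite -[_ ^+ k](rmorphXn conjc); apply: csmooth_conj.
split=> // phi sphi.
pose w : {poly R[i]} := \prod_(b | b != q i) ('X - (ze b)%:P) ^+ k.
(* The claim is [G = 0]. As [conj P] is [conj (z_i - ze (q i))^k] times [conj w], the function
   [conj w] kills [G], and [w] has no zero at [ze (q i)]. *)
pose G phi := piece q (fun x => conjc (zc i x - ze (q i)) ^+ k * phi x).
have dG : cdist G := cdist_mul (cdist_piece q) sv.
apply: (kills_nonvanish (F := G) (u := fun x => (zc i x - ze (q i)) ^+ k)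
  (v := fun x => conjc w.[zc i x])) => //.
- split=> // psi sp; rewrite /G; under eq_fun do rewrite mulrCA.
  by apply: ku; apply: csmoothM.
- split=> // psi sp; rewrite /G.
  have [_ kp] := piece_kills q (killPc i).
  rewrite -[RHS](kp psi sp); congr (piece q _); apply/funext => x.
  rewrite mulrA; congr (_ * _); rewrite /P (bigD1 (q i))//= hornerM rmorphM.
  by rewrite horner_exp hornerXsubC rmorphXn.
- move=> x; case: (posnP k) => [k0|k0].
    by move/eqP; rewrite /= k0 expr0 oner_eq0.
  move/eqP; rewrite expf_eq0 k0 subr_eq0 /= => /eqP ->.
  rewrite conjc_eq0 /w horner_prod; apply/prodf_neq0 => b bq.
  rewrite horner_exp expf_neq0// hornerXsubC subr_eq0.
  by apply: contra bq => /eqP/ze_inj ->.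
Qed.

Definition pt (q : {ffun 'I_d -> 'I_s}) : X :=
  row_mx (\row_i complex.Re (ze (q i))) (\row_i complex.Im (ze (q i))).

Lemma pt_inj : injective pt.
Proof.
move=> q q' /eq_row_mx[/rowP h1 /rowP h2]; apply/ffunP => i; apply: ze_inj.
by apply: complexP; [have := h1 i | have := h2 i]; rewrite !mxE.
Qed.

(** A real coordinate minus its value at [pt q] is a combination of [z_i - ze (q i)] and its
    conjugate; the powers [k] that kill these give the power [k + k]. *)
Lemma piece_structure q : exists L : seq (R[i] * seq 'I_(d + d)),
  forall phi, csmooth phi -> piece q phi = \sum_(cs <- L) cs.1 * iterDC cs.2 phi (pt q).
Proof.
apply: (@local_structure R (d + d) (piece q) (pt q) (k + k)) => [|l]; first exact: cdist_piece.
have half : (2 : R[i]) != 0 by rewrite pnatr_eq0.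
have iN0 : ('i%C : R[i]) != 0 by rewrite eq_complex /= oner_eq0 andbF.
have scale i (c c' : R[i]) : kills (piece q)
    (fun x => (c * (zc i x - ze (q i)) + c' * conjc (zc i x - ze (q i))) ^+ (k + k)).
  have sz : csmooth (fun x : X => zc i x - ze (q i)).
    have := csmooth_pz ('X - (ze (q i))%:P) i.
    by under eq_fun do rewrite !hornerE.
  apply: kills_addX => //; first exact: cdist_piece.
  - under eq_fun do rewrite exprMn; apply: killsM; first exact: piece_kills_zc.
    exact: csmooth_cst.
  - under eq_fun do rewrite exprMn; apply: killsM; first exact: piece_kills_zbc.
    exact: csmooth_cst.
  - exact: csmoothZ.
  - by apply: csmoothZ; apply: csmooth_conj.
case: (splitP l) => i li.
  have -> : l = lshift d i by apply: val_inj.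
  have := scale i 2^-1 2^-1; congr (kills _ _); apply/funext => x; congr (_ ^+ _).
  rewrite /pt row_mxEl mxE; apply: (mulfI half); rewrite mulrDr !mulVKf//.
  by case: (ze (q i)) => a b; apply: complexP; rewrite !(ReM, ImM, ReD, ImD) /=; ring.
have -> : l = rshift d i by apply: val_inj.
have := scale i (2 * 'i)^-1 (- (2 * 'i)^-1); congr (kills _ _).
apply/funext => x; congr (_ ^+ _).
rewrite /pt row_mxEr mxE; apply: (mulfI (mulf_neq0 half iN0)).
rewrite mulrDr mulNr mulrN !mulVKf ?mulf_neq0//.
by case: (ze (q i)) => a b; apply: complexP; rewrite !(ReM, ImM, ReD, ImD) /=; ring.
Qed.

(** On [piece q], powers of [conj (z_i - ze (q i))] act as 0. Hence [conj (eps (q i))] acts as 1,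
    while at a coordinate where [q] and [q'] differ [conj (eps (q' i))] acts as 0. *)
Lemma piece_orthogonal q q' phi : csmooth phi ->
  F (fun x => e q x * (conjc (e q' x) * phi x)) = if q == q' then piece q phi else 0.
Proof.
move=> sphi; rewrite -/(piece q _).
have E x : conjc (e q' x) = \prod_i conjc (eps (q' i)).[zc i x] by rewrite rmorph_prod.
have kz i : kills (piece q) (fun x => conjc (('X - (ze (q i))%:P) ^+ k).[zc i x]).
  have := piece_kills_zbc q i; congr (kills _ _); apply/funext => x.
  by rewrite horner_exp hornerXsubC rmorphXn.
case: eqVneq => [<-|qq'].
  have fx i : fixes (piece q) (fun x => conjc (eps (q i)).[zc i x]).
    apply: fixes_kills => //; first exact: cdist_piece.
    have /dvdpP[w hw] := eps_one (q i).
    have -> : (fun x : X => 1 - conjc (eps (q i)).[zc i x]) = fun x =>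
        conjc w.[zc i x] * conjc (('X - (ze (q i))%:P) ^+ k).[zc i x].
      apply/funext => x; rewrite -rmorphM -hornerM -hw hornerD hornerN hornerC.
      by rewrite rmorphB rmorph1.
    exact: killsM.
  have [_ h] := fixes_prod (index_enum _) fx.
  rewrite -[RHS]h//; congr (piece q _); apply/funext => x; congr (_ * _).
  by rewrite rmorph_prod.
have [i qi] : exists i, q i != q' i.
  apply: contrapT => h; move/eqP: qq'; apply; apply/ffunP => i.
  by apply/eqP/negPn/negP => hi; apply: h; exists i.
have /dvdpP[w hw] : ('X - (ze (q i))%:P) ^+ k %| eps (q' i).
  by apply: dvdp_trans (eps_other (q' i)); rewrite (bigD1 (q i))//= dvdp_mulr.
have -> : (fun x => conjc (e q' x) * phi x) = fun x =>
    conjc (('X - (ze (q i))%:P) ^+ k).[zc i x] * (conjc w.[zc i x] *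
     ((\prod_(j | j != i) conjc (eps (q' j)).[zc j x]) * phi x)).
  by apply/funext => x; rewrite E (bigD1 i)//= hw hornerM rmorphM /=; ring.
have [_ kp] := kz i; apply: kp; apply: csmoothM => //; apply: csmoothM => //.
exact: csmooth_prod.
Qed.

(* Multiplying the [z]-monomials by [e q] and the [conj z]-monomials by [conj (e q')] makes
   the moment matrix diagonal, with a nonzero entry for every nonzero piece. *)
Lemma card_pieces m (T : {set {ffun 'I_d -> 'I_s}}) : inf_rank (AF F) m ->
  (forall q, q \in T -> exists a b, piece q (monomZ a b) != 0) -> (#|T| <= m)%N.
Proof.
move=> rF hT; have [al [be [uM hA]]] := rank_factor rF.
pose o : 'I_d -> nat := fun=> 0%N.
pose Mz (a : 'I_d -> nat) : X -> R[i] := monomZ a o.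
have sMz a : csmooth (Mz a) by apply: csmooth_monomZ.
have Mz1 : Mz o = fun=> 1 by apply: monomZ0.
have MzM a b x : Mz a x * Mz b x = Mz (fun j => a j + b j)%N x by rewrite /Mz monomZM.
have cz i : cspan Mz (zc i).
  rewrite (_ : zc i = Mz (shift_at i o)); first exact: cspan_gen.
  by apply/funext => x; rewrite /Mz -shift_atE monomZ0 mulr1.
have ce q a : cspan Mz (fun x => e q x * Mz a x).
  apply: (cspanM MzM); last exact: cspan_gen.
  apply: (cspan_prod Mz1 MzM) => i.
  exact: (cspan_horner Mz1 MzM).
have sce p : cspan Mz p -> csmooth p by apply: cspan_smooth.
have lin (c : R[i]) p1 p2 g : csmooth p1 -> csmooth p2 -> csmooth g ->
    F (fun x => (c * p1 x + p2 x) * g x) = c * F (fun x => p1 x * g x) + F (fun x => p2 x * g x).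
  move=> s1 s2 sg; rewrite -(cdist_lin dF c (csmoothM s1 sg) (csmoothM s2 sg)).
  by congr F; apply/funext => x; ring.
have F0 g : F (fun x => 0 * g x) = 0.
  by under eq_fun do rewrite mul0r; apply: (cdist0 dF).
pose W := invmx (\matrix_(i, j) AF F (al i) (be j)).
(* The rank factorization, extended by sesquilinearity from monomials to all [p] and [r] in the span
   of the [z]-monomials. *)
pose B (p r : X -> R[i]) := \sum_j \sum_i F (fun x => p x * monomZ o (be j) x) *
   W j i * F (fun x => Mz (al i) x * conjc (r x)).
have bil1 a r : cspan Mz r -> F (fun x => Mz a x * conjc (r x)) = B (Mz a) r.
  have conjE (g h : X -> R[i]) : F (fun x => g x * conjc (h x)) = F (fun x => conjc (h x) * g x).
    by congr F; apply/funext => x; rewrite mulrC.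
  have E a' b : F (fun x => Mz a' x * conjc (Mz b x)) = AF F a' b.
    congr F; apply/funext => x; rewrite conj_monomZ monomZM; congr (monomZ _ _ x).
    by apply/funext => j; rewrite addn0.
  have E' a' b : F (fun x => Mz a' x * monomZ o b x) = AF F a' b.
    by rewrite -E; congr F; apply/funext => x; rewrite conj_monomZ.
  elim=> [|c b r' cr' ih].
    rewrite conjE conjc0 F0 /B big1// => j _; rewrite big1// => i _.
    by rewrite conjE conjc0 F0 mulr0.
  have L a' : F (fun x => Mz a' x * conjc (c * Mz b x + r' x)) =
      conjc c * AF F a' b + F (fun x => Mz a' x * conjc (r' x)).
    have -> : (fun x => Mz a' x * conjc (c * Mz b x + r' x)) = fun x =>
        (conjc c * conjc (Mz b x) + conjc (r' x)) * Mz a' x.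
      by apply/funext => x; rewrite rmorphD rmorphM mulrC.
    rewrite (lin _ _ _ _ (csmooth_conj (sMz b)) (csmooth_conj (sce _ cr')) (sMz a')).
    by rewrite -!conjE E.
  rewrite L ih hA mulr_sumr /B -big_split; apply: eq_bigr => j _ /=.
  rewrite mulr_sumr -big_split; apply: eq_bigr => i _ /=.
  by rewrite L E' /W; ring.
have bil p r : cspan Mz p -> cspan Mz r -> F (fun x => p x * conjc (r x)) = B p r.
  move=> cp cr; have sr : csmooth (fun x => conjc (r x)) by apply/csmooth_conj/sce.
  elim: cp => [|c a p' cp' ih].
    by rewrite F0 /B big1// => j _; rewrite big1// => i _; rewrite F0 !mul0r.
  rewrite lin//; last exact: sce.
  rewrite ih bil1// mulr_sumr /B -big_split; apply: eq_bigr => j _ /=.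
  rewrite mulr_sumr -big_split; apply: eq_bigr => i _ /=.
  rewrite lin//; [by ring | exact: sce | exact: csmooth_monomZ].
have /choice[a ha] q : exists a : ('I_d -> nat) * ('I_d -> nat),
    q \in T -> piece q (monomZ a.1 a.2) != 0.
  have [qT|qT] := boolP (q \in T); last by exists (o, o).
  by have [a [b hab]] := hT q qT; exists (a, b).
pose p (i : 'I_#|T|) x := e (enum_val i) x * Mz (a (enum_val i)).1 x.
pose r (i : 'I_#|T|) x := e (enum_val i) x * Mz (a (enum_val i)).2 x.
pose N := \matrix_(i, j) F (fun x => p i x * conjc (r j x)).
have uN : N \in unitmx.
  have -> : N = diag_mx (\row_i piece (enum_val i) (monomZ (a (enum_val i)).1 (a (enum_val i)).2)).
    apply/matrixP => i j; rewrite !mxE.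
    have -> : (fun x => p i x * conjc (r j x)) = fun x => e (enum_val i) x *
        (conjc (e (enum_val j) x) * monomZ (a (enum_val i)).1 (a (enum_val j)).2 x).
      apply/funext => x; rewrite /p /r rmorphM /= conj_monomZ.
      have -> : monomZ (a (enum_val i)).1 (a (enum_val j)).2 x =
          Mz (a (enum_val i)).1 x * monomZ o (a (enum_val j)).2 x.
        by rewrite monomZM; congr (monomZ _ _ x); apply/funext => l; rewrite ?addn0.
      by ring.
    rewrite piece_orthogonal; last exact: csmooth_monomZ.
    by rewrite (inj_eq enum_val_inj); case: eqP => [->|_]; rewrite ?mulr1n ?mulr0n.
  rewrite unitmxE det_diag unitfE; apply/prodf_neq0 => i _; rewrite mxE.
  by apply: ha; apply: enum_valP.
rewrite -(mxrank_unit uN).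
(* The invertible matrix [N] factors through dimension [m]. *)
have -> : N = \matrix_(i, j) F (fun x => p i x * monomZ o (be j) x) *m
    (W *m \matrix_(i, j) F (fun x => Mz (al i) x * conjc (r j x))).
  apply/matrixP => i j; rewrite !mxE bil; [|exact: ce|exact: ce].
  apply: eq_bigr => l _; rewrite !mxE mulr_sumr; apply: eq_bigr => l' _.
  by rewrite !mxE mulrA.
exact: leq_trans (mxrankM_maxl _ _) (rank_leq_col _).
Qed.

End Pieces.

Lemma finite_rank_decomposition m : inf_rank (AF F) m ->
  exists (pts : seq X) (L : X -> seq (R[i] * seq 'I_(d + d))), (size pts <= m)%N /\
    forall phi, csmooth phi ->
      F phi = \sum_(q <- pts) \sum_(cs <- L q) cs.1 * iterDC cs.2 phi q.
Proof.
move=> rF; have [s [ze [k [zi kP kPc]]]] := common_annihilator rF.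
have [eps [h1 h2 h3]] := poly_idempotents k zi.
have /choice[L hL] := piece_structure zi kP kPc h1.
pose T : {set {ffun 'I_d -> 'I_s}} :=
  finset (fun q => `[< exists a b, piece eps q (monomZ a b) != 0 >]).
have cT : (#|T| <= m)%N.
  by apply: (card_pieces zi kP kPc h1 h2 rF) => q; rewrite inE => /asboolP.
(* Reindexes operators from grid indices to points; [pt_inj] makes the index unique, and the empty
   list is the default off the grid. *)
pose L' (x : X) := if [pick q | pt ze q == x] is Some q then L q else [::].
exists [seq pt ze q | q <- enum T], L'; split; first by rewrite size_map -cardE.
move=> phi sphi; rewrite big_map big_enum /= (piece_sum kP h3 sphi).
rewrite (bigID (mem T)) /= [X in _ + X]big1 ?addr0 => [|q].
  apply: eq_bigr => q _; rewrite hL// /L'.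
  by case: pickP => [q' /eqP/(pt_inj zi) -> //|/(_ q)]; rewrite eqxx.
(* A piece outside [T] vanishes on all monomials, hence everywhere by density. *)
rewrite inE => /asboolPn hq; apply: (monomZ_dense (cdist_piece eps q)) => // a b.
by apply/eqP/negPn/negP => hab; apply: hq; exists a, b.
Qed.

End Decomposition.

(** * Support of a finite combination of derivatives *)

Section LocalDerivatives.
Variables (R : realType) (n : nat).
Local Notation X := 'rV[R]_n.

(** Vanishing at [q] alone says nothing about the next derivative, so the induction carries
    vanishing on a neighbourhood. *)
Lemma iterD_local (f : X -> R) s (q : X) : (\near q, f q = 0) -> iterD s f q = 0.
Proof.
suff H : (\near q, f q = 0) -> \near q, iterD s f q = 0.
  by move=> /H; exact: nbhs_singleton.
move=> h; elim: s => // i s ih.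
rewrite iterD_cons; apply: filterS (nbhs_interior ih) => y hy.
rewrite DrP -(derive_cst (0 : R) y (evec R i)).
exact: near_eq_derive.
Qed.

End LocalDerivatives.

Lemma support_of_combination (R : realType) n (F : ('rV[R]_n -> R[i]) -> R[i])
    (pts : seq 'rV[R]_n) (L : 'rV[R]_n -> seq (R[i] * seq 'I_n)) :
  (forall phi, smoothC phi ->
     F phi = \sum_(q <- pts) \sum_(cs <- L q) cs.1 * iterDC cs.2 phi q) ->
  dsupport F `<=` [set x | x \in pts].
Proof.
move=> hF x hx; apply: contrapT => /= /negP xpts; apply: hx.
(* A strict inequality: a test function that vanishes at distance at least [e] from [x] is then zero
   near every [q] in [pts]. *)
have [e e0 he] : exists2 e : R, 0 < e & forall q, q \in pts -> e < `|q - x|.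
  elim: pts xpts {hF} => [|q pts ih]; first by exists 1.
  rewrite in_cons negb_or => /andP[xq /ih[e e0 he]].
  have q0 : 0 < `|q - x| by rewrite normr_gt0 subr_eq0 eq_sym.
  exists (Num.min e (`|q - x| / 2)); first by rewrite lt_min e0 divr_gt0.
  move=> p; rewrite in_cons => /orP[/eqP->|/he pe]; rewrite gt_min ?pe//.
  by apply/orP; right; rewrite ltr_pdivrMr// ltr_pMr// ltr1n.
exists e; split=> // phi sphi h0; rewrite hF// big_seq big1// => q qpts.
have nq : \near q, phi q = 0.
  have r0 : 0 < `|q - x| - e by rewrite subr_gt0 he.
  apply/nbhs_ballP; exists (`|q - x| - e) => //= y; rewrite -ball_normE /ball_ /= => qy.
  apply: h0; have : `|q - x| <= `|q - y| + `|y - x|.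
    by rewrite (le_trans _ (ler_normD _ _))// addrA subrK.
  by move: qy; lra.
rewrite big1// => cs _; rewrite (_ : iterDC _ _ _ = 0) ?mulr0//.
by apply: complexP => /=; apply: iterD_local; apply: filterS nq => y ->.
Qed.

Theorem theorem4p1 (R : realType) (d m : nat)
    (F : ('rV[R]_(d + d) -> R[i]) -> R[i]) :
  comp_supp_distribution F ->
  inf_rank (AF F) m ->
  exists (pts : seq 'rV[R]_(d + d))
         (L : 'rV[R]_(d + d) -> seq (R[i] * seq 'I_(d + d))),
    (size pts <= m)%N /\
    dsupport F `<=` [set x | x \in pts] /\
    forall phi : 'rV[R]_(d + d) -> R[i], smoothC phi ->
      F phi = \sum_(q <- pts) \sum_(cs <- L q) cs.1 * iterDC cs.2 phi q.
Proof.
move=> /comp_supp_cdist dF /(finite_rank_decomposition dF)[pts [L [spts hF]]].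
have {}hF phi : smoothC phi ->
    F phi = \sum_(q <- pts) \sum_(cs <- L q) cs.1 * iterDC cs.2 phi q.
  by move=> /csmoothP; apply: hF.
exists pts, L; split=> //; split=> //.
exact: support_of_combination hF.
Qed.
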